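(* Suppose that $\mathbf{V}$ is a universe of set theory (ZFC) in which $\lambda,\kappa,\mu$ are cardinals with \[ \aleph_0\le\lambda=\lambda^{<\lambda}<\lambda^+=\kappa<\lambda^{++}<\mu \] and $\mu^{\lambda^+}=\mu$, while $2^\lambda=\kappa$ and $2^{\kappa}=\kappa^+$. Then there is a cofinality and cardinality preserving forcing extension of $\mathbf{V}$ in which no bounded subsets are added to $\kappa$ and the following hold: (i) $2^\lambda=\lambda^+$ and $2^{\lambda^+}=\mu$; (ii) every locally $<\kappa$ Hausdorff topological space $X$ of size $\le\kappa^+$ such that for every open neighbourhood assignment $U^*$ of $X$ there is a finer open neighbourhood assignment $U$ of $X$ with respect to which all open subspaces of $X$ of size $\le\kappa$ are $\kappa$-$D$, is a $D$-space.
   Context: An open neighbourhood assignment (ONA) in a topological space $(X,\tau)$ is a function $U:X\to\tau$ such that $x\in U(x)$ for all $x\in X$. For $D\subseteq X$ write $\bigcup U``D=\bigcup\{U(x):x\in D\}$. $X$ is a $D$-space (is $D$) iff for every ONA $U$ of $X$ there is a closed discrete $D\subseteq X$ with $\bigcup U``D=X$. An ONA $V$ is finer than $U$ iff $V(x)\subseteq U(x)$ for all $x\in X$. $X$ is locally $<\kappa$ iff there is an ONA $U$ of $X$ with $|U(x)|<\kappa$ for all $x\in X$. A subset $D\subseteq X$ is $U$-sticky iff $D$ is closed discrete in $X$ and for all $x\in X$, $U(x)\cap D\ne\emptyset$ implies $x\in\bigcup U``D$. For a regular cardinal $\kappa\ge\aleph_1$, $\mathbb{P}^\kappa_U(X)$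 is the set of all $U$-sticky $D\subseteq X$ with $|D|<\kappa$, ordered by: $D\le D'$ ($D'$ is stronger) iff $D\subseteq D'$ and $(D'\setminus D)\cap\bigcup U``D=\emptyset$. $X$ is $\kappa$-$D$ with respect to an ONA $U$ of $X$ iff for every $D\in\mathbb{P}^\kappa_U(X)$ and every $x\in X$ there is $D'\ge D$ in $\mathbb{P}^\kappa_U(X)$ with $x\in\bigcup U``D'$. If $U$ is an ONA of $X$ and $Y\subseteq X$ is a subspace, then ''$Y$ is $\kappa$-$D$ with respect to $U$'' means that $Y$, with the subspace topology, is $\kappa$-$D$ with respect to the ONA $y\mapsto U(y)\cap Y$ of $Y$. *)

(* Defs.v *)
Declare Scope fm_scope.
Delimit Scope fm_scope with fm.

(** ** Formulas of set theory

  [fm A]: formulas with parameters in [A], with higher-order abstract syntax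
  for the quantifiers.  Nothing in the type forces the bodies of [All] and [Ex]
  to be uniform in the bound variable, so axiom schemes do not range over
  [fm A] but over the genuinely first-order [formula] below.  The formulas
  defined in this file are all uniform in [A] and in their parameters. *)

Inductive fm (A : Type) : Type :=
| Mem (x y : A)
| Eq (x y : A)
| Not (p : fm A)
| And (p q : fm A)
| Or (p q : fm A)
| Imp (p q : fm A)
| All (p : A -> fm A)
| Ex (p : A -> fm A).

Arguments Mem {A}. Arguments Eq {A}. Arguments Not {A}. Arguments And {A}.
Arguments Or {A}. Arguments Imp {A}. Arguments All {A}. Arguments Ex {A}.
Bind Scope fm_scope with fm.

Notation "x ∈ y" := (Mem x y) (at level 70) : fm_scope.
Notation "x ≡ y" := (Eq x y) (at level 70) : fm_scope.
Notation "¬ p" := (Not p) (at level 75, right associativity) : fm_scope.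
Notation "p ∧ q" := (And p q) (at level 80, right associativity) : fm_scope.
Notation "p ∨ q" := (Or p q) (at level 85, right associativity) : fm_scope.
Notation "p ⇒ q" := (Imp p q) (at level 99, right associativity) : fm_scope.
Notation "p ⇔ q" := (And (Imp p q) (Imp q p)) (at level 95) : fm_scope.
Notation "∀ x .. y , p" := (All (fun x => .. (All (fun y => p%fm)) ..))
  (at level 200, x binder, y binder, right associativity) : fm_scope.
Notation "∃ x .. y , p" := (Ex (fun x => .. (Ex (fun y => p%fm)) ..))
  (at level 200, x binder, y binder, right associativity) : fm_scope.
Notation "∀[ x ∈ a ] p" := (All (fun x => Imp (Mem x a) p%fm))
  (at level 200, x name, a at level 69, p at level 200) : fm_scope.
Notation "∃[ x ∈ a ] p" := (Ex (fun x => And (Mem x a) p%fm))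
  (at level 200, x name, a at level 69, p at level 200) : fm_scope.
Open Scope fm_scope.

Fixpoint holds {V : Type} (mem : V -> V -> Prop) (p : fm V) : Prop :=
  match p with
  | Mem x y => mem x y
  | Eq x y => x = y
  | Not p => ~ holds mem p
  | And p q => holds mem p /\ holds mem q
  | Or p q => holds mem p \/ holds mem q
  | Imp p q => holds mem p -> holds mem q
  | All p => forall x, holds mem (p x)
  | Ex p => exists x, holds mem (p x)
  end.

(** ** Basic set theory *)

Section SetTheory.
Context {A : Type}.
Implicit Types a b c d e f k l m o s t u v w x y z X Y D U : A.

Definition subset x y : fm A := ∀ z, z ∈ x ⇒ z ∈ y.
Definition empty x : fm A := ∀ z, ¬ z ∈ x.
Definition is_upair a b c : fm A := ∀ z, z ∈ c ⇔ (z ≡ a ∨ z ≡ b).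
Definition is_pair a b c : fm A :=
  ∃ s t, is_upair a a s ∧ is_upair a b t ∧ is_upair s t c.
Definition is_union s u : fm A := ∀ z, z ∈ u ⇔ (∃[y ∈ s] z ∈ y).
Definition is_inter a b c : fm A := ∀ z, z ∈ c ⇔ (z ∈ a ∧ z ∈ b).
Definition is_power x s : fm A := ∀ z, z ∈ s ⇔ subset z x.
Definition is_succ x y : fm A := ∀ z, z ∈ y ⇔ (z ∈ x ∨ z ≡ x).

(** [(a, b)] belongs to [f]. *)
Definition rel f a b : fm A := ∃ c, is_pair a b c ∧ c ∈ f.

Definition is_fun f a b : fm A :=
  (∀[c ∈ f] ∃[x ∈ a] ∃[y ∈ b] is_pair x y c) ∧
  (∀[x ∈ a] ∃[y ∈ b] rel f x y ∧ ∀ y', rel f x y' ⇒ y' ≡ y).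
Definition injective f : fm A := ∀ x x' y, rel f x y ∧ rel f x' y ⇒ x ≡ x'.
Definition surjective f b : fm A := ∀[y ∈ b] ∃ x, rel f x y.

Definition card_le a b : fm A := ∃ f, is_fun f a b ∧ injective f.
Definition card_lt a b : fm A := card_le a b ∧ ¬ card_le b a.
Definition card_eq a b : fm A :=
  ∃ f, is_fun f a b ∧ injective f ∧ surjective f b.

Definition transitive x : fm A := ∀[y ∈ x] subset y x.
Definition ordinal x : fm A := transitive x ∧ ∀[y ∈ x] transitive y.
Definition cardinal k : fm A := ordinal k ∧ ∀[a ∈ k] ¬ card_eq a k.
Definition is_card_of x k : fm A := cardinal k ∧ card_eq x k.

Definition is_omega w : fm A :=
  ordinal w ∧ (∃[x ∈ w] empty x) ∧ (∀[x ∈ w] ∃[y ∈ w] is_succ x y) ∧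
  (∀[x ∈ w] empty x ∨ ∃[y ∈ w] is_succ y x).
Definition infinite_cardinal k : fm A :=
  cardinal k ∧ ∃ w, is_omega w ∧ subset w k.

(** [l] is the cardinal successor of [k]. *)
Definition succ_card k l : fm A :=
  cardinal l ∧ k ∈ l ∧ ∀ m, cardinal m ∧ k ∈ m ⇒ (l ≡ m ∨ l ∈ m).

(** [m ^ k = e]. *)
Definition card_exp m k e : fm A :=
  ∃ s, (∀ f, f ∈ s ⇔ is_fun f k m) ∧ is_card_of s e.

(** [m ^ (<k) = e]: [e] is the cardinality of the set of all functions from an
    ordinal below [k] to [m]. *)
Definition card_exp_lt m k e : fm A :=
  ∃ s, (∀ f, f ∈ s ⇔ (∃[a ∈ k] is_fun f a m)) ∧ is_card_of s e.

Definition is_two t : fm A := ∃ a b, empty a ∧ is_succ a b ∧ is_succ b t.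
Definition card_exp2 k e : fm A := ∃ t, is_two t ∧ card_exp t k e.

Definition cofinal_map f d a : fm A :=
  is_fun f d a ∧ ∀[x ∈ a] ∃[i ∈ d] ∃[y ∈ a] rel f i y ∧ (x ≡ y ∨ x ∈ y).
(** [d] is the cofinality of the ordinal [a]. *)
Definition is_cof a d : fm A :=
  ordinal a ∧ ordinal d ∧ (∃ f, cofinal_map f d a) ∧
  ∀[e ∈ d] ¬ ∃ f, cofinal_map f e a.

(** ** Topology: [X] is a space with set of open sets [t] *)

Definition topology X t : fm A :=
  (∀[u ∈ t] subset u X) ∧ X ∈ t ∧
  (∀ s, subset s t ⇒ ∀ u, is_union s u ⇒ u ∈ t) ∧
  (∀[u ∈ t] ∀[v ∈ t] ∀ w, is_inter u v w ⇒ w ∈ t).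

Definition hausdorff X t : fm A :=
  ∀[x ∈ X] ∀[y ∈ X] ¬ x ≡ y ⇒
    ∃[u ∈ t] ∃[v ∈ t] x ∈ u ∧ y ∈ v ∧ ¬ ∃ z, z ∈ u ∧ z ∈ v.

Definition closed_in X t D : fm A :=
  subset D X ∧ ∃[c ∈ t] ∀ z, z ∈ c ⇔ (z ∈ X ∧ ¬ z ∈ D).
Definition discrete_in t D : fm A :=
  ∀[x ∈ D] ∃[u ∈ t] ∀ z, (z ∈ u ∧ z ∈ D) ⇔ z ≡ x.
Definition closed_discrete X t D : fm A := closed_in X t D ∧ discrete_in t D.

Definition ona X t U : fm A :=
  is_fun U X t ∧ ∀[x ∈ X] ∀ u, rel U x u ⇒ x ∈ u.

(** [z] belongs to [U(x)]. *)
Definition in_nbhd U x z : fm A := ∃ u, rel U x u ∧ z ∈ u.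
(** [z] belongs to the union of the [U(x)] for [x] in [D]. *)
Definition covered U D z : fm A := ∃[x ∈ D] in_nbhd U x z.

Definition finer X V U : fm A :=
  ∀[x ∈ X] ∀ z, in_nbhd V x z ⇒ in_nbhd U x z.

Definition D_space X t : fm A :=
  ∀ U, ona X t U ⇒ ∃ D, closed_discrete X t D ∧ ∀[x ∈ X] covered U D x.

Definition locally_lt k X t : fm A :=
  ∃ U, ona X t U ∧ ∀[x ∈ X] ∀ u, rel U x u ⇒ card_lt u k.

Definition sticky X t U D : fm A :=
  closed_discrete X t D ∧
  ∀[x ∈ X] (∃[z ∈ D] in_nbhd U x z) ⇒ covered U D x.

Definition sticky_cond k X t U D : fm A := sticky X t U D ∧ card_lt D k.
Definition sticky_ext U D D' : fm A :=
  subset D D' ∧ ¬ ∃ z, (z ∈ D' ∧ ¬ z ∈ D) ∧ covered U D z.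

Definition kappa_D k X t U : fm A :=
  ∀ D, sticky_cond k X t U D ⇒ ∀[x ∈ X]
    ∃ D', sticky_cond k X t U D' ∧ sticky_ext U D D' ∧ covered U D' x.

Definition is_subspace_topology t Y s : fm A :=
  ∀ v, v ∈ s ⇔ (∃[u ∈ t] is_inter u Y v).
(** [V] is the function sending [y] in [Y] to the trace of [U(y)] on [Y]. *)
Definition is_trace_ona U Y V : fm A :=
  ∀ c, c ∈ V ⇔
    (∃[y ∈ Y] ∃ u v, rel U y u ∧ is_inter u Y v ∧ is_pair y v c).
Definition subspace_kappa_D k t U Y : fm A :=
  ∃ s V, is_subspace_topology t Y s ∧ is_trace_ona U Y V ∧ kappa_D k Y s V.

End SetTheory.

(** ** Models of ZFC *)

(** First-order formulas with de Bruijn indices, used in the axiom schemes. *)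
Inductive formula : Type :=
| fMem (i j : nat)
| fEq (i j : nat)
| fNot (p : formula)
| fAnd (p q : formula)
| fAll (p : formula).

Definition scons {A : Type} (x : A) (v : nat -> A) (n : nat) : A :=
  match n with O => x | S n => v n end.

Fixpoint inst {A : Type} (p : formula) (v : nat -> A) : fm A :=
  match p with
  | fMem i j => v i ∈ v j
  | fEq i j => v i ≡ v j
  | fNot p => ¬ inst p v
  | fAnd p q => inst p v ∧ inst q v
  | fAll p => ∀ x, inst p (scons x v)
  end.

Record ZFC {V : Type} (mem : V -> V -> Prop) : Prop := {
  zfc_extensionality : holds mem (∀ x y, (∀ z, z ∈ x ⇔ z ∈ y) ⇒ x ≡ y);
  zfc_foundation : holds mem
    (∀ x, (∃ y, y ∈ x) ⇒ ∃[y ∈ x] ¬ ∃ z, z ∈ x ∧ z ∈ y);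
  zfc_pairing : holds mem (∀ a b, ∃ c, is_upair a b c);
  zfc_union : holds mem (∀ s, ∃ u, is_union s u);
  zfc_power : holds mem (∀ x, ∃ s, is_power x s);
  zfc_infinity : holds mem
    (∃ w, (∃[x ∈ w] empty x) ∧ ∀[x ∈ w] ∃[y ∈ w] is_succ x y);
  zfc_separation : forall (p : formula) (v : nat -> V), holds mem
    (∀ a, ∃ b, ∀ x, x ∈ b ⇔ (x ∈ a ∧ inst p (scons x v)));
  zfc_replacement : forall (p : formula) (v : nat -> V), holds mem
    (∀ a, (∀[x ∈ a] ∃ y, inst p (scons x (scons y v)) ∧
             ∀ y', inst p (scons x (scons y' v)) ⇒ y' ≡ y) ⇒
      ∃ b, ∀[x ∈ a] ∃[y ∈ b] inst p (scons x (scons y v)));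
  zfc_choice : holds mem
    (∀ s, (∀[x ∈ s] ∃ z, z ∈ x) ⇒
      ∃ f u, is_union s u ∧ is_fun f s u ∧ ∀[x ∈ s] ∀ z, rel f x z ⇒ z ∈ x)
}.

(** ** Forcing

  Conditions: elements of [P], where [(q, p)] in [le] means that [q] is
  stronger than [p], and [one] is a weakest condition.

  Names: every set is regarded as a name, [s] denoting in the extension by [G]
  the set of the values of all [z] with [(z, r)] in [s] for some [r] in [G].

  Forcing of atomic formulas is defined by recursion on names.  The model need
  not be well-founded, so the recursion is carried out inside it: [F] is a set
  of triples [(p, (s, t))] deciding which [p] force [s = t], for [s] and [t] in
  a transitive set [T]. *)

Section ForcingRecursion.
Context {A : Type}.

Definition is_forcing (P le one : A) : fm A :=
  (∀[c ∈ le] ∃[p ∈ P] ∃[q ∈ P] is_pair p q c) ∧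
  (∀[p ∈ P] rel le p p) ∧
  (∀ p q r, rel le p q ∧ rel le q r ⇒ rel le p r) ∧
  one ∈ P ∧ (∀[p ∈ P] rel le p one).

Definition rel3 (F p s t : A) : fm A := ∃ c, is_pair s t c ∧ rel F p c.
Definition in_dom (P s z : A) : fm A := ∃[r ∈ P] rel s z r.

(** [p] forces [x] to belong to [s], computed from [F]: the [r] such that some
    [(z, r')] in [s] has [r] below [r'] and [r] forcing [x = z] are dense
    below [p]. *)
Definition forces_mem_from (le F p x s : A) : fm A :=
  ∀ q, rel le q p ⇒ ∃ r, rel le r q ∧
    ∃ z r', rel s z r' ∧ rel le r r' ∧ rel3 F r x z.

Definition is_forces_eq_on (P le F T : A) : fm A :=
  transitive T ∧
  ∀[p ∈ P] ∀[s ∈ T] ∀[t ∈ T] rel3 F p s t ⇔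
    (∀ x, in_dom P s x ∨ in_dom P t x ⇒ ∀ q, rel le q p ⇒
       (forces_mem_from le F q x s ⇔ forces_mem_from le F q x t)).

Definition forces_mem (P le p s t : A) : fm A :=
  ∃ F T, is_forces_eq_on P le F T ∧ s ∈ T ∧ t ∈ T ∧
    forces_mem_from le F p s t.
Definition forces_eq (P le p s t : A) : fm A :=
  ∃ F T, is_forces_eq_on P le F T ∧ s ∈ T ∧ t ∈ T ∧ rel3 F p s t.

(** [c] is the canonical name of [x]: [f] is the function on the transitive
    set [T] with [f(z) = { (f(w), one) : w in z }]. *)
Definition is_check_name (one x c : A) : fm A :=
  ∃ f T, transitive T ∧ x ∈ T ∧
    (∀[z ∈ T] ∃ d, rel f z d ∧ ∀ d', rel f z d' ⇒ d' ≡ d) ∧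
    (∀[z ∈ T] ∀ d, rel f z d ⇒
       ∀ e, e ∈ d ⇔ (∃[w ∈ z] ∃ b, rel f w b ∧ is_pair b one e)) ∧
    rel f x c.

End ForcingRecursion.

Section ForcingExtension.
Context {V : Type} {mem : V -> V -> Prop}.

(** A forcing notion of the model. *)
Record forcing : Type := {
  conditions : V;
  order : V;
  weakest : V;
  forcing_ok : holds mem (is_forcing conditions order weakest)
}.

Variable Q : forcing.

Definition stronger (q p : V) : Prop := holds mem (rel (order Q) q p).

Fixpoint forces (p : V) (phi : fm V) : Prop :=
  match phi with
  | Mem s t => holds mem (forces_mem (conditions Q) (order Q) p s t)
  | Eq s t => holds mem (forces_eq (conditions Q) (order Q) p s t)
  | Not phi => forall q, stronger q p -> ~ forces q phi
  | And phi psi => forces p phi /\ forces p psi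
  | Or phi psi => forall q, stronger q p ->
      exists r, stronger r q /\ (forces r phi \/ forces r psi)
  | Imp phi psi => forall q, stronger q p -> forces q phi -> forces q psi
  | All phi => forall s, forces p (phi s)
  | Ex phi => forall q, stronger q p ->
      exists r, stronger r q /\ exists s, forces r (phi s)
  end.

(** Truth in the forcing extension by [Q]; the parameters of [phi] are names.
    The model may be uncountable, so that no generic filter over it need exist:
    the extension is accessed through the forcing relation. *)
Definition holds_in_extension (phi : fm V) : Prop := forces (weakest Q) phi.

Definition check_name (x c : V) : Prop :=
  holds mem (is_check_name (weakest Q) x c).

(** [p] forces the value of [s] to belong to the ground model. *)
Definition forces_ground (p s : V) : Prop :=
  forall q, stronger q p ->
    exists r, stronger r q /\ exists x c, check_name x c /\ forces r (s ≡ c).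

Definition preserves_cofinalities : Prop :=
  forall a d, holds mem (is_cof a d) ->
    exists a' d', check_name a a' /\ check_name d d' /\
      holds_in_extension (is_cof a' d').

Definition preserves_cardinals : Prop :=
  forall a, holds mem (cardinal a) ->
    exists a', check_name a a' /\ holds_in_extension (cardinal a').

Definition adds_no_bounded_subsets (k : V) : Prop :=
  forall b, holds mem (b ∈ k) -> exists b', check_name b b' /\
    forall p s, stronger p (weakest Q) -> forces p (subset s b') ->
      forces_ground p s.

End ForcingExtension.

Arguments forcing {V} mem.

(* Main.v *)
(** Statement (ii) already holds in ZFC for every successor cardinal [k = l^+]: [U] may
    be chosen so that every [U(x)] has size at most [l].  Call [Y] reflecting when it is
    closed under [y ↦ U(y)] and contains every [b] with [y ∈ U(b)], for [y] in [Y], as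
    soon as [Y] contains few of these.  Every point lies in a reflecting [Y] of size at
    most [k], and small sticky subsets of such a [Y] are sticky in the whole space.  If
    [W] is open and closed under [U] and [E] is sticky, then [E \ W] is sticky, because
    points outside [W] can only be covered from outside [W].  So a sticky [D] covering
    exactly a [U]-closed open set extends, by [k] small steps outside of that set, to one
    that covers one more reflecting [Y]; transfinitely many such steps cover the space.

    It therefore suffices to force with the partial functions of size at most [lam] from
    [mu × kap] to [2].  They are [kap]-closed and have the [kap^+]-chain condition, and
    nice names bound [2^kap].

    As the model may be uncountable and ill-founded, the forcing statement, which is
    first-order, is first transferred to a countable elementary submodel [V].  There a
    generic [G] exists, and the names modulo [G] form a model of ZFC in which every
    formula holds that is forced by an element of [G]. *)

From Stdlib Require Import Classical ClassicalEpsilon FunctionalExtensionality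
  PropExtensionality ProofIrrelevance Arith Lia Setoid.
From Stdlib Require Cantor.
Require Import Defs.


(** * Definability *)

(** Stickiness of [E] in an open subspace [Y] says nothing about points [b] outside [Y] whose [U(b)]
    meets [E]; this is the obstacle that reflection removes. For [z] in [E], the points [b] of [Y]
    with [z ∈ U(b)] are all covered by [E], so there are at most [l] of them, and reflection turns
    this count inside [Y] into a count in the whole space. The forcing half is shaped by the fact
    that the model is an arbitrary structure. A predicate on it yields a set only if it is
    first-order definable with parameters, so every separation, replacement, recursion and induction
    comes with a definability proof. A generic filter is treated as a predicate outside the model;
    it is reached only through dense sets of the model and the truth lemma. To descend to a
    countable submodel, the whole conclusion, including the forcing relation for each formula
    concerned, has to be one first-order statement, also over structures that are not yet known to
    satisfy any axiom. *)

Fixpoint ren (r : nat -> nat) (p : formula) : formula :=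
  match p with
  | fMem i j => fMem (r i) (r j)
  | fEq i j => fEq (r i) (r j)
  | fNot p => fNot (ren r p)
  | fAnd p q => fAnd (ren r p) (ren r q)
  | fAll p => fAll (ren (fun n => match n with O => O | S m => S (r m) end) p)
  end.

Lemma inst_ren (A : Type) (p : formula) (r : nat -> nat) (e : nat -> A) :
  inst (ren r p) e = inst p (fun n => e (r n)).
Proof.
  revert r e; induction p; intros r e; simpl; try (rewrite ?IHp, ?IHp1, ?IHp2; reflexivity).
  f_equal. apply functional_extensionality; intro x.
  rewrite IHp. f_equal. apply functional_extensionality; intros [|n]; reflexivity.
Qed.

Class Model (V : Type) := {
  mem : V -> V -> Prop;
  ax_ext : holds mem (∀ x y, (∀ z, z ∈ x ⇔ z ∈ y) ⇒ x ≡ y);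
  ax_found : holds mem
    (∀ x, (∃ y, y ∈ x) ⇒ ∃[y ∈ x] ¬ ∃ z, z ∈ x ∧ z ∈ y);
  ax_pair : holds mem (∀ a b, ∃ c, is_upair a b c);
  ax_union : holds mem (∀ s, ∃ u, is_union s u);
  ax_power : holds mem (∀ x, ∃ s, is_power x s);
  ax_inf : holds mem
    (∃ w, (∃[x ∈ w] empty x) ∧ ∀[x ∈ w] ∃[y ∈ w] is_succ x y);
  ax_sep : forall (p : formula) (v : nat -> V), holds mem
    (∀ a, ∃ b, ∀ x, x ∈ b ⇔ (x ∈ a ∧ inst p (scons x v)));
  ax_repl : forall (p : formula) (v : nat -> V), holds mem
    (∀ a, (∀[x ∈ a] ∃ y, inst p (scons x (scons y v)) ∧
             ∀ y', inst p (scons x (scons y' v)) ⇒ y' ≡ y) ⇒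
      ∃ b, ∀[x ∈ a] ∃[y ∈ b] inst p (scons x (scons y v)))
}.

Notation "x ∊ y" := (mem x y) (at level 70) : type_scope.
Notation "'⊨' p" := (holds mem p%fm) (at level 75, p at level 75) : type_scope.

(** Definability with parameters; [e] lists the free variables. *)
Section Definability.
Context {V : Type} {M : Model V}.

(** Each index is either routed to a variable of [e] or frozen to a parameter of the model, so
    definability always means definability with parameters. *)
Definition res (s : nat -> nat + V) (e : nat -> V) (n : nat) : V :=
  match s n with inl i => e i | inr v => v end.

Definition dfn (P : (nat -> V) -> Prop) : Prop :=
  exists p s, forall e, P e <-> ⊨ inst p (res s e).

(** A term is definable when its graph is, with the value at index 0. Objects picked by [epsilon]
    therefore qualify as soon as a definable property characterises them. *)
Definition dt (t : (nat -> V) -> V) : Prop :=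
  dfn (fun e => e 0 = t (fun n => e (S n))).

Lemma dfn_iff (P Q : (nat -> V) -> Prop) :
  (forall e, P e <-> Q e) -> dfn P -> dfn Q.
Proof. intros H (p & s & Hp). exists p, s. intro e. rewrite <- H. apply Hp. Qed.

Lemma dfn_memv i j : dfn (fun e => e i ∊ e j).
Proof. exists (fMem i j), inl. reflexivity. Qed.
Lemma dfn_eqv i j : dfn (fun e => e i = e j).
Proof. exists (fEq i j), inl. reflexivity. Qed.

Lemma dfn_not P : dfn P -> dfn (fun e => ~ P e).
Proof. intros (p & s & H). exists (fNot p), s. intro e. simpl. rewrite H. reflexivity. Qed.

(** Two formulas come with different parameter lists; interleaving them on even and odd indices
    gives one list for the conjunction. *)
Definition join (s s' : nat -> nat + V) (n : nat) : nat + V :=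
  if Nat.even n then s (Nat.div2 n) else s' (Nat.div2 n).

Lemma dfn_and P Q : dfn P -> dfn Q -> dfn (fun e => P e /\ Q e).
Proof.
  intros (p & s & H) (q & s' & H').
  exists (fAnd (ren (fun n => 2 * n) p) (ren (fun n => S (2 * n)) q)), (join s s').
  intro e. cbn [inst holds]. rewrite !inst_ren, H, H'.
  assert (E1 : (fun n => res (join s s') e (2 * n)) = res s e).
  { apply functional_extensionality; intro n. unfold res, join.
    rewrite Nat.even_mul, Nat.div2_double. reflexivity. }
  assert (E2 : (fun n => res (join s s') e (S (2 * n))) = res s' e).
  { apply functional_extensionality; intro n. unfold res, join.
    rewrite Nat.even_succ, <- Nat.negb_even, Nat.even_mul.
    cbn [Nat.even orb negb]. rewrite Nat.div2_succ_double. reflexivity. }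
  rewrite E1, E2. reflexivity.
Qed.

Lemma dfn_res t P : dfn P -> dfn (fun e => P (res t e)).
Proof.
  intros (p & s & H).
  exists p, (fun n => match s n with inl i => t i | inr v => inr v end).
  intro e. rewrite H.
  replace (res s (res t e)) with
    (res (fun n => match s n with inl i => t i | inr v => inr v end) e); [reflexivity|].
  apply functional_extensionality; intro n. unfold res. now destruct (s n).
Qed.

(** Indices that [s] routes to variable 0 belong to the bound variable and stay at 0; all other
    indices are pushed past the binder. *)
Lemma dfn_all (P : V -> (nat -> V) -> Prop) :
  dfn (fun e => P (e 0) (fun n => e (S n))) -> dfn (fun e => forall x, P x e).
Proof.
  intros (p & s & H).
  exists (fAll (ren (fun n => match s n with inl 0 => 0 | _ => S n end) p)),
    (fun n => match s n with inl (S i) => inl i | inl 0 => inl 0 | inr v => inr v end).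
  intro e. cbn [inst holds].
  enough (E : forall x, P x e <-> ⊨ inst (ren (fun n => match s n with inl 0 => 0 | _ => S n end) p)
   (scons x (res (fun n => match s n with inl (S i) => inl i | inl 0 => inl 0 | inr v => inr v end) e))).
  { split; intros K x; apply E, K. }
  intro x. specialize (H (scons x e)). cbn in H. rewrite H, inst_ren.
  match goal with |- holds _ (inst _ ?a) <-> holds _ (inst _ ?b) => replace b with a; [reflexivity|] end.
  apply functional_extensionality; intro n. unfold res.
  destruct (s n) as [[|i]|v] eqn:E; simpl; try rewrite E; reflexivity.
Qed.

Lemma dfn_or P Q : dfn P -> dfn Q -> dfn (fun e => P e \/ Q e).
Proof.
  intros H H'. apply dfn_iff with (fun e => ~ (~ P e /\ ~ Q e)).
  - intro e. tauto.
  - auto using dfn_not, dfn_and.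
Qed.
Lemma dfn_imp (P Q : (nat -> V) -> Prop) : dfn P -> dfn Q -> dfn (fun e => P e -> Q e).
Proof.
  intros H H'. apply dfn_iff with (fun e => ~ (P e /\ ~ Q e)).
  - intro e. tauto.
  - auto using dfn_not, dfn_and.
Qed.
Lemma dfn_equiv (P Q : (nat -> V) -> Prop) : dfn P -> dfn Q -> dfn (fun e => P e <-> Q e).
Proof. intros H H'. unfold iff. apply dfn_and; apply dfn_imp; assumption. Qed.
Lemma dfn_ex (P : V -> (nat -> V) -> Prop) :
  dfn (fun e => P (e 0) (fun n => e (S n))) -> dfn (fun e => exists x, P x e).
Proof.
  intro H. apply dfn_iff with (fun e => ~ forall x, ~ P x e).
  - intro e. split; [intro K; apply NNPP; intro K'; apply K; intros x Hx; eauto | intros [x Hx] K; eapply K; eauto].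
  - apply dfn_not. apply (dfn_all (fun x e => ~ P x e)). apply dfn_not, H.
Qed.

Lemma dfn_prop (Q : Prop) : dfn (fun _ => Q).
Proof.
  destruct (classic Q) as [H|H].
  - exists (fNot (fAnd (fEq 0 0) (fNot (fEq 0 0)))), inl. intro e. simpl. tauto.
  - exists (fAnd (fEq 0 0) (fNot (fEq 0 0))), inl. intro e. simpl. tauto.
Qed.

Lemma dt_var i : dt (fun e => e i).
Proof. apply dfn_eqv. Qed.
Lemma dt_const c : dt (fun _ => c).
Proof.
  exists (fEq 0 1), (fun n => match n with 0 => inl 0 | _ => inr c end). reflexivity.
Qed.

Lemma dfn_shift P r : dfn P -> dfn (fun e => P (fun n => e (r n))).
Proof. intro H. apply (dfn_res (fun n => inl (r n)) _ H). Qed.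

(** Substituting a definable term costs one existential quantifier over its value. *)
Lemma dfn_sub (P : V -> (nat -> V) -> Prop) t :
  dt t -> dfn (fun e => P (e 0) (fun n => e (S n))) -> dfn (fun e => P (t e) e).
Proof.
  intros Ht H. apply dfn_iff with (fun e => exists x, x = t e /\ P x e).
  - intro e. split; [intros (x & -> & K); exact K | eauto].
  - apply dfn_ex. apply dfn_and; assumption.
Qed.

Definition dp1 (P : V -> Prop) := dfn (fun e => P (e 0)).
Definition dp2 (P : V -> V -> Prop) := dfn (fun e => P (e 0) (e 1)).
Definition dp3 (P : V -> V -> V -> Prop) := dfn (fun e => P (e 0) (e 1) (e 2)).
Definition dp4 (P : V -> V -> V -> V -> Prop) := dfn (fun e => P (e 0) (e 1) (e 2) (e 3)).
Definition df1 (F : V -> V) := dfn (fun e => e 0 = F (e 1)).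
Definition df2 (F : V -> V -> V) := dfn (fun e => e 0 = F (e 1) (e 2)).
Definition df3 (F : V -> V -> V -> V) := dfn (fun e => e 0 = F (e 1) (e 2) (e 3)).

Lemma dp1_sub P t : dp1 P -> dt t -> dfn (fun e => P (t e)).
Proof. intros H Ht. apply (dfn_sub (fun x _ => P x) t Ht). exact H. Qed.
Lemma dt_shift t r : dt t -> dt (fun e => t (fun n => e (r n))).
Proof.
  intro H. exact (dfn_shift _ (fun n => match n with 0 => 0 | S m => S (r m) end) H).
Qed.
Lemma dp2_sub P s t : dp2 P -> dt s -> dt t -> dfn (fun e => P (s e) (t e)).
Proof.
  intros H Hs Ht. apply (dfn_sub (fun x e => P x (t e)) s Hs).
  apply (dfn_sub (fun y e => P (e 0) y) (fun e => t (fun n => e (S n)))).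
  - apply (dt_shift t S Ht).
  - exact (dfn_shift _ (fun n => match n with 0 => 1 | _ => 0 end) H).
Qed.
Lemma dp3_sub P s t u : dp3 P -> dt s -> dt t -> dt u -> dfn (fun e => P (s e) (t e) (u e)).
Proof.
  intros H Hs Ht Hu. apply (dfn_sub (fun x e => P x (t e) (u e)) s Hs).
  apply (dfn_sub (fun y e => P (e 0) y (u (fun n => e (S n)))) (fun e => t (fun n => e (S n)))).
  - apply (dt_shift t S Ht).
  - apply (dfn_sub (fun z e => P (e 1) (e 0) z) (fun e => u (fun n => e (S (S n))))).
    + apply (dt_shift u (fun n => S (S n)) Hu).
    + exact (dfn_shift _ (fun n => match n with 0 => 2 | 1 => 1 | _ => 0 end) H).
Qed.
Lemma dp4_sub P s t u v : dp4 P -> dt s -> dt t -> dt u -> dt v ->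
  dfn (fun e => P (s e) (t e) (u e) (v e)).
Proof.
  intros H Hs Ht Hu Hv. apply (dfn_sub (fun x e => P x (t e) (u e) (v e)) s Hs).
  apply (dfn_sub (fun y e => P (e 0) y (u (fun n => e (S n))) (v (fun n => e (S n)))) (fun e => t (fun n => e (S n)))).
  - apply (dt_shift t S Ht).
  - apply (dfn_sub (fun z e => P (e 1) (e 0) z (v (fun n => e (S (S n))))) (fun e => u (fun n => e (S (S n))))).
    + apply (dt_shift u (fun n => S (S n)) Hu).
    + apply (dfn_sub (fun z e => P (e 2) (e 1) (e 0) z) (fun e => v (fun n => e (S (S (S n)))))).
      * apply (dt_shift v (fun n => S (S (S n))) Hv).
      * exact (dfn_shift _ (fun n => match n with 0 => 3 | 1 => 2 | 2 => 1 | _ => 0 end) H).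
Qed.
Lemma df1_sub F t : df1 F -> dt t -> dt (fun e => F (t e)).
Proof.
  intros H Ht. apply (dp2_sub (fun x y => x = F y) (fun e => e 0) (fun e => t (fun n => e (S n))) H).
  - apply dt_var.
  - apply (dt_shift t S Ht).
Qed.
Lemma df2_sub F s t : df2 F -> dt s -> dt t -> dt (fun e => F (s e) (t e)).
Proof.
  intros H Hs Ht.
  apply (dp3_sub (fun x y z => x = F y z) (fun e => e 0) (fun e => s (fun n => e (S n))) (fun e => t (fun n => e (S n))) H).
  - apply dt_var.
  - apply (dt_shift s S Hs).
  - apply (dt_shift t S Ht).
Qed.
Lemma df3_sub F s t u : df3 F -> dt s -> dt t -> dt u -> dt (fun e => F (s e) (t e) (u e)).
Proof.
  intros H Hs Ht Hu.
  apply (dp4_sub (fun x y z w => x = F y z w) (fun e => e 0) (fun e => s (fun n => e (S n)))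
    (fun e => t (fun n => e (S n))) (fun e => u (fun n => e (S n))) H).
  - apply dt_var.
  - apply (dt_shift s S Hs).
  - apply (dt_shift t S Ht).
  - apply (dt_shift u S Hu).
Qed.
Lemma dfn_mem s t : dt s -> dt t -> dfn (fun e => s e ∊ t e).
Proof. apply (dp2_sub (fun x y => x ∊ y)). exact (dfn_memv 0 1). Qed.
Lemma dfn_eq s t : dt s -> dt t -> dfn (fun e => s e = t e).
Proof. apply (dp2_sub (fun x y => x = y)). exact (dfn_eqv 0 1). Qed.

(** Freezing all variables but the first gives the one-place predicates to which the schemes of the
    model apply. *)
Lemma dfn_at0 (P : V -> (nat -> V) -> Prop) :
  dfn (fun e => P (e 0) (fun n => e (S n))) -> forall e, dp1 (fun x => P x e).
Proof.
  intros H e. exact (dfn_res (fun n => match n with 0 => inl 0 | S m => inr (e m) end) _ H).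
Qed.
Lemma dt_at0 (F : V -> (nat -> V) -> V) :
  dt (fun e => F (e 0) (fun n => e (S n))) -> forall e, df1 (fun x => F x e).
Proof.
  intros H e.
  exact (dfn_res (fun n => match n with 0 => inl 0 | 1 => inl 1 | S (S m) => inr (e m) end) _ H).
Qed.
Lemma dt_at0' (F : V -> V -> (nat -> V) -> V) :
  dt (fun e => F (e 0) (e 1) (fun n => e (S (S n)))) -> forall e, df2 (fun x y => F x y e).
Proof.
  intros H e.
  exact (dfn_res (fun n => match n with 0 => inl 0 | 1 => inl 1 | 2 => inl 2 | S (S (S m)) => inr (e m) end) _ H).
Qed.

Lemma dp1_formula P : dp1 P -> exists p v, forall x, P x <-> ⊨ inst p (scons x v).
Proof.
  (* After the renaming, the slots of indices routed to the variable are never read; [v0] merely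
     fills them. *)
  intros (p & s & H). destruct ax_inf as [v0 _].
  exists (ren (fun n => match s n with inl _ => 0 | inr _ => S n end) p),
    (fun n => match s n with inl _ => v0 | inr v => v end).
  intro x. specialize (H (fun _ => x)). cbn in H. rewrite H, inst_ren.
  match goal with |- holds _ (inst _ ?a) <-> holds _ (inst _ ?b) => replace b with a; [reflexivity|] end.
  apply functional_extensionality; intro n. unfold res.
  destruct (s n) as [i|v] eqn:E; simpl; try rewrite E; reflexivity.
Qed.
Lemma dp2_formula P : dp2 P -> exists p v, forall x y, P x y <-> ⊨ inst p (scons x (scons y v)).
Proof.
  intros (p & s & H). destruct ax_inf as [v0 _].
  exists (ren (fun n => match s n with inl 0 => 0 | inl _ => 1 | inr _ => S (S n) end) p),
      (fun n => match s n with inl _ => v0 | inr v => v end).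
  intros x y. specialize (H (fun n => match n with 0 => x | _ => y end)). cbn in H. rewrite H, inst_ren.
  match goal with |- holds _ (inst _ ?a) <-> holds _ (inst _ ?b) => replace b with a; [reflexivity|] end.
  apply functional_extensionality; intro n. unfold res.
  destruct (s n) as [[|i]|v] eqn:E; simpl; try rewrite E; reflexivity.
Qed.
End Definability.

Create HintDb dfn.
#[export] Hint Constants Opaque : dfn.
#[export] Hint Variables Opaque : dfn.
#[export] Hint Resolve dfn_not dfn_and dfn_all dfn_or dfn_imp dfn_equiv dfn_ex dfn_mem dfn_eq dt_const : dfn.
#[export] Hint Resolve dt_var : dfn.
#[export] Hint Resolve dfn_prop | 100 : dfn.
#[export] Hint Extern 1 (dp1 _) => (red; cbv beta) : dfn.
#[export] Hint Extern 1 (dp2 _) => (red; cbv beta) : dfn.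
#[export] Hint Extern 1 (dp3 _) => (red; cbv beta) : dfn.
#[export] Hint Extern 1 (dp4 _) => (red; cbv beta) : dfn.
Ltac dfn := cbv beta; solve [auto 200 with dfn nocore].
#[export] Hint Extern 5 (dfn _) => match goal with
  | H : dp1 ?P |- dfn (fun e => ?P (@?t e)) => apply (dp1_sub P t H)
  | H : dp2 ?P |- dfn (fun e => ?P (@?s e) (@?t e)) => apply (dp2_sub P s t H)
  | H : dp3 ?P |- dfn (fun e => ?P (@?s e) (@?t e) (@?u e)) => apply (dp3_sub P s t u H)
  | H : dp4 ?P |- dfn (fun e => ?P (@?s e) (@?t e) (@?u e) (@?v e)) => apply (dp4_sub P s t u v H)
  end : dfn.
#[export] Hint Extern 5 (dt _) => match goal with
  | H : df1 ?P |- dt (fun e => ?P (@?t e)) => apply (df1_sub P t H)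
  | H : df2 ?P |- dt (fun e => ?P (@?s e) (@?t e)) => apply (df2_sub P s t H)
  | H : df3 ?P |- dt (fun e => ?P (@?s e) (@?t e) (@?u e)) => apply (df3_sub P s t u H)
  end : dfn.
#[export] Hint Extern 1 (df1 _) => (red; cbv beta) : dfn.
#[export] Hint Extern 1 (df2 _) => (red; cbv beta) : dfn.
#[export] Hint Extern 1 (df3 _) => (red; cbv beta) : dfn.

(** * Set theory in a model of ZF *)

Section Sets.
Context {V : Type} {M : Model V}.
Implicit Types a b c d f g s t u v w x y z : V.

Lemma set_ext x y : (forall z, z ∊ x <-> z ∊ y) -> x = y.
Proof. intro H. apply ax_ext. intro z. split; apply H. Qed.

Lemma V_inhabited : inhabited V.
Proof. destruct ax_inf as [w _]. exact (inhabits w). Qed.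
Definition the (P : V -> Prop) : V := epsilon V_inhabited P.
Lemma the_spec (P : V -> Prop) : (exists x, P x) -> P (the P).
Proof. apply epsilon_spec. Qed.

(** For an undefinable predicate the described set may not exist and [sep a P] is then an arbitrary
    element, so each use of [sepE] discharges a definability goal. *)
Definition sep a (P : V -> Prop) : V := the (fun b => forall x, x ∊ b <-> x ∊ a /\ P x).
Lemma sepE a P x : dp1 P -> x ∊ sep a P <-> x ∊ a /\ P x.
Proof.
  intro H. revert x. apply (the_spec (fun b => forall x, x ∊ b <-> x ∊ a /\ P x)).
  destruct (dp1_formula P H) as (p & v & E). destruct (ax_sep p v a) as [b Hb]. exists b.
  intro x. rewrite E. split; apply Hb.
Qed.

Lemma dt_sep (t : (nat -> V) -> V) (P : V -> (nat -> V) -> Prop) :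
  dt t -> dfn (fun e => P (e 0) (fun n => e (S n))) ->
  dt (fun e => sep (t e) (fun x => P x e)).
Proof.
  intros Ht H. red.
  apply dfn_iff with (fun e => forall x, x ∊ e 0 <-> x ∊ t (fun n => e (S n)) /\ P x (fun n => e (S n))).
  - intro e. split.
    + intro K. apply set_ext. intro x. rewrite K, sepE; [reflexivity|].
      exact (dfn_at0 P H _).
    + intros -> x. apply sepE. exact (dfn_at0 P H _).
  - apply (dfn_all (fun x e => x ∊ e 0 <-> x ∊ t (fun n => e (S n)) /\ P x (fun n => e (S n)))).
    apply dfn_equiv; [dfn|]. apply dfn_and.
    + apply dfn_mem; [apply dt_var|]. apply (dt_shift t (fun n => S (S n)) Ht).
    + exact (dfn_shift _ (fun n => match n with 0 => 0 | S m => S (S m) end) H).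
Qed.

Definition Sub x y := forall z, z ∊ x -> z ∊ y.
Lemma dp2_Sub : dp2 Sub. Proof. unfold Sub. dfn. Qed.
Lemma Sub_refl x : Sub x x. Proof. intros z H; exact H. Qed.
Lemma Sub_trans x y z : Sub x y -> Sub y z -> Sub x z. Proof. unfold Sub; auto. Qed.
Lemma Sub_antisym x y : Sub x y -> Sub y x -> x = y.
Proof. intros H H'. apply set_ext. split; auto. Qed.

Definition upair a b := the (fun c => forall z, z ∊ c <-> z = a \/ z = b).
Lemma upairE a b z : z ∊ upair a b <-> z = a \/ z = b.
Proof.
  revert z. apply (the_spec (fun c => forall z, z ∊ c <-> z = a \/ z = b)).
  destruct (ax_pair a b) as [c H]. exists c. intro z. split; apply H.
Qed.
Lemma df2_upair : df2 upair.
Proof.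
  apply (dfn_iff (fun e => forall z, z ∊ e 0 <-> z = e 1 \/ z = e 2)); [|dfn].
  intro e. split.
  - intro H. apply set_ext. intro z. now rewrite H, upairE.
  - intros -> z. apply upairE.
Qed.
Definition Union a := the (fun c => forall z, z ∊ c <-> exists y, y ∊ a /\ z ∊ y).
Lemma UnionE a z : z ∊ Union a <-> exists y, y ∊ a /\ z ∊ y.
Proof.
  revert z. apply (the_spec (fun c => forall z, z ∊ c <-> exists y, y ∊ a /\ z ∊ y)).
  destruct (ax_union a) as [c H]. exists c. intro z. split; apply H.
Qed.
Lemma df1_Union : df1 Union.
Proof.
  apply (dfn_iff (fun e => forall z, z ∊ e 0 <-> exists y, y ∊ e 1 /\ z ∊ y)); [|dfn].
  intro e. split.
  - intro H. apply set_ext. intro z. now rewrite H, UnionE.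
  - intros -> z. apply UnionE.
Qed.
Definition Pow a := the (fun c => forall z, z ∊ c <-> Sub z a).
Lemma PowE a z : z ∊ Pow a <-> Sub z a.
Proof.
  revert z. apply (the_spec (fun c => forall z, z ∊ c <-> Sub z a)).
  destruct (ax_power a) as [c H]. exists c. intro z. split; apply H.
Qed.
Lemma df1_Pow : df1 Pow.
Proof.
  pose proof dp2_Sub.
  apply (dfn_iff (fun e => forall z, z ∊ e 0 <-> Sub z (e 1))); [|dfn].
  intro e. split.
  - intro K. apply set_ext. intro z. now rewrite K, PowE.
  - intros -> z. apply PowE.
Qed.
End Sets.
#[export] Hint Extern 2 (dfn (fun e => Sub _ _)) => apply (dp2_sub _ _ _ dp2_Sub) : dfn.
#[export] Hint Extern 2 (dt (fun e => sep _ _)) => (apply dt_sep) : dfn.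
#[export] Hint Extern 2 (dt (fun e => Union _)) => apply (df1_sub _ _ df1_Union) : dfn.
#[export] Hint Extern 2 (dt (fun e => Pow _)) => apply (df1_sub _ _ df1_Pow) : dfn.
#[export] Hint Extern 2 (dt (fun e => upair _ _)) => apply (df2_sub _ _ _ df2_upair) : dfn.

Section Sets2.
Context {V : Type} {M : Model V}.
Implicit Types a b c d f g s t u v w x y z : V.

Definition rep a (F : V -> V) := the (fun b => forall y, y ∊ b <-> exists x, x ∊ a /\ y = F x).
Lemma repE a F y : df1 F -> y ∊ rep a F <-> exists x, x ∊ a /\ y = F x.
Proof.
  intro H. revert y. apply (the_spec (fun b => forall y, y ∊ b <-> exists x, x ∊ a /\ y = F x)).
  assert (H' : dp2 (fun x y => y = F x)).
  { exact (dfn_shift _ (fun n => match n with 0 => 1 | _ => 0 end) H). }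
  destruct (dp2_formula _ H') as (p & v & E).
  destruct (ax_repl p v a) as [b Hb].
  { intros x Hx. exists (F x). split; [apply E; reflexivity|]. intros y Hy. apply E. exact Hy. }
  exists (sep b (fun y => exists x, x ∊ a /\ y = F x)). intro y. rewrite sepE by dfn.
  split; [intros [_ K]; exact K|]. intros (x & Hx & ->). split; [|eauto].
  destruct (Hb x Hx) as (y & Hy & K). apply E in K. now subst.
Qed.
Lemma dt_rep (t : (nat -> V) -> V) (F : V -> (nat -> V) -> V) :
  dt t -> dt (fun e => F (e 0) (fun n => e (S n))) -> dt (fun e => rep (t e) (fun x => F x e)).
Proof.
  intros Ht H. red.
  apply dfn_iff with (fun e => forall y, y ∊ e 0 <-> exists x, x ∊ t (fun n => e (S n)) /\ y = F x (fun n => e (S n))).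
  - intro e. split.
    + intro K. apply set_ext. intro x. rewrite K, repE; [reflexivity|]. exact (dt_at0 F H _).
    + intros -> y. apply repE. exact (dt_at0 F H _).
  - apply dfn_all. apply dfn_equiv; [dfn|]. apply dfn_ex. apply dfn_and.
    + apply dfn_mem; [apply dt_var|]. apply (dt_shift t (fun n => S (S (S n))) Ht).
    + apply dfn_eq; [apply dt_var|].
      exact (dt_shift (fun e => F (e 0) (fun n => e (S n))) (fun n => match n with 0 => 0 | S m => S (S (S m)) end) H).
Qed.

Definition ite (P : Prop) x y := if excluded_middle_informative P then x else y.
Lemma ite_true (P : Prop) x y : P -> ite P x y = x.
Proof. intro. unfold ite. now destruct excluded_middle_informative. Qed.
Lemma ite_false (P : Prop) x y : ~ P -> ite P x y = y.
Proof. intro. unfold ite. now destruct excluded_middle_informative. Qed.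
Lemma dt_ite (P : (nat -> V) -> Prop) (s t : (nat -> V) -> V) : dfn P -> dt s -> dt t -> dt (fun e => ite (P e) (s e) (t e)).
Proof.
  intros H Hs Ht. red.
  apply dfn_iff with (fun e => (P (fun n => e (S n)) /\ e 0 = s (fun n => e (S n))) \/
    (~ P (fun n => e (S n)) /\ e 0 = t (fun n => e (S n)))).
  - intro e. unfold ite. destruct excluded_middle_informative; tauto.
  - pose proof (dfn_shift _ S H). pose proof (dt_shift _ S Hs). pose proof (dt_shift _ S Ht).
    apply dfn_or; apply dfn_and; auto with dfn nocore.
Qed.
End Sets2.
#[export] Hint Extern 2 (dt (fun e => rep _ _)) => (apply dt_rep) : dfn.
#[export] Hint Extern 2 (dt (fun e => ite _ _ _)) => (apply dt_ite) : dfn.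

Tactic Notation "sepin" hyp(H) := rewrite sepE in H by dfn.

Section Sets3.
Context {V : Type} {M : Model V}.
Implicit Types a b c d f g s t u v w x y z : V.

Definition emp : V := sep (the (fun _ => True)) (fun _ => False).
Lemma empE x : ~ x ∊ emp.
Proof. unfold emp. rewrite sepE by dfn. tauto. Qed.
Lemma nonempty x : x <> emp -> exists y, y ∊ x.
Proof.
  intro H. apply NNPP. intro K. apply H. apply set_ext. intro z. split; intro Hz.
  - destruct K. eauto.
  - destruct (empE z Hz).
Qed.
Lemma emp_eq x : (forall y, ~ y ∊ x) -> x = emp.
Proof. intro H. apply NNPP. intro K. destruct (nonempty x K) as [y Hy]. exact (H y Hy). Qed.

Definition sing a := upair a a.
Lemma singE a z : z ∊ sing a <-> z = a.
Proof. unfold sing. rewrite upairE. tauto. Qed.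
Lemma df1_sing : df1 sing. Proof. unfold sing. dfn. Qed.

Definition cup a b := Union (upair a b).
Lemma cupE a b z : z ∊ cup a b <-> z ∊ a \/ z ∊ b.
Proof.
  unfold cup. rewrite UnionE. setoid_rewrite upairE.
  split; [intros (y & [->| ->] & H); auto | intros [H|H]; eauto].
Qed.
Lemma df2_cup : df2 cup. Proof. unfold cup. dfn. Qed.
Definition cap a b := sep a (fun x => x ∊ b).
Lemma capE a b z : z ∊ cap a b <-> z ∊ a /\ z ∊ b.
Proof. unfold cap. now rewrite sepE by dfn. Qed.
Lemma df2_cap : df2 cap. Proof. unfold cap. dfn. Qed.
Definition diff a b := sep a (fun x => ~ x ∊ b).
Lemma diffE a b z : z ∊ diff a b <-> z ∊ a /\ ~ z ∊ b.
Proof. unfold diff. now rewrite sepE by dfn. Qed.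
Lemma df2_diff : df2 diff. Proof. unfold diff. dfn. Qed.
Definition suc a := cup a (upair a a).
Lemma sucE a z : z ∊ suc a <-> z ∊ a \/ z = a.
Proof. unfold suc. rewrite cupE, upairE. tauto. Qed.
Lemma df1_suc : df1 suc.
Proof. pose proof df2_cup. unfold suc. dfn. Qed.

Definition pair a b := upair (upair a a) (upair a b).
Lemma df2_pair : df2 pair. Proof. unfold pair. dfn. Qed.
Lemma upair_eq a b c d : upair a b = upair c d -> (a = c /\ b = d) \/ (a = d /\ b = c).
Proof.
  intro H.
  assert (K : forall z, z = a \/ z = b <-> z = c \/ z = d) by (intro z; now rewrite <- !upairE, H).
  pose proof (proj1 (K a) (or_introl eq_refl)). pose proof (proj1 (K b) (or_intror eq_refl)).
  pose proof (proj2 (K c) (or_introl eq_refl)). pose proof (proj2 (K d) (or_intror eq_refl)).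
  intuition congruence.
Qed.
Lemma pair_inj a b c d : pair a b = pair c d -> a = c /\ b = d.
Proof.
  unfold pair. intro H. apply upair_eq in H.
  destruct H as [[H K]|[H K]]; apply upair_eq in H; apply upair_eq in K; intuition congruence.
Qed.
Lemma is_upairP a b c : ⊨ is_upair a b c <-> c = upair a b.
Proof.
  cbn. split.
  - intro H. apply set_ext. intro z. rewrite upairE. exact (conj (proj1 (H z)) (proj2 (H z))).
  - intros -> z. split; apply upairE.
Qed.
Lemma is_pairP a b c : ⊨ is_pair a b c <-> c = pair a b.
Proof.
  change (⊨ is_pair a b c) with
    (exists s t, (⊨ is_upair a a s) /\ (⊨ is_upair a b t) /\ (⊨ is_upair s t c)).
  setoid_rewrite is_upairP. split.
  - intros (s & t & -> & -> & ->). reflexivity.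
  - intros ->. exists (upair a a), (upair a b). auto.
Qed.
Lemma relP f a b : ⊨ rel f a b <-> pair a b ∊ f.
Proof.
  change (⊨ rel f a b) with (exists c, (⊨ is_pair a b c) /\ c ∊ f).
  setoid_rewrite is_pairP. split; [intros (c & -> & H); exact H | eauto].
Qed.
Lemma pair_Union a b c : pair a b ∊ c -> a ∊ Union (Union c) /\ b ∊ Union (Union c).
Proof.
  intro H. split; apply UnionE; exists (upair a b); (split; [apply UnionE; exists (pair a b); split; [exact H|]|]);
  unfold pair; rewrite !upairE; auto.
Qed.
Lemma Union_repE a (F : V -> V) x : df1 F -> x ∊ Union (rep a F) <-> exists i, i ∊ a /\ x ∊ F i.
Proof.
  intro D. rewrite UnionE. split.
  - intros (y & Hy & Hx). rewrite repE in Hy by dfn. destruct Hy as (i & Hi & ->). eauto.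
  - intros (i & Hi & Hx). exists (F i). rewrite repE by dfn. eauto.
Qed.
Lemma Union_sep_eq a (Q : V -> Prop) m : dp1 Q -> m ∊ a -> Q m -> (forall x, x ∊ a -> Q x -> x = m) ->
  Union (sep a Q) = m.
Proof.
  intros D Hm Qm U. apply set_ext. intro z. rewrite UnionE. split.
  - intros (x & Hx & Hz). sepin Hx. rewrite <- (U x); tauto.
  - intro Hz. exists m. rewrite sepE by dfn. auto.
Qed.
End Sets3.
#[export] Hint Extern 2 (dt (fun e => sing _)) => apply (df1_sub _ _ df1_sing) : dfn.
#[export] Hint Extern 2 (dt (fun e => suc _)) => apply (df1_sub _ _ df1_suc) : dfn.
#[export] Hint Extern 2 (dt (fun e => cup _ _)) => apply (df2_sub _ _ _ df2_cup) : dfn.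
#[export] Hint Extern 2 (dt (fun e => cap _ _)) => apply (df2_sub _ _ _ df2_cap) : dfn.
#[export] Hint Extern 2 (dt (fun e => diff _ _)) => apply (df2_sub _ _ _ df2_diff) : dfn.
#[export] Hint Extern 2 (dt (fun e => pair _ _)) => apply (df2_sub _ _ _ df2_pair) : dfn.

(** * Products and functions as sets *)

Section Functions.
Context {V : Type} {M : Model V}.
Implicit Types a b c d f g s t u v w x y z : V.

Definition prod a b := sep (Pow (Pow (cup a b))) (fun c => exists x, x ∊ a /\ exists y, y ∊ b /\ c = pair x y).
Lemma df2_prod : df2 prod. Proof. unfold prod. dfn. Qed.
Lemma prodE a b c : c ∊ prod a b <-> exists x, x ∊ a /\ exists y, y ∊ b /\ c = pair x y.
Proof.
  unfold prod. rewrite sepE by dfn. split; [tauto|]. intro H. split; [|exact H].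
  destruct H as (x & Hx & y & Hy & ->). apply PowE. intros u Hu. apply PowE. intros v Hv. apply cupE.
  unfold pair in Hu. rewrite upairE in Hu. destruct Hu as [->| ->]; rewrite upairE in Hv; intuition congruence.
Qed.
Lemma prod_pair a b x y : pair x y ∊ prod a b <-> x ∊ a /\ y ∊ b.
Proof.
  rewrite prodE. split.
  - intros (x' & Hx & y' & Hy & E). apply pair_inj in E. destruct E; subst. auto.
  - intros [Hx Hy]. exists x; split; [assumption|]. eauto.
Qed.

(** The union of all values of [f] at [x]: the value itself when it is unique, the empty set outside
    the domain. This makes application a total definable operation on arbitrary sets. *)
Definition app f x := Union (sep (Union (Union f)) (fun y => pair x y ∊ f)).
Lemma df2_app : df2 app. Proof. unfold app. dfn. Qed.
Lemma app_eq f x y : pair x y ∊ f -> (forall y', pair x y' ∊ f -> y' = y) -> app f x = y.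
Proof.
  intros H K. apply Union_sep_eq; [dfn|eapply pair_Union, H|exact H|auto].
Qed.
Lemma df1_app f : df1 (app f).
Proof. pose proof df2_app. dfn. Qed.
Lemma Union_appE f a x : x ∊ Union (rep a (app f)) <-> exists i, i ∊ a /\ x ∊ app f i.
Proof. apply Union_repE, df1_app. Qed.
Definition lam a (F : V -> V) := rep a (fun x => pair x (F x)).
Lemma lamE a F c : df1 F -> c ∊ lam a F <-> exists x, x ∊ a /\ c = pair x (F x).
Proof. intro H. unfold lam. now rewrite repE by dfn. Qed.
Lemma dt_lam (t : (nat -> V) -> V) (F : V -> (nat -> V) -> V) :
  dt t -> dt (fun e => F (e 0) (fun n => e (S n))) -> dt (fun e => lam (t e) (fun x => F x e)).
Proof.
  intros Ht H. unfold lam. apply (dt_rep t (fun x e => pair x (F x e)) Ht).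
  apply (df2_sub _ _ _ df2_pair); [apply dt_var|exact H].
Qed.
Lemma pair_lam a F x y : df1 F -> pair x y ∊ lam a F <-> x ∊ a /\ y = F x.
Proof.
  intro H. rewrite lamE by exact H. split.
  - intros (z & Hz & E). apply pair_inj in E. destruct E; subst. auto.
  - intros [Hx ->]. eauto.
Qed.
Lemma app_lam a F x : df1 F -> x ∊ a -> app (lam a F) x = F x.
Proof.
  intros H Hx. apply app_eq.
  - apply pair_lam; auto.
  - intros y' K. apply pair_lam in K; tauto.
Qed.
Lemma lam_ext a F G : df1 F -> df1 G -> (forall x, x ∊ a -> F x = G x) -> lam a F = lam a G.
Proof.
  intros HF HG E. apply set_ext. intro z. rewrite !lamE by assumption.
  split; intros (x & Hx & ->); exists x; rewrite E by assumption; auto.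
Qed.

(** Equality with a [lam] says at once that [f] consists of pairs, is single-valued and has domain
    exactly [a]. *)
Definition IsFun f a b : Prop := f = lam a (app f) /\ forall x, x ∊ a -> app f x ∊ b.
Lemma IsFunP f a b : ⊨ is_fun f a b <-> IsFun f a b.
Proof.
  pose proof (df1_app f) as Hf.
  change (⊨ is_fun f a b) with
    ((forall c, c ∊ f -> exists x, x ∊ a /\ exists y, y ∊ b /\ ⊨ is_pair x y c) /\
     (forall x, x ∊ a -> exists y, y ∊ b /\ (⊨ rel f x y) /\ forall y', (⊨ rel f x y') -> y' = y)).
  setoid_rewrite is_pairP. setoid_rewrite relP. split.
  - intros [H K].
    assert (A : forall x, x ∊ a -> app f x ∊ b /\ pair x (app f x) ∊ f /\ forall y, pair x y ∊ f -> y = app f x).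
    { intros x Hx. destruct (K x Hx) as (y & Hy & P1 & P2). rewrite (app_eq f x y P1 P2). auto. }
    split; [|intros x Hx; now apply A]. apply set_ext. intro c. rewrite lamE by exact Hf. split.
    + intro Hc. destruct (H c Hc) as (x & Hx & y & Hy & ->). exists x. split; [exact Hx|].
      f_equal. now apply A.
    + intros (x & Hx & ->). now apply A.
  - intros [E H]. split.
    + intros c Hc. rewrite E, lamE in Hc by exact Hf. destruct Hc as (x & Hx & ->).
      exists x. split; [exact Hx|]. exists (app f x). auto.
    + intros x Hx. exists (app f x). split; [auto|]. split.
      * rewrite E at 2. apply pair_lam; auto.
      * intros y'. rewrite E at 1. rewrite pair_lam by exact Hf. tauto.
Qed.
Lemma fun_rel f a b x y : IsFun f a b -> pair x y ∊ f <-> x ∊ a /\ y = app f x.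
Proof. intros [E _]. rewrite E at 1. apply pair_lam, df1_app. Qed.
Lemma lam_fun a b F : df1 F -> (forall x, x ∊ a -> F x ∊ b) -> IsFun (lam a F) a b.
Proof.
  intros HF H. split.
  - apply lam_ext; [assumption|apply df1_app|]. intros. now rewrite app_lam.
  - intros x Hx. rewrite app_lam by assumption. auto.
Qed.
Lemma fun_ext f g a b b' : IsFun f a b -> IsFun g a b' -> (forall x, x ∊ a -> app f x = app g x) -> f = g.
Proof. intros [E _] [E' _] H. rewrite E, E'. apply lam_ext; auto using df1_app. Qed.
Lemma dp3_IsFun : dp3 IsFun.
Proof.
  pose proof df2_app. unfold IsFun. red. apply dfn_and; [|dfn].
  apply dfn_eq; [dfn|]. apply (dt_lam (fun e => e 1) (fun x e => app (e 0) x)); dfn.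
Qed.

Definition Fun a b := sep (Pow (prod a b)) (fun f => IsFun f a b).
Lemma FunE a b f : f ∊ Fun a b <-> IsFun f a b.
Proof.
  pose proof dp3_IsFun. unfold Fun. rewrite sepE by dfn. split; [tauto|]. intro K. split; [|exact K].
  apply PowE. intros c Hc. destruct K as [E K]. rewrite E in Hc. apply lamE in Hc; [|apply df1_app].
  destruct Hc as (x & Hx & ->). apply prod_pair. auto.
Qed.
End Functions.
#[export] Hint Extern 2 (dt (fun e => prod _ _)) => apply (df2_sub _ _ _ df2_prod) : dfn.
#[export] Hint Extern 2 (dt (fun e => app _ _)) => apply (df2_sub _ _ _ df2_app) : dfn.
#[export] Hint Extern 2 (dt (fun e => lam _ _)) => (apply dt_lam) : dfn.
#[export] Hint Extern 2 (dfn (fun e => IsFun _ _ _)) => apply (dp3_sub _ _ _ _ dp3_IsFun) : dfn.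
Lemma df2_Fun {V} {M : Model V} : df2 Fun. Proof. unfold Fun. dfn. Qed.
#[export] Hint Extern 2 (dt (fun e => Fun _ _)) => apply (df2_sub _ _ _ df2_Fun) : dfn.

(** * Foundation, natural numbers and recursion along membership *)

Section Recursion.
Context {V : Type} {M : Model V}.
Implicit Types a b c d f g s t u v w x y z : V.

Lemma repl_rel a (R : V -> V -> Prop) : dp2 R ->
  (forall x y y', x ∊ a -> R x y -> R x y' -> y = y') ->
  exists b, forall y, y ∊ b <-> exists x, x ∊ a /\ R x y.
Proof.
  intros H U. destruct (dp2_formula R H) as (p & v & E).
  set (a' := sep a (fun x => exists y, R x y)).
  destruct (ax_repl p v a') as [b Hb].
  { intros x Hx. unfold a' in Hx. sepin Hx. destruct Hx as [Hx [y Hy]]. exists y.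
    split; [now apply E|]. intros y' Hy'. apply (U x); auto. now apply E. }
  exists (sep b (fun y => exists x, x ∊ a /\ R x y)). intro y. rewrite sepE by dfn.
  split; [tauto|]. intros (x & Hx & K). split; [|eauto].
  destruct (Hb x) as (y' & Hy & K'); [unfold a'; rewrite sepE by dfn; eauto|].
  apply E in K'. now rewrite (U x y y').
Qed.

Lemma found x y : y ∊ x -> exists m, m ∊ x /\ forall z, z ∊ m -> ~ z ∊ x.
Proof.
  intro H. destruct (ax_found x) as (m & Hm & K); [exists y; exact H|].
  exists m. split; [exact Hm|]. intros z Hz Hz'. apply K. exists z. split; assumption.
Qed.
Lemma no_refl x : ~ x ∊ x.
Proof.
  intro H. destruct (found (sing x) x) as (m & Hm & K); [now apply singE|].
  apply singE in Hm. subst. apply (K x H). now apply singE.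
Qed.
Lemma no_cycle x y : x ∊ y -> ~ y ∊ x.
Proof.
  intros H H'. destruct (found (upair x y) x) as (m & Hm & K); [apply upairE; auto|].
  apply upairE in Hm. destruct Hm; subst.
  - apply (K y H'). apply upairE; auto.
  - apply (K x H). apply upairE; auto.
Qed.

Definition inductive x := emp ∊ x /\ forall y, y ∊ x -> suc y ∊ x.
Lemma dp1_inductive : dp1 inductive. Proof. unfold inductive. dfn. Qed.
Lemma inductive_ex : exists x, inductive x.
Proof.
  destruct ax_inf as (w & (e & He & Ke) & H). exists w. split.
  - replace emp with e; [exact He|]. apply emp_eq. exact Ke.
  - intros y Hy. destruct (H y Hy) as (z & Hz & K). replace (suc y) with z; [exact Hz|].
    apply set_ext. intro u. rewrite sucE. split; apply K.
Qed.
(** Cut out of an arbitrary inductive set. In an ill-founded model it may contain nonstandard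
    numbers, so induction on it is available for definable predicates only. *)
Definition om : V := sep (the inductive) (fun n => forall I, inductive I -> n ∊ I).
Lemma omE n : n ∊ om <-> forall I, inductive I -> n ∊ I.
Proof.
  pose proof dp1_inductive. unfold om. rewrite sepE by dfn. split; [tauto|].
  intro K. split; [|exact K]. apply K. apply the_spec, inductive_ex.
Qed.
Lemma om_0 : emp ∊ om. Proof. apply omE. intros I H. apply H. Qed.
Lemma om_S n : n ∊ om -> suc n ∊ om.
Proof. rewrite !omE. intros H I K. apply K, H, K. Qed.
Lemma om_ind (P : V -> Prop) : dp1 P -> P emp -> (forall n, n ∊ om -> P n -> P (suc n)) ->
  forall n, n ∊ om -> P n.
Proof.
  intros D H0 HS n Hn. assert (K : n ∊ sep om P).
  { apply (proj1 (omE n) Hn). split; [apply sepE; auto using om_0|].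
    intros y Hy. rewrite sepE in * by dfn. destruct Hy. auto using om_S. }
  apply sepE in K; tauto.
Qed.
Definition Tr x := forall y, y ∊ x -> Sub y x.
Lemma dp1_Tr : dp1 Tr. Proof. unfold Tr. dfn. Qed.
Lemma om_Tr : Tr om.
Proof.
  refine (om_ind (fun n => Sub n om) _ _ _); [dfn| |].
  - intros z Hz. destruct (empE z Hz).
  - intros n Hn H z Hz. apply sucE in Hz. destruct Hz as [Hz| ->]; auto.
Qed.

(** General recursion presupposes transitive sets around a point, so here the iteration of [Union]
    along [om] is done by hand: [att f n] describes an approximation up to [n], approximations
    agree, and replacement collects their last values. *)
Lemma trcl_ex x : exists t, Tr t /\ Sub x t.
Proof.
  pose (att f n := app f emp = x /\ forall i, i ∊ n -> app f (suc i) = Union (app f i)).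
  assert (D : dp2 att) by (unfold att; dfn).
  assert (U : forall n, n ∊ om -> forall f g, att f n -> att g n -> app f n = app g n).
  { apply (om_ind (fun n => forall f g, att f n -> att g n -> app f n = app g n)); [dfn| |].
    - intros f g [H _] [H' _]. congruence.
    - intros n Hn IH f g [H K] [H' K']. rewrite K, K' by (apply sucE; auto). f_equal.
      apply IH; split; auto; intros; [apply K|apply K']; apply sucE; auto. }
  assert (E : forall n, n ∊ om -> exists f, att f n).
  { apply (om_ind (fun n => exists f, att f n)); [dfn| |].
    - exists (lam om (fun _ => x)). split; [apply app_lam; [dfn|apply om_0]|].
      intros i Hi. destruct (empE i Hi).
    - intros n Hn [f [H K]].
      pose (F := fun i => ite (i = suc n) (Union (app f n)) (app f i)).
      assert (DF : df1 F) by (unfold F; dfn).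
      assert (EF : forall i, i ∊ om -> i <> suc n -> app (lam om F) i = app f i).
      { intros i Hi Hn'. rewrite app_lam by assumption. apply ite_false, Hn'. }
      exists (lam om F). split.
      + rewrite EF; [exact H|apply om_0|]. intro C. apply (empE n). rewrite C. apply sucE; auto.
      + intros i Hi. apply sucE in Hi. destruct Hi as [Hi| ->].
        * assert (i ∊ om) by (eapply om_Tr; eauto).
          rewrite !EF; auto using om_S.
          -- intros ->. apply (no_cycle _ _ Hi). apply sucE; auto.
          -- intro C. assert (C' : n ∊ suc i) by (rewrite C; apply sucE; auto).
             apply sucE in C'. destruct C' as [C'| ->]; [exact (no_cycle _ _ C' Hi)|exact (no_refl _ Hi)].
        * rewrite app_lam by auto using om_S. unfold F. rewrite ite_true by reflexivity.
          rewrite EF; auto. intro C. apply (no_refl n). rewrite C at 2. apply sucE; auto. }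
  destruct (repl_rel om (fun n y => exists f, att f n /\ y = app f n)) as [b Hb]; [dfn| |].
  { intros n y y' Hn (f & Hf & ->) (g & Hg & ->). auto. }
  exists (Union b). split.
  - intros y Hy z Hz. apply UnionE in Hy. destruct Hy as (v & Hv & Hy).
    apply Hb in Hv. destruct Hv as (n & Hn & f & Hf & ->).
    destruct (E _ (om_S n Hn)) as [g Hg]. apply UnionE. exists (app g (suc n)). split.
    + apply Hb. exists (suc n). split; [auto using om_S|]. eauto.
    + destruct Hg as [H K]. rewrite K by (apply sucE; auto).
      apply UnionE. exists y. split; [|exact Hz].
      rewrite (U n Hn g f); auto. split; auto. intros; apply K, sucE; auto.
  - intros y Hy. apply UnionE. exists x. split; [|exact Hy].
    apply Hb. exists emp. split; [apply om_0|]. destruct (E _ om_0) as [f Hf]. exists f. split; [exact Hf|].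
    symmetry. apply Hf.
Qed.

(** Foundation speaks about sets only; a counterexample is therefore placed in a transitive set,
    where the counterexamples form a set with a minimal element. *)
Lemma ind (P : V -> Prop) : dp1 P -> (forall x, (forall y, y ∊ x -> P y) -> P x) -> forall x, P x.
Proof.
  intros D H x. apply NNPP. intro N. destruct (trcl_ex (sing x)) as (t & T & S).
  destruct (found (sep t (fun y => ~ P y)) x) as (m & Hm & K).
  { rewrite sepE by dfn. split; [|exact N]. apply S, singE. reflexivity. }
  sepin Hm. apply (proj2 Hm), H. intros y Hy. apply NNPP. intro N'.
  apply (K y Hy). rewrite sepE by dfn. split; [|exact N']. eapply T; [apply Hm|exact Hy].
Qed.

(** An approximation to the recursive function on the transitive set [d]. Only the values of [f] on
    [d] matter; [f] need not be a function. *)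
Definition attempt (G : V -> V -> V) f d :=
  Tr d /\ forall y, y ∊ d -> app f y = G y (lam y (app f)).
Definition rec (G : V -> V -> V) x := the (fun v => exists f d, attempt G f d /\ x ∊ d /\ v = app f x).

Section Rec.
Context (G : V -> V -> V) (HG : df2 G).
Lemma dp2_attempt : dp2 (attempt G).
Proof. pose proof dp1_Tr. unfold attempt. dfn. Qed.

Lemma attempt_agree f g d d' : attempt G f d -> attempt G g d' ->
  forall y, y ∊ d -> y ∊ d' -> app f y = app g y.
Proof.
  intros [T H] [T' H'].
  apply (ind (fun y => y ∊ d -> y ∊ d' -> app f y = app g y)); [dfn|].
  intros x IH Hx Hx'. rewrite H, H' by assumption. f_equal.
  apply lam_ext; auto using df1_app. intros y Hy. apply IH; auto; [eapply T|eapply T']; eauto.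
Qed.
Lemma attempt_ex x : exists f d, attempt G f d /\ x ∊ d.
Proof.
  pose proof dp2_attempt as DA.
  revert x. apply ind; [dfn|]. intros x IH.
  destruct (trcl_ex x) as (t & T & S).
  (* [s] consists of the points of a transitive set around [x] that some attempt reaches. It is
     transitive and, by the induction hypothesis, contains every element of [x]; the attempts are
     glued on [s] and prolonged to [x]. *)
  set (s := sep t (fun z => exists f d, attempt G f d /\ z ∊ d)).
  assert (Es : forall z, z ∊ s <-> z ∊ t /\ exists f d, attempt G f d /\ z ∊ d)
    by (intro; unfold s; rewrite sepE by dfn; reflexivity).
  assert (Ts : Tr s).
  { intros y Hy z Hz. rewrite Es in *. destruct Hy as (Hy & f & d & A & Hd).
    split; [eapply T; eauto|]. exists f, d. split; [exact A|]. eapply A; eauto. }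
  assert (Sx : Sub x s) by (intros y Hy; apply Es; auto).
  destruct (repl_rel s (fun z c => exists f d, attempt G f d /\ z ∊ d /\ c = pair z (app f z))) as [f0 Hf0]; [dfn| |].
  { intros z y y' _ (f & d & A & Hd & ->) (g & d' & A' & Hd' & ->). f_equal. eapply attempt_agree; eauto. }
  assert (Ef0 : forall f d z, attempt G f d -> z ∊ d -> z ∊ s -> app f0 z = app f z).
  { intros f d z A Hd Hz. apply app_eq.
    - apply Hf0. exists z. split; [exact Hz|]. eauto.
    - intros y' K. apply Hf0 in K. destruct K as (z' & _ & g & d' & A' & Hd' & E).
      apply pair_inj in E. destruct E as [<- ->]. eapply attempt_agree; eauto. }
  set (F := fun z => G z (lam z (app f0))).
  assert (DF : df1 F) by (unfold F; dfn).
  assert (A0 : forall z, z ∊ s -> F z = app f0 z).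
  { intros z Hz. pose proof Hz as Hz'. apply Es in Hz'. destruct Hz' as (Hz' & f & d & A & Hd).
    rewrite (Ef0 f d z) by assumption. unfold F. rewrite (proj2 A z Hd). f_equal.
    apply lam_ext; auto using df1_app. intros y Hy. apply Ef0 with d; auto.
    - eapply A; eauto.
    - eapply Ts; eauto. }
  set (d := cup s (sing x)).
  assert (Ed : forall z, z ∊ d -> Sub z s).
  { intros z Hz. unfold d in Hz. rewrite cupE, singE in Hz. destruct Hz as [Hz| ->]; auto. }
  exists (lam d F), d. split; [split|].
  - intros y Hy z Hz. apply cupE. left. exact (Ed y Hy z Hz).
  - intros y Hy. rewrite app_lam by assumption. unfold F. f_equal.
    apply lam_ext; auto using df1_app. intros z Hz. rewrite app_lam; [|assumption|apply cupE; left; exact (Ed y Hy z Hz)].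
    symmetry. apply A0. exact (Ed y Hy z Hz).
  - apply cupE. right. now apply singE.
Qed.
Lemma rec_val f d x : attempt G f d -> x ∊ d -> rec G x = app f x.
Proof.
  intros A Hx. destruct (the_spec (fun v => exists f d, attempt G f d /\ x ∊ d /\ v = app f x)) as (g & d' & A' & H & E).
  - eauto 6.
  - unfold rec. rewrite E. eapply attempt_agree; eauto.
Qed.
Lemma df1_rec : df1 (rec G).
Proof.
  pose proof dp2_attempt as DA.
  apply dfn_iff with (fun e => exists f d, attempt G f d /\ e 1 ∊ d /\ e 0 = app f (e 1)); [|dfn].
  intro e. split.
  - intros (f & d & A & H & ->). symmetry. eapply rec_val; eauto.
  - intros ->. destruct (attempt_ex (e 1)) as (f & d & A & H). exists f, d. repeat split; auto; try apply A.
    eapply rec_val; eauto.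
Qed.
Lemma rec_eq x : rec G x = G x (lam x (rec G)).
Proof.
  destruct (attempt_ex x) as (f & d & A & H). rewrite (rec_val f d) by assumption.
  rewrite (proj2 A x H). f_equal. apply lam_ext; auto using df1_app, df1_rec.
  intros y Hy. symmetry. apply rec_val with d; auto. eapply A; eauto.
Qed.
End Rec.

Lemma dt_rec (G : V -> V -> (nat -> V) -> V) (t : (nat -> V) -> V) :
  dt t -> dt (fun e => G (e 0) (e 1) (fun n => e (S (S n)))) ->
  dt (fun e => rec (fun x f => G x f e) (t e)).
Proof.
  intros Ht H. red.
  apply dfn_iff with (fun e => exists f d, attempt (fun x f => G x f (fun n => e (S n))) f d /\ t (fun n => e (S n)) ∊ d /\ e 0 = app f (t (fun n => e (S n)))).
  - intro e. pose proof (dt_at0' G H (fun n => e (S n))) as HG. split.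
    + intros (f & d & A & Hx & ->). symmetry. eapply rec_val; eauto.
    + intros ->. destruct (attempt_ex _ HG (t (fun n => e (S n)))) as (f & d & A & Hx).
      exists f, d. repeat split; auto; try apply A. eapply rec_val; eauto.
  - pose proof (dt_shift t (fun n => S (S (S n))) Ht) as Ht3. cbv beta in Ht3.
    pose proof dp1_Tr. unfold attempt. apply dfn_ex, dfn_ex. apply dfn_and; [|dfn].
    apply dfn_and; [dfn|]. apply dfn_all. apply dfn_imp; [dfn|]. apply dfn_eq; [dfn|].
    apply (dfn_sub (fun l e => e 0 = G (e 1) l (fun n => e (S (S (S (S (S n)))))))
       (fun e => lam (e 1) (fun y => app (e 3) y))); [dfn|].
    apply (dfn_eq (fun e => e 1)); [dfn|].
    exact (dt_shift (fun e => G (e 0) (e 1) (fun n => e (S (S n))))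
      (fun n => match n with 0 => 2 | 1 => 0 | S (S m) => S (S (S (S (S (S m))))) end) H).
Qed.
End Recursion.
#[export] Hint Extern 2 (dt (fun e => rec _ _)) => (apply dt_rec) : dfn.
#[export] Hint Extern 2 (dfn (fun e => Tr _)) => apply (dp1_sub _ _ dp1_Tr) : dfn.

(** * Ordinals, rank and collection *)

Section Ordinals.
Context {V : Type} {M : Model V}.
Implicit Types a b c d f g s t u v w x y z : V.

Definition Ord x := Tr x /\ forall y, y ∊ x -> Tr y.
Lemma dp1_Ord : dp1 Ord. Proof. unfold Ord. dfn. Qed.
Hint Extern 2 (dfn (fun e => Ord _)) => apply (dp1_sub _ _ dp1_Ord) : dfn.
Lemma ord_in a b : Ord a -> b ∊ a -> Ord b.
Proof. intros [T H] K. split; [auto|]. intros y Hy. apply H. exact (T b K y Hy). Qed.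
Lemma ord_trans a b c : Ord a -> b ∊ a -> c ∊ b -> c ∊ a.
Proof. intros [T _] H. exact (T b H c). Qed.
Lemma ord_tri a : Ord a -> forall b, Ord b -> a ∊ b \/ a = b \/ b ∊ a.
Proof.
  revert a. apply (ind (fun a => Ord a -> forall b, Ord b -> a ∊ b \/ a = b \/ b ∊ a)); [dfn|]. intros a IHa Ha.
  apply (ind (fun b => Ord b -> a ∊ b \/ a = b \/ b ∊ a)); [dfn|]. intros b IHb Hb.
  destruct (classic (a ∊ b)) as [|N1]; [auto|]. destruct (classic (b ∊ a)) as [|N2]; [auto|].
  right; left. apply set_ext. intro x. split; intro Hx.
  - destruct (IHa x Hx (ord_in _ _ Ha Hx) b Hb) as [|[->|K]]; [auto|tauto|].
    destruct N2. eapply ord_trans; eauto.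
  - destruct (IHb x Hx (ord_in _ _ Hb Hx)) as [K|[->|K]]; [|tauto|auto].
    destruct N1. eapply ord_trans; eauto.
Qed.
Lemma ord_sub a b : Ord a -> Ord b -> Sub a b <-> a = b \/ a ∊ b.
Proof.
  intros Ha Hb. split.
  - intro S. destruct (ord_tri a Ha b Hb) as [H|[H|H]]; auto. destruct (no_refl b). auto.
  - intros [->|H]; [apply Sub_refl|]. intros z. eapply ord_trans; eauto.
Qed.
Lemma ord_lin a b : Ord a -> Ord b -> Sub a b \/ b ∊ a.
Proof. intros Ha Hb. destruct (ord_tri a Ha b Hb) as [H|[H|H]]; auto; left; apply ord_sub; auto. Qed.
Lemma ord_suc a : Ord a -> Ord (suc a).
Proof.
  intros [T H]. split.
  - intros y Hy z Hz. apply sucE. apply sucE in Hy. destruct Hy as [Hy| ->]; [left; exact (T y Hy z Hz)|auto].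
  - intros y Hy. apply sucE in Hy. destruct Hy as [Hy| ->]; auto.
Qed.
Lemma ord_Union s : (forall x, x ∊ s -> Ord x) -> Ord (Union s).
Proof.
  intro H. split.
  - intros y Hy z Hz. rewrite UnionE in *. destruct Hy as (u & Hu & Hy). exists u. split; [exact Hu|].
    eapply ord_trans; eauto.
  - intros y Hy. rewrite UnionE in Hy. destruct Hy as (u & Hu & Hy). exact (proj1 (ord_in u y (H u Hu) Hy)).
Qed.
Lemma ord_least (P : V -> Prop) a : dp1 P -> Ord a -> P a ->
  exists m, Ord m /\ P m /\ forall b, b ∊ m -> ~ P b.
Proof.
  intros D. revert a. apply (ind (fun a => Ord a -> P a -> exists m, Ord m /\ P m /\ forall b, b ∊ m -> ~ P b)); [dfn|].
  intros a IH Ha Pa. destruct (classic (exists b, b ∊ a /\ P b)) as [(b & Hb & Pb)|N].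
  - apply (IH b); auto. eapply ord_in; eauto.
  - exists a. split; [exact Ha|]. split; [exact Pa|]. intros b Hb Pb. apply N. eauto.
Qed.
Lemma suc_in a b : Ord a -> b ∊ a -> suc b = a \/ suc b ∊ a.
Proof.
  intros Ha Hb. apply ord_sub; [apply ord_suc; eapply ord_in; eauto|exact Ha|].
  intros z Hz. apply sucE in Hz. destruct Hz as [Hz| ->]; [|exact Hb]. eapply ord_trans; eauto.
Qed.
Lemma ord_max a b : Ord a -> Ord b -> cup a b = a \/ cup a b = b.
Proof.
  intros Ha Hb. assert (K : forall u v, Sub u v -> cup u v = v).
  { intros u v S. apply Sub_antisym; intros z; rewrite cupE; intuition auto. }
  destruct (ord_lin a b Ha Hb) as [S|H]; [right; auto|left].
  assert (S : Sub b a) by (apply ord_sub; auto).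
  apply Sub_antisym; intros z; rewrite cupE; intuition auto.
Qed.
(** Burali-Forti: the successor of the supremum of the ordinals in [s] cannot belong to [s]. *)
Lemma no_ord_set s : exists a, Ord a /\ ~ a ∊ s.
Proof.
  set (o := sep s Ord). assert (D := dp1_Ord).
  assert (Eo : forall x, x ∊ o <-> x ∊ s /\ Ord x) by (intro; unfold o; now rewrite sepE by dfn).
  exists (suc (Union o)). assert (Ho : Ord (Union o)).
  { apply ord_Union. intros x Hx. now apply Eo. }
  split; [now apply ord_suc|]. intro H. apply (no_refl (Union o)), UnionE.
  exists (suc (Union o)). split; [|apply sucE; auto]. apply Eo. auto using ord_suc.
Qed.

Definition rank x := rec (fun x f => Union (rep x (fun y => suc (app f y)))) x.
Lemma df1_rank : df1 rank. Proof. unfold rank. dfn. Qed.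
Hint Extern 2 (dt (fun e => rank _)) => apply (df1_sub _ _ df1_rank) : dfn.
Lemma rankE x z : z ∊ rank x <-> exists y, y ∊ x /\ z ∊ suc (rank y).
Proof.
  unfold rank at 1. rewrite rec_eq by dfn. rewrite UnionE. split.
  - intros (y & Hy & Hz). rewrite repE in Hy by dfn. destruct Hy as (u & Hu & ->).
    exists u. split; [exact Hu|]. rewrite app_lam in Hz by first [assumption|exact df1_rank]. exact Hz.
  - intros (y & Hy & Hz). exists (suc (rank y)). split; [|exact Hz]. rewrite repE by dfn.
    exists y. split; [exact Hy|]. now rewrite app_lam by first [assumption|exact df1_rank].
Qed.
Lemma rank_ord x : Ord (rank x).
Proof.
  revert x. apply ind; [dfn|]. intros x IH.
  replace (rank x) with (Union (rep x (fun y => suc (rank y)))).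
  - apply ord_Union. intros y Hy. rewrite repE in Hy by dfn. destruct Hy as (u & Hu & ->). auto using ord_suc.
  - apply set_ext. intro z. rewrite rankE, UnionE. split.
    + intros (y & Hy & Hz). rewrite repE in Hy by dfn. destruct Hy as (u & Hu & ->). eauto.
    + intros (y & Hy & Hz). exists (suc (rank y)). split; [|exact Hz]. rewrite repE by dfn. eauto.
Qed.
Lemma rank_in x y : y ∊ x -> rank y ∊ rank x.
Proof. intro H. apply rankE. exists y. split; [exact H|]. apply sucE; auto. Qed.
Lemma rank_sub x a : Ord a -> (forall y, y ∊ x -> rank y ∊ a) -> Sub (rank x) a.
Proof.
  intros Ha H z Hz. apply rankE in Hz. destruct Hz as (y & Hy & Hz). apply sucE in Hz.
  destruct Hz as [Hz| ->]; auto. eapply ord_trans; eauto.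
Qed.

Definition Vh a := rec (fun x f => Union (rep x (fun y => Pow (app f y)))) a.
Lemma df1_Vh : df1 Vh. Proof. unfold Vh. dfn. Qed.
Hint Extern 2 (dt (fun e => Vh _)) => apply (df1_sub _ _ df1_Vh) : dfn.
Lemma VhE' a x : x ∊ Vh a <-> exists b, b ∊ a /\ Sub x (Vh b).
Proof.
  unfold Vh at 1. rewrite rec_eq by dfn. rewrite UnionE. split.
  - intros (y & Hy & Hz). rewrite repE in Hy by dfn. destruct Hy as (u & Hu & ->).
    exists u. split; [exact Hu|]. rewrite app_lam in Hz by first [assumption|exact df1_Vh]. now apply PowE.
  - intros (y & Hy & Hz). exists (Pow (Vh y)). split; [|now apply PowE]. rewrite repE by dfn.
    exists y. split; [exact Hy|]. now rewrite app_lam by first [assumption|exact df1_Vh].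
Qed.
Lemma VhE a : Ord a -> forall x, x ∊ Vh a <-> rank x ∊ a.
Proof.
  revert a. apply (ind (fun a => Ord a -> forall x, x ∊ Vh a <-> rank x ∊ a)); [dfn|]. intros a IH Ha x.
  rewrite VhE'. split.
  - intros (b & Hb & S). assert (Ob := ord_in _ _ Ha Hb).
    assert (K : Sub (rank x) b). { apply rank_sub; [exact Ob|]. intros y Hy. apply (IH b Hb Ob). auto. }
    apply ord_sub in K; auto using rank_ord. destruct K as [->|K]; auto. eapply ord_trans; eauto.
  - intro H. exists (rank x). split; [exact H|]. intros y Hy. apply IH; auto using rank_ord, rank_in.
Qed.
Lemma Vh_Tr a : Ord a -> Tr (Vh a).
Proof.
  intros Ha y Hy z Hz. rewrite VhE in * by exact Ha. eapply ord_trans; eauto using rank_in.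
Qed.
Lemma in_Vh x : x ∊ Vh (suc (rank x)).
Proof. apply VhE; [apply ord_suc, rank_ord|]. apply sucE; auto. Qed.
Lemma pair_rank x y : rank x ∊ rank (pair x y) /\ rank y ∊ rank (pair x y).
Proof.
  assert (upair x y ∊ pair x y) by (apply upairE; auto).
  assert (rank (upair x y) ∊ rank (pair x y)) by now apply rank_in.
  split; (eapply ord_trans; [apply rank_ord|eassumption|]); apply rank_in, upairE; auto.
Qed.

Lemma rank_ind (P : V -> Prop) : dp1 P ->
  (forall x, (forall y, rank y ∊ rank x -> P y) -> P x) -> forall x, P x.
Proof.
  intros D H. assert (K : forall a, forall x, rank x = a -> P x).
  { apply (ind (fun a => forall x, rank x = a -> P x)); [dfn|]. intros a IH x <-. apply H. intros y Hy. exact (IH _ Hy y eq_refl). }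
  intro x. exact (K _ x eq_refl).
Qed.

(** Scott's trick: the least rank of a witness is unique, so replacement collects these ranks, and a
    level of the cumulative hierarchy above all of them contains a witness for each [x]. *)
Lemma collection a (R : V -> V -> Prop) : dp2 R ->
  exists b, forall x, x ∊ a -> (exists y, R x y) -> exists y, y ∊ b /\ R x y.
Proof.
  intro D.
  set (S := fun x α => (exists y, R x y /\ rank y = α) /\ forall y, R x y -> ~ rank y ∊ α).
  assert (DS : dp2 S) by (unfold S; dfn).
  destruct (repl_rel a S) as [o Ho]; [exact DS| |].
  { intros x α β Hx [(y & Ry & <-) K] [(z & Rz & <-) K'].
    destruct (ord_tri (rank y) (rank_ord y) _ (rank_ord z)) as [H|[H|H]]; auto.
    - destruct (K' y Ry H).
    - destruct (K z Rz H). }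
  assert (OU : Ord (Union o)).
  { apply ord_Union. intros α Hα. apply Ho in Hα. destruct Hα as (x & Hx & (y & _ & <-) & _). apply rank_ord. }
  exists (Vh (suc (suc (Union o)))). intros x Hx [y Hy].
  destruct (ord_least (fun α => exists y, R x y /\ rank y = α) (rank y)) as (m & Om & (z & Hz & <-) & Hm).
  - dfn.
  - apply rank_ord.
  - eauto.
  - exists z. split; [|exact Hz]. apply VhE; [auto using ord_suc|].
    assert (K : rank z ∊ o). { apply Ho. exists x. split; [exact Hx|]. split; [eauto|]. intros u Hu C. exact (Hm _ C (ex_intro _ u (conj Hu eq_refl))). }
    rewrite sucE. assert (S1 : Sub (rank z) (Union o)). { intros u Hu. apply UnionE. eauto. }
    apply ord_sub in S1; auto using rank_ord. rewrite sucE. destruct S1 as [->|]; auto.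
Qed.

(** Least indices replace choice. This is essential in [ext_choice], where the axiom of choice of
    the extension is still to be proved. *)
Lemma least_fun (a : V) (P : V -> V -> Prop) θ : dp2 P -> Ord θ ->
  (forall x, x ∊ a -> exists i, i ∊ θ /\ P x i) ->
  exists f, forall x, x ∊ a -> app f x ∊ θ /\ P x (app f x) /\ forall j, j ∊ app f x -> ~ P x j.
Proof.
  intros D O H.
  set (R := fun x i => i ∊ θ /\ P x i /\ forall j, j ∊ i -> ~ P x j).
  assert (DR : dp2 R) by (unfold R; dfn).
  assert (U : forall x i i', R x i -> R x i' -> i = i').
  { intros x i i' (Hi & Pi & Mi) (Hi' & Pi' & Mi').
    destruct (ord_tri i (ord_in _ _ O Hi) i' (ord_in _ _ O Hi')) as [K|[K|K]]; auto; [destruct (Mi' _ K Pi)|destruct (Mi _ K Pi')]. }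
  set (f := sep (prod a θ) (fun c => exists x i, c = pair x i /\ R x i)).
  exists f. intros x Hx.
  assert (E : exists i, R x i).
  { destruct (H x Hx) as (i & Hi & Pi). destruct (ord_least (fun i => i ∊ θ /\ P x i) i) as (m & Om & [Hm Pm] & K); [dfn|eapply ord_in; eauto|auto|].
    exists m. split; [auto|]. split; [auto|]. intros j Hj Pj. apply (K j Hj). split; [|exact Pj]. eapply ord_trans; eauto. }
  destruct E as [i Ri]. replace (app f x) with i; [exact Ri|]. symmetry. apply app_eq.
  - unfold f. rewrite sepE by dfn. rewrite prod_pair. split; [split; [exact Hx|apply Ri]|eauto].
  - intros y Hy. unfold f in Hy. sepin Hy. destruct Hy as [_ (x' & i' & E & Ri')]. apply pair_inj in E. destruct E; subst. eauto.
Qed.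
End Ordinals.
#[export] Hint Extern 2 (dfn (fun e => Ord _)) => apply (dp1_sub _ _ dp1_Ord) : dfn.
#[export] Hint Extern 2 (dt (fun e => rank _)) => apply (df1_sub _ _ df1_rank) : dfn.
#[export] Hint Extern 2 (dt (fun e => Vh _)) => apply (df1_sub _ _ df1_Vh) : dfn.

(** * Cardinals *)

(** Kept apart from [Model]: a generic extension is first shown to be a model, and its axiom of
    choice is then proved with the set theory developed for models. *)
Class Choice (V : Type) {M : Model V} : Prop :=
  ac : ⊨ (∀ s, (∀[x ∈ s] ∃ z, z ∈ x) ⇒
      ∃ f u, is_union s u ∧ is_fun f s u ∧ ∀[x ∈ s] ∀ z, rel f x z ⇒ z ∈ x).

Section Cardinals.
Context {V : Type} {M : Model V}.
Implicit Types a b c d f g s t u v w x y z : V.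

(** Only the values of [f] on [a] are constrained, which spares domain bookkeeping; [lam a (app f)]
    recovers a genuine function. *)
Definition Inj f a b := (forall x, x ∊ a -> app f x ∊ b) /\
  forall x y, x ∊ a -> y ∊ a -> app f x = app f y -> x = y.
Lemma dp3_Inj : dp3 Inj. Proof. unfold Inj. dfn. Qed.
Hint Extern 2 (dfn (fun e => Inj _ _ _)) => apply (dp3_sub _ _ _ _ dp3_Inj) : dfn.
Definition cle a b := exists f, Inj f a b.
Lemma dp2_cle : dp2 cle. Proof. unfold cle. dfn. Qed.
Hint Extern 2 (dfn (fun e => cle _ _)) => apply (dp2_sub _ _ _ dp2_cle) : dfn.
Definition Surj f a b := forall y, y ∊ b -> exists x, x ∊ a /\ app f x = y.
Lemma dp3_Surj : dp3 Surj. Proof. unfold Surj. dfn. Qed.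
Hint Extern 2 (dfn (fun e => Surj _ _ _)) => apply (dp3_sub _ _ _ _ dp3_Surj) : dfn.
Definition ceq a b := exists f, Inj f a b /\ Surj f a b.
Lemma dp2_ceq : dp2 ceq. Proof. unfold ceq. dfn. Qed.

Lemma InjI a b (F : V -> V) : df1 F -> (forall x, x ∊ a -> F x ∊ b) ->
  (forall x y, x ∊ a -> y ∊ a -> F x = F y -> x = y) -> Inj (lam a F) a b.
Proof.
  intros D H K. split.
  - intros x Hx. rewrite app_lam by assumption. auto.
  - intros x y Hx Hy. rewrite !app_lam by assumption. auto.
Qed.
Lemma cleI a b (F : V -> V) : df1 F -> (forall x, x ∊ a -> F x ∊ b) ->
  (forall x y, x ∊ a -> y ∊ a -> F x = F y -> x = y) -> cle a b.
Proof. intros. exists (lam a F). now apply InjI. Qed.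
Lemma Inj_IsFun f a b : Inj f a b -> IsFun (lam a (app f)) a b.
Proof. intros [H _]. apply lam_fun; auto using df1_app. Qed.
Lemma cleP a b : ⊨ card_le a b <-> cle a b.
Proof.
  change (⊨ card_le a b) with (exists f, (⊨ is_fun f a b) /\
    forall x x' y, (⊨ rel f x y) /\ (⊨ rel f x' y) -> x = x').
  setoid_rewrite IsFunP. setoid_rewrite relP. split.
  - intros (f & Hf & I). exists f. split; [apply Hf|]. intros x y Hx Hy E.
    apply (I x y (app f x)). rewrite !(fun_rel _ _ _ _ _ Hf). auto.
  - intros (f & Hf). exists (lam a (app f)). split; [eapply Inj_IsFun; eauto|].
    intros x x' y. rewrite !pair_lam by apply df1_app. intros [[Hx ->] [Hx' E]]. apply Hf; auto.
Qed.
Lemma ceqP a b : ⊨ card_eq a b <-> ceq a b.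
Proof.
  change (⊨ card_eq a b) with (exists f, (⊨ is_fun f a b) /\
    (forall x x' y, (⊨ rel f x y) /\ (⊨ rel f x' y) -> x = x') /\
    (forall y, y ∊ b -> exists x, ⊨ rel f x y)).
  setoid_rewrite IsFunP. setoid_rewrite relP. split.
  - intros (f & Hf & I & S). exists f. split; [split; [apply Hf|]|].
    + intros x y Hx Hy E. apply (I x y (app f x)). rewrite !(fun_rel _ _ _ _ _ Hf). auto.
    + intros y Hy. destruct (S y Hy) as [x Hx]. rewrite (fun_rel _ _ _ _ _ Hf) in Hx. exists x. intuition.
  - intros (f & Hf & S). exists (lam a (app f)). split; [eapply Inj_IsFun; eauto|]. split.
    + intros x x' y. rewrite !pair_lam by apply df1_app. intros [[Hx ->] [Hx' E]]. apply Hf; auto.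
    + intros y Hy. destruct (S y Hy) as (x & Hx & <-). exists x. rewrite pair_lam by apply df1_app. auto.
Qed.
Lemma cle_sub a b : Sub a b -> cle a b.
Proof. intro S. apply cleI with (fun x => x); [dfn|auto|auto]. Qed.
Lemma cle_refl a : cle a a. Proof. apply cle_sub, Sub_refl. Qed.
Lemma cle_trans a b c : cle a b -> cle b c -> cle a c.
Proof.
  intros (f & Hf & If) (g & Hg & Ig). apply cleI with (fun x => app g (app f x)); [dfn|auto|].
  intros x y Hx Hy E. apply If; auto.
Qed.
Lemma ceq_cle a b : ceq a b -> cle a b /\ cle b a.
Proof.
  intros (f & Hf & S). split; [exists f; exact Hf|].
  apply cleI with (fun y => Union (sep a (fun x => app f x = y))); [dfn| |].
  all: assert (K : forall x, x ∊ a -> Union (sep a (fun x' => app f x' = app f x)) = x).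
  1,3: intros x Hx; apply Union_sep_eq; [dfn|exact Hx|reflexivity|intros x' Hx' E; now apply Hf].
  - intros y Hy. destruct (S y Hy) as (x & Hx & <-). now rewrite K by assumption.
  - intros y y' Hy Hy'. destruct (S y Hy) as (x & Hx & <-). destruct (S y' Hy') as (x' & Hx' & <-).
    rewrite !K by assumption. now intros ->.
Qed.
Lemma Inj_inv f a b : Inj f a b -> exists g, forall x, x ∊ a -> app g (app f x) = x.
Proof.
  intros [Hf If]. set (g := sep (prod b a) (fun c => exists x, x ∊ a /\ c = pair (app f x) x)).
  exists g. intros x Hx. apply app_eq.
  - unfold g. rewrite sepE by dfn. rewrite prod_pair. split; eauto.
  - intros y Hy. unfold g in Hy. sepin Hy. destruct Hy as [_ (x' & Hx' & E)]. apply pair_inj in E.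
    destruct E as [E ->]. symmetry. auto.
Qed.

(** Schröder–Bernstein; [Y] is the greatest fixed point of [Y ↦ a \ g"(b \ f"Y)]. *)
Lemma cle_antisym a b : cle a b -> cle b a -> ceq a b.
Proof.
  intros (f & Hf) (g & Hg).
  destruct (Inj_inv g b a Hg) as [h Hh].
  pose (Ph := fun Y x => x ∊ a /\ forall y, y ∊ b -> app g y = x -> exists u, u ∊ Y /\ app f u = y).
  assert (DP : dp2 Ph) by (unfold Ph; dfn).
  set (Y := sep a (fun x => exists Z, x ∊ Z /\ Sub Z a /\ forall z, z ∊ Z -> Ph Z z)).
  assert (EY : forall x, x ∊ Y <-> x ∊ a /\ exists Z, x ∊ Z /\ Sub Z a /\ forall z, z ∊ Z -> Ph Z z)
    by (intro; unfold Y; rewrite sepE by dfn; reflexivity).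
  assert (YP : forall x, x ∊ Y -> Ph Y x).
  { intros x Hx. apply EY in Hx. destruct Hx as (Ha & Z & Hx & S & K). split; [exact Ha|].
    intros y Hy E. destruct (proj2 (K x Hx) y Hy E) as (u & Hu & E'). exists u. split; [|exact E'].
    apply EY. split; [auto|]. eauto. }
  assert (PY : forall x, Ph Y x -> x ∊ Y).
  { intros x Hx. apply EY. split; [apply Hx|]. exists (cup Y (sing x)).
    assert (S : Sub Y (cup Y (sing x))) by (intros u Hu; apply cupE; auto).
    split; [apply cupE; right; now apply singE|]. split.
    - intros u Hu. rewrite cupE, singE in Hu. destruct Hu as [Hu| ->]; [apply EY, Hu|apply Hx].
    - intros u Hu. assert (K : Ph Y u) by (rewrite cupE, singE in Hu; destruct Hu as [Hu| ->]; auto).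
      split; [apply K|]. intros y Hy E. destruct (proj2 K y Hy E) as (v & Hv & E'). eauto. }
  assert (NY : forall x, x ∊ a -> ~ x ∊ Y -> exists y, y ∊ b /\ app g y = x /\ forall u, u ∊ Y -> app f u <> y).
  { intros x Hx N. apply NNPP. intro C. apply N, PY. split; [exact Hx|]. intros y Hy E.
    apply NNPP. intro C'. apply C. exists y. repeat split; auto. intros u Hu E'. apply C'. eauto. }
  pose (F := fun x => ite (x ∊ Y) (app f x) (app h x)).
  assert (DF : df1 F) by (unfold F; dfn).
  assert (F1 : forall x, x ∊ Y -> F x = app f x) by (intros; now apply ite_true).
  assert (F2 : forall x, ~ x ∊ Y -> F x = app h x) by (intros; now apply ite_false).
  assert (Ya : Sub Y a) by (intros x Hx; now apply EY in Hx).
  exists (lam a F). split; [apply InjI; auto|].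
  - intros x Hx. destruct (classic (x ∊ Y)) as [H|H].
    + rewrite F1 by exact H. now apply Hf.
    + destruct (NY x Hx H) as (y & Hy & <- & _). rewrite F2, Hh; auto.
  - assert (X : forall x y, x ∊ a -> y ∊ a -> x ∊ Y -> ~ y ∊ Y -> F x <> F y).
    { intros x y Hx Hy Yx Ny. rewrite F1, F2 by assumption. destruct (NY y Hy Ny) as (u & Hu & <- & N).
      rewrite Hh by assumption. now apply N. }
    intros x y Hx Hy E. destruct (classic (x ∊ Y)) as [H|H]; destruct (classic (y ∊ Y)) as [H'|H'].
    + rewrite !F1 in E by assumption. apply Hf; auto.
    + destruct (X x y Hx Hy H H' E).
    + symmetry in E. destruct (X y x Hy Hx H' H E).
    + destruct (NY x Hx H) as (u & Hu & <- & _). destruct (NY y Hy H') as (v & Hv & <- & _).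
      rewrite !F2, !Hh in E by assumption. now subst.
  - intros y Hy. destruct (classic (app g y ∊ Y)) as [H|H].
    + destruct (proj2 (YP _ H) y Hy eq_refl) as (u & Hu & E). exists u.
      rewrite app_lam by auto. rewrite F1; auto.
    + exists (app g y). rewrite app_lam by first [assumption|now apply Hg]. rewrite F2, Hh by assumption.
      split; [now apply Hg|reflexivity].
Qed.

(** Exhausting [A] in the order prescribed by the selector [sel]. *)
Lemma enumerate A (sel : V -> V) : df1 sel ->
  (forall B, Sub B A -> B <> emp -> sel B ∊ B) ->
  exists θ e, Ord θ /\ Inj e θ A /\ Surj e θ A /\
    forall i, i ∊ θ -> app e i ∊ A /\ (forall j, j ∊ i -> app e j <> app e i) /\
      exists B, app e i = sel B /\ forall x, x ∊ B <-> x ∊ A /\ forall j, j ∊ i -> app e j <> x.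
Proof.
  intros D S.
  pose (E := rec (fun i f => sel (diff A (rep i (fun j => app f j))))).
  assert (DE : df1 E) by (unfold E; dfn).
  pose (R := fun i => diff A (rep i (fun j => E j))).
  assert (DR : df1 R) by (unfold R; dfn).
  assert (ER : forall i x, x ∊ R i <-> x ∊ A /\ forall j, j ∊ i -> E j <> x).
  { intros i x. unfold R. rewrite diffE, repE by dfn. split; intros [H K]; (split; [exact H|]).
    - intros j Hj C. apply K. eauto.
    - intros (j & Hj & ->). exact (K j Hj eq_refl). }
  assert (EE : forall i, E i = sel (R i)).
  { intro i. unfold E at 1. rewrite rec_eq by dfn. f_equal. unfold R. f_equal.
    apply set_ext. intro y. rewrite !repE by dfn. split; intros (j & Hj & ->); exists j; (split; [exact Hj|]).
    - rewrite app_lam; auto.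
    - rewrite app_lam; auto. }
  assert (In : forall i, R i <> emp -> E i ∊ A /\ forall j, j ∊ i -> E j <> E i).
  { intros i N. rewrite EE. apply ER, S; [|exact N]. intros x Hx. now apply ER in Hx. }
  (* If the exhaustion never stopped, [E] would be injective on the ordinals, and replacement along
     its inverse would give a set containing all of them. *)
  assert (X : exists θ, Ord θ /\ R θ = emp).
  { apply NNPP. intro N.
    assert (N' : forall i, Ord i -> R i <> emp) by (intros i Oi C; apply N; eauto).
    destruct (repl_rel A (fun x i => Ord i /\ E i = x)) as [o Ho]; [dfn| |].
    { intros x i i' _ [Oi <-] [Oi' Ei]. destruct (ord_tri i Oi i' Oi') as [H|[H|H]]; auto.
      - symmetry in Ei. destruct (proj2 (In i' (N' _ Oi')) i H Ei).
      - destruct (proj2 (In i (N' _ Oi)) i' H Ei). }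
    destruct (no_ord_set o) as (i & Oi & Ni). apply Ni, Ho. exists (E i). split; [apply In; auto|auto]. }
  destruct X as (θ0 & O0 & H0).
  destruct (ord_least (fun θ => R θ = emp) θ0) as (θ & Oθ & Hθ & K); [dfn|auto|auto|].
  assert (Eθ : forall i, i ∊ θ -> app (lam θ E) i = E i) by (intros; now apply app_lam).
  assert (W : forall i j, i ∊ θ -> j ∊ i -> j ∊ θ) by (intros; eapply ord_trans; eauto).
  exists θ, (lam θ E). split; [exact Oθ|]. split; [|split].
  - apply InjI; [exact DE| |].
    + intros i Hi. apply In, K, Hi.
    + intros i j Hi Hj C. destruct (ord_tri i (ord_in _ _ Oθ Hi) j (ord_in _ _ Oθ Hj)) as [H|[H|H]]; auto.
      * destruct (proj2 (In j (K j Hj)) i H C).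
      * symmetry in C. destruct (proj2 (In i (K i Hi)) j H C).
  - intros x Hx. apply NNPP. intro C. apply (empE x). rewrite <- Hθ. apply ER. split; [exact Hx|].
    intros j Hj E'. apply C. exists j. rewrite Eθ; auto.
  - intros i Hi. rewrite Eθ by exact Hi. destruct (In i (K i Hi)) as [I1 I2]. split; [exact I1|]. split.
    + intros j Hj. rewrite Eθ by eauto. auto.
    + exists (R i). split; [apply EE|]. intro x. rewrite ER. split; intros [H1 H2]; (split; [exact H1|]).
      * intros j Hj. rewrite Eθ by eauto. auto.
      * intros j Hj. rewrite <- Eθ by eauto. auto.
Qed.

(** With the least remaining element as selector, the exhaustion lists a well-ordered set in
    increasing order, so [θ] is its order type. *)
Lemma enumerate_rel A (R : V -> V -> Prop) : dp2 R ->
  (forall x y, x ∊ A -> y ∊ A -> R x y -> ~ R y x) ->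
  (forall B, Sub B A -> B <> emp -> exists m, m ∊ B /\ forall y, y ∊ B -> y = m \/ R m y) ->
  exists θ e, Ord θ /\ Inj e θ A /\ Surj e θ A /\
    forall i j, i ∊ θ -> j ∊ i -> R (app e j) (app e i).
Proof.
  intros D As W.
  pose (sel := fun B => Union (sep B (fun x => forall y, y ∊ B -> y = x \/ R x y))).
  assert (Es : forall B, Sub B A -> B <> emp -> sel B ∊ B /\ forall y, y ∊ B -> y = sel B \/ R (sel B) y).
  { intros B SB NB. destruct (W B SB NB) as (m & Hm & K).
    replace (sel B) with m; [auto|]. symmetry. apply Union_sep_eq; [dfn|exact Hm|exact K|].
    intros x Hx Kx. destruct (K x Hx) as [->|K']; [reflexivity|]. destruct (Kx m Hm) as [E|K'']; [now symmetry|].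
    destruct (As x m); auto. }
  destruct (enumerate A sel) as (θ & e & Oθ & I & S & H); [unfold sel; dfn|apply Es|].
  exists θ, e. repeat (split; [assumption|]). intros i j Hi Hj.
  assert (Hj' : j ∊ θ) by (eapply ord_trans; eauto).
  destruct (H j Hj') as (_ & _ & B & E & EB). destruct (H i Hi) as (Hi1 & Hi2 & _).
  (* The later value was still available at stage [j], where the least available element was
     taken. *)
  assert (KB : app e i ∊ B).
  { apply EB. split; [exact Hi1|]. intros k Hk. apply Hi2. eapply ord_trans; [eapply ord_in; eauto| |]; eauto. }
  destruct (Es B) as [_ K].
  - intros x Hx. now apply EB.
  - intros ->. destruct (empE _ KB).
  - rewrite <- E in K. destruct (K _ KB) as [C|C]; [|exact C]. symmetry in C. destruct (Hi2 j Hj C).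
Qed.

Lemma ord_set_least B : (forall x, x ∊ B -> Ord x) -> B <> emp ->
  exists m, m ∊ B /\ forall y, y ∊ B -> y = m \/ m ∊ y.
Proof.
  intros O N. destruct (nonempty B N) as [x Hx].
  destruct (ord_least (fun i => i ∊ B) x) as (m & Om & Hm & K); [dfn|auto|auto|].
  exists m. split; [exact Hm|]. intros y Hy. destruct (ord_tri m Om y (O y Hy)) as [H|[H|H]]; auto.
  destruct (K y H Hy).
Qed.

(** An increasing enumeration of ordinals dominates the identity, hence the order type of a subset
    of [k] is contained in [k]. *)
Lemma ord_subset_type A k : Ord k -> Sub A k ->
  exists θ, Ord θ /\ Sub θ k /\ ceq θ A.
Proof.
  intros Ok S.
  destruct (enumerate_rel A (fun x y => x ∊ y)) as (θ & e & Oθ & I & Su & H).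
  - dfn.
  - intros x y _ _. apply no_cycle.
  - intros B SB NB. apply ord_set_least; [|exact NB]. intros x Hx. eapply ord_in; eauto.
  - assert (K : forall i, i ∊ θ -> i = app e i \/ i ∊ app e i).
    { apply (ind (fun i => i ∊ θ -> i = app e i \/ i ∊ app e i)); [dfn|]. intros i IH Hi.
      assert (Oi : Ord i) by (eapply ord_in; eauto).
      assert (Oe : forall j, j ∊ θ -> Ord (app e j)) by (intros j Hj; apply (ord_in k); [exact Ok|]; apply S, I, Hj).
      apply ord_sub; auto. intros j Hj. assert (Hj' : j ∊ θ) by (eapply ord_trans; eauto).
      destruct (IH j Hj Hj') as [C|C]; [rewrite C; auto|]. eapply ord_trans; [auto|apply (H i j Hi Hj)|exact C]. }
    exists θ. split; [exact Oθ|]. split; [|exists e; auto]. intros i Hi.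
    assert (Hk : app e i ∊ k) by (apply S, I, Hi).
    destruct (K i Hi) as [->|C]; [exact Hk|]. eapply ord_trans; eauto.
Qed.

Section WithChoice.
Context {C : Choice V}.
Lemma choice_fun s : exists f, forall x, x ∊ s -> x <> emp -> app f x ∊ x.
Proof.
  destruct (ac (diff s (sing emp))) as (f & u & _ & Hf & K).
  { intros x Hx. apply nonempty. apply diffE in Hx. rewrite singE in Hx. tauto. }
  apply IsFunP in Hf. exists f. intros x Hx N.
  assert (Hx' : x ∊ diff s (sing emp)) by (apply diffE; rewrite singE; auto).
  apply (K x Hx'). apply relP. rewrite (fun_rel _ _ _ _ _ Hf). auto.
Qed.
Lemma choice_rel a b (R : V -> V -> Prop) : dp2 R ->
  (forall x, x ∊ a -> exists y, y ∊ b /\ R x y) ->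
  exists f, IsFun f a b /\ forall x, x ∊ a -> R x (app f x).
Proof.
  intros D H. destruct (choice_fun (Pow b)) as [c Hc].
  pose (F := fun x => app c (sep b (fun y => R x y))).
  assert (DF : df1 F) by (unfold F; dfn).
  assert (K : forall x, x ∊ a -> F x ∊ b /\ R x (F x)).
  { intros x Hx. destruct (H x Hx) as (y & Hy & Ry).
    assert (K : F x ∊ sep b (fun y => R x y)).
    { apply Hc.
      - apply PowE. intros z Hz. sepin Hz. tauto.
      - intro E. apply (empE y). rewrite <- E. rewrite sepE by dfn. auto. }
    sepin K. exact K. }
  exists (lam a F). split.
  - apply lam_fun; [exact DF|]. apply K.
  - intros x Hx. rewrite app_lam by assumption. now apply K.
Qed.
Lemma cle_surj a b (R : V -> V -> Prop) : dp2 R ->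
  (forall y, y ∊ b -> exists x, x ∊ a /\ R x y) ->
  (forall x y y', x ∊ a -> R x y -> R x y' -> y = y') -> cle b a.
Proof.
  intros D H U. destruct (choice_rel b a (fun y x => R x y)) as (f & Hf & K); [dfn|exact H|].
  exists f. split; [apply Hf|]. intros y y' Hy Hy' E. apply (U (app f y)).
  - now apply Hf.
  - auto.
  - rewrite E. auto.
Qed.
Lemma cle_image a (F : V -> V) : df1 F -> cle (rep a F) a.
Proof.
  intro D. apply cle_surj with (fun x y => y = F x); [dfn| |].
  - intros y Hy. now rewrite repE in Hy by dfn.
  - intros; congruence.
Qed.
Lemma wellorder A : exists θ e, Ord θ /\ Inj e θ A /\ Surj e θ A.
Proof.
  destruct (choice_fun (Pow A)) as [c Hc].
  destruct (enumerate A (app c)) as (θ & e & H1 & H2 & H3 & _); eauto using df1_app.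
  intros B S N. apply Hc; [|exact N]. now apply PowE.
Qed.
(** Dependent choice of length [θ], by recursion along a choice function for the subsets of [A]. It
    drives the transfinite constructions of sticky sets, of descending conditions and of maximal
    antichains. *)
Lemma sequence A (le D : V -> V -> Prop) θ : dp2 le -> dp2 D -> Ord θ ->
  (forall i f, i ∊ θ -> (forall j, j ∊ i -> app f j ∊ A /\ D j (app f j) /\
      forall j', j' ∊ j -> le (app f j') (app f j)) ->
    exists q, q ∊ A /\ D i q /\ forall j, j ∊ i -> le (app f j) q) ->
  exists f, forall i, i ∊ θ -> app f i ∊ A /\ D i (app f i) /\ forall j, j ∊ i -> le (app f j) (app f i).
Proof.
  intros Dl DD O H. destruct (choice_fun (Pow A)) as [c Hc].
  pose (B := fun i f => sep A (fun q => D i q /\ forall j, j ∊ i -> le (app f j) q)).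
  pose (F := rec (fun i f => app c (B i f))).
  assert (DB : df2 B) by (unfold B; dfn).
  assert (DF : df1 F) by (unfold F; dfn).
  exists (lam θ F).
  apply (ind (fun i => i ∊ θ -> app (lam θ F) i ∊ A /\ D i (app (lam θ F) i) /\
     forall j, j ∊ i -> le (app (lam θ F) j) (app (lam θ F) i))); [dfn|].
  intros i IH Hi.
  assert (W : forall j, j ∊ i -> j ∊ θ) by (intros; eapply ord_trans; eauto).
  assert (E : app (lam θ F) i = app c (B i (lam θ F))).
  { rewrite app_lam by assumption. unfold F at 1. rewrite rec_eq by dfn. f_equal.
    apply set_ext. intro q. unfold B. rewrite !sepE by dfn. apply and_iff_compat_l, and_iff_compat_l.
    split; intros K j Hj; specialize (K j Hj); rewrite app_lam in * by auto; exact K. }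
  destruct (H i (lam θ F) Hi) as (q & Hq & Dq & Lq).
  { intros j Hj. destruct (IH j Hj (W j Hj)) as (P1 & P2 & P3). auto. }
  assert (K : app c (B i (lam θ F)) ∊ B i (lam θ F)).
  { apply Hc.
    - apply PowE. intros z Hz. unfold B in Hz. sepin Hz. tauto.
    - intro C'. apply (empE q). rewrite <- C'. unfold B. rewrite sepE by dfn. auto. }
  rewrite <- E in K. unfold B in K. sepin K. exact K.
Qed.
End WithChoice.
End Cardinals.
#[export] Hint Extern 2 (dfn (fun e => Inj _ _ _)) => apply (dp3_sub _ _ _ _ dp3_Inj) : dfn.
#[export] Hint Extern 2 (dfn (fun e => Surj _ _ _)) => apply (dp3_sub _ _ _ _ dp3_Surj) : dfn.
#[export] Hint Extern 2 (dfn (fun e => cle _ _)) => apply (dp2_sub _ _ _ dp2_cle) : dfn.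
#[export] Hint Extern 2 (dfn (fun e => ceq _ _)) => apply (dp2_sub _ _ _ dp2_ceq) : dfn.

(** * Cardinal arithmetic and successor cardinals *)

Section Arithmetic.
Context {V : Type} {M : Model V}.
Implicit Types a b c d f g s t u v w x y z : V.

Notation one_ := (suc emp).
Lemma emp_neq_one : emp <> one_.
Proof. intro E. apply (empE emp). rewrite E at 2. apply sucE. auto. Qed.
Lemma cle_prod a a' b b' : cle a a' -> cle b b' -> cle (prod a b) (prod a' b').
Proof.
  intros (f & Hf & If) (g & Hg & Ig).
  set (r := sep (prod (prod a b) (prod a' b')) (fun c => exists x y, c = pair (pair x y) (pair (app f x) (app g y)))).
  assert (E : forall x y, x ∊ a -> y ∊ b -> app r (pair x y) = pair (app f x) (app g y)).
  { intros x y Hx Hy. apply app_eq.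
    - unfold r. rewrite sepE by dfn. rewrite !prod_pair. split; [auto|]. eauto.
    - intros z Hz. unfold r in Hz. sepin Hz. destruct Hz as [_ (x' & y' & E)].
      apply pair_inj in E. destruct E as [E ->]. apply pair_inj in E. destruct E; subst. auto. }
  exists r. split.
  - intros p Hp. apply prodE in Hp. destruct Hp as (x & Hx & y & Hy & ->).
    rewrite E by assumption. apply prod_pair. auto.
  - intros p q Hp Hq. apply prodE in Hp. destruct Hp as (x & Hx & y & Hy & ->).
    apply prodE in Hq. destruct Hq as (x' & Hx' & y' & Hy' & ->). rewrite !E by assumption.
    intro C. apply pair_inj in C. destruct C as [C C']. f_equal; auto.
Qed.

Section Absorb.
Context (K : V) (K0 : emp ∊ K) (K1 : one_ ∊ K) (KK : cle (prod K K) K).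
Lemma cle_cup a b : cle a K -> cle b K -> cle (cup a b) K.
Proof.
  intros (f & Hf & If) (g & Hg & Ig). apply cle_trans with (prod K K); [|exact KK].
  apply cleI with (fun x => ite (x ∊ a) (pair emp (app f x)) (pair one_ (app g x))); [dfn| |].
  - intros x Hx. destruct (classic (x ∊ a)) as [H|H].
    + rewrite ite_true by exact H. apply prod_pair; auto.
    + rewrite ite_false by exact H. apply cupE in Hx. apply prod_pair. intuition.
  - pose proof emp_neq_one.
    intros x y Hx Hy. apply cupE in Hx. apply cupE in Hy.
    destruct (classic (x ∊ a)) as [Hx'|Hx']; [rewrite (ite_true (x ∊ a))|rewrite (ite_false (x ∊ a))]; try assumption;
    (destruct (classic (y ∊ a)) as [Hy'|Hy']; [rewrite (ite_true (y ∊ a))|rewrite (ite_false (y ∊ a))]; try assumption);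
    intro E; apply pair_inj in E; destruct E as [E1 E2]; try congruence; [auto|].
    apply Ig; tauto.
Qed.
Lemma cle_sing x : cle (sing x) K.
Proof.
  apply cleI with (fun _ => emp); [dfn|auto|]. intros y z Hy Hz _. rewrite singE in *. congruence.
Qed.
Lemma cle_suc a : cle a K -> cle (suc a) K.
Proof. intro H. apply cle_cup; [exact H|]. apply cle_sing. Qed.
Lemma cle_Union {C : Choice V} I (F : V -> V) : df1 F -> cle I K -> (forall i, i ∊ I -> cle (F i) K) ->
  cle (Union (rep I F)) K.
Proof.
  intros D (e & He & Ie) H. set (W := Union (rep I F)).
  assert (EW : forall x, x ∊ W <-> exists i, i ∊ I /\ x ∊ F i).
  { intro x. now apply Union_repE. }
  destruct (choice_rel I (Pow (prod W K)) (fun i f => Inj f (F i) K)) as (c & _ & Hc); [dfn| |].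
  { intros i Hi. destruct (H i Hi) as [f Hf]. exists (lam (F i) (app f)). split.
    - apply PowE. intros p Hp. rewrite lamE in Hp by apply df1_app. destruct Hp as (x & Hx & ->).
      apply prod_pair. split; [apply EW; eauto|now apply Hf].
    - apply InjI; [apply df1_app|apply Hf|apply Hf]. }
  destruct (choice_rel W I (fun x i => x ∊ F i)) as (g & Hg & Hg'); [dfn| |].
  { intros x Hx. apply EW in Hx. exact Hx. }
  apply cle_trans with (prod K K); [|exact KK].
  apply cleI with (fun x => pair (app e (app g x)) (app (app c (app g x)) x)); [dfn| |].
  - intros x Hx. assert (app g x ∊ I) by now apply Hg. apply prod_pair. split; [auto|]. apply (Hc (app g x)); auto.
  - intros x y Hx Hy E. assert (app g x ∊ I) by now apply Hg. assert (app g y ∊ I) by now apply Hg.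
    apply pair_inj in E. destruct E as [E1 E2]. apply Ie in E1; auto. rewrite <- E1 in E2.
    apply (Hc (app g x)) in E2; auto. rewrite E1. auto.
Qed.
End Absorb.

Lemma cup_l x y z w : Ord z -> Ord w -> Ord x -> Ord y -> cup z w = cup x y \/ cup z w ∊ cup x y ->
  z ∊ suc (cup x y) /\ w ∊ suc (cup x y).
Proof.
  intros Oz Ow Ox Oy H.
  assert (Om : Ord (cup x y)) by (destruct (ord_max x y Ox Oy) as [->| ->]; auto).
  assert (On : Ord (cup z w)) by (destruct (ord_max z w Oz Ow) as [->| ->]; auto).
  apply ord_sub in H; auto. rewrite !sucE. split.
  - assert (S : Sub z (cup x y)) by (intros u Hu; apply H, cupE; auto). apply ord_sub in S; tauto.
  - assert (S : Sub w (cup x y)) by (intros u Hu; apply H, cupE; auto). apply ord_sub in S; tauto.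
Qed.

Section Hessenberg.
Context (l : V) (Ol : Ord l) (l0 : emp ∊ l) (l1 : one_ ∊ l) (ll : cle (prod l l) l).

(** Gödel's well-order of pairs: by maximum, then lexicographically. *)
Definition gless p q := exists x y z w, p = pair x y /\ q = pair z w /\
  (cup x y ∊ cup z w \/ (cup x y = cup z w /\ (x ∊ z \/ (x = z /\ y ∊ w)))).
Lemma glessE x y z w : gless (pair x y) (pair z w) <->
  (cup x y ∊ cup z w \/ (cup x y = cup z w /\ (x ∊ z \/ (x = z /\ y ∊ w)))).
Proof.
  unfold gless. split.
  - intros (x' & y' & z' & w' & E & E' & H). apply pair_inj in E. apply pair_inj in E'.
    destruct E, E'; subst. exact H.
  - intro H. exists x, y, z, w. auto.
Qed.
(** Induction on [α], started at [l], whose square is absorbed by hypothesis. If [α] embeds into a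
    smaller ordinal, the bound is inherited from there. Otherwise the type [θ] of Gödel's order on
    the square cannot exceed [α]: the pairs before a given one lie in the square of a successor of
    some [m] in [α], and that square is too small to contain a copy of [α]. *)
Lemma hessenberg α : Ord α -> Sub l α -> cle (prod α α) α.
Proof.
  revert α. apply (ind (fun α => Ord α -> Sub l α -> cle (prod α α) α)); [dfn|]. intros α IH Oα Sα.
  destruct (classic (exists β, β ∊ α /\ cle α β)) as [(β & Hβ & H)|N].
  { assert (Oβ : Ord β) by (eapply ord_in; eauto).
    assert (Sβ : cle β α) by (apply cle_sub, ord_sub; auto).
    destruct (ord_lin l β Ol Oβ) as [S|S].
    - apply cle_trans with β; [|exact Sβ]. apply cle_trans with (prod β β); [|apply IH; auto]. apply cle_prod; auto.
    - apply cle_trans with l; [|now apply cle_sub]. apply cle_trans with (prod l l); [|exact ll].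
      assert (cle α l) by (apply cle_trans with β; [exact H|]; apply cle_sub, ord_sub; auto). apply cle_prod; auto. }
  assert (Sl : l = α \/ l ∊ α) by now apply ord_sub. destruct Sl as [<-|Hl]; [exact ll|].
  destruct (enumerate_rel (prod α α) gless) as (θ & e & Oθ & I & S & H).
  - unfold gless. dfn.
  - intros p q Hp Hq. apply prodE in Hp. destruct Hp as (x & Hx & y & Hy & ->).
    apply prodE in Hq. destruct Hq as (z & Hz & w & Hw & ->). rewrite !glessE.
    intros [H|[E [H|[E1 H]]]] [H'|[E' [H'|[E2 H']]]]; try subst x; try subst z;
      try (eapply no_cycle; eassumption); try (eapply no_refl; eassumption);
      try (rewrite E in H'; eapply no_refl; eassumption); rewrite E' in H; eapply no_refl; eassumption.
  - intros B SB NB.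
    assert (OB : forall x y, pair x y ∊ B -> Ord x /\ Ord y /\ Ord (cup x y)).
    { intros x y Hp. apply SB, prod_pair in Hp. assert (Ord x /\ Ord y) as [Ox Oy] by (split; eapply ord_in; intuition eauto).
      split; [exact Ox|]. split; [exact Oy|]. destruct (ord_max x y Ox Oy) as [->| ->]; auto. }
    destruct (nonempty B NB) as [p Hp]. pose proof (SB p Hp) as Hp'. apply prodE in Hp'.
    destruct Hp' as (x0 & _ & y0 & _ & ->).
    destruct (ord_least (fun m => exists x y, pair x y ∊ B /\ m = cup x y) (cup x0 y0)) as (m & Om & (x1 & y1 & H1 & Em) & Km);
      [dfn|apply (OB x0 y0 Hp)|eauto|].
    destruct (ord_least (fun x => exists y, pair x y ∊ B /\ m = cup x y) x1) as (x & Ox & (y2 & H2 & Em2) & Kx);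
      [dfn|apply (OB x1 y1 H1)|eauto|].
    destruct (ord_least (fun y => pair x y ∊ B /\ m = cup x y) y2) as (y & Oy & (H3 & Em3) & Ky);
      [dfn|apply (OB x y2 H2)|eauto|].
    exists (pair x y). split; [exact H3|]. intros q Hq. pose proof (SB q Hq) as Hq'. apply prodE in Hq'.
    destruct Hq' as (z & _ & w & _ & ->). destruct (OB z w Hq) as (Oz & Ow & On). rewrite glessE, <- Em3.
    destruct (ord_tri m Om _ On) as [C|[C|C]]; [auto| |destruct (Km _ C); eauto].
    destruct (ord_tri x Ox z Oz) as [D|[D|D]]; [auto 10| |destruct (Kx _ D); eauto]. subst z.
    destruct (ord_tri y Oy w Ow) as [E|[E|E]]; [auto 10|subst; auto|destruct (Ky _ E); auto].
  - destruct (ceq_cle θ (prod α α)) as [_ Hθ]; [exists e; auto|].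
    destruct (ord_lin θ α Oθ Oα) as [Sθ|Hα].
    { eapply cle_trans; [exact Hθ|now apply cle_sub]. }
    exfalso. assert (He : app e α ∊ prod α α) by now apply I.
    apply prodE in He. destruct He as (x & Hx & y & Hy & Ee).
    assert (Ox : Ord x) by (apply (ord_in α); assumption). assert (Oy : Ord y) by (apply (ord_in α); assumption).
    set (m := cup x y). assert (Hm : m ∊ α) by (unfold m; destruct (ord_max x y Ox Oy) as [->| ->]; auto).
    assert (Om : Ord m) by (apply (ord_in α); assumption).
    (* What is enumerated before index [α] precedes [(x, y)] in Gödel's order, so both coordinates
       are at most the maximum [m]. *)
    assert (L : cle α (prod (suc m) (suc m))).
    { exists e. split.
      - intros j Hj. assert (Hj' : j ∊ θ) by (eapply ord_trans; eauto). assert (Hp : app e j ∊ prod α α) by now apply I.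
        apply prodE in Hp. destruct Hp as (z & Hz & w & Hw & Ej).
        pose proof (H α j Hα Hj) as G. rewrite Ee, Ej, glessE in G. rewrite Ej. apply prod_pair.
        apply cup_l; try (apply (ord_in α); assumption); tauto.
      - intros j j' Hj Hj'. apply I; eapply ord_trans; eauto. }
    destruct (ord_lin l m Ol Om) as [Sm|Sm].
    + assert (mm : cle (prod m m) m) by auto. apply N. exists m. split; [exact Hm|].
      eapply cle_trans; [exact L|]. eapply cle_trans; [|exact mm].
      assert (cle (suc m) m) by (apply cle_suc; auto using cle_refl). apply cle_prod; auto.
    + apply N. exists l. split; [exact Hl|]. eapply cle_trans; [exact L|]. eapply cle_trans; [|exact ll].
      assert (cle (suc m) l) by (apply cle_suc; auto; apply cle_sub, ord_sub; auto). apply cle_prod; auto.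
Qed.
End Hessenberg.

Lemma cardinalP k : ⊨ cardinal k <-> Ord k /\ forall a, a ∊ k -> ~ ceq a k.
Proof.
  change (⊨ cardinal k) with (Ord k /\ forall a, a ∊ k -> ~ (⊨ card_eq a k)).
  setoid_rewrite ceqP. reflexivity.
Qed.

(** The facts about [k = l⁺] on which both the covering argument and the forcing rest. They are
    established in the ground model and then once more in its extension. *)
Record succ_of (l k : V) : Prop := {
  so_Ol : Ord l; so_l0 : emp ∊ l; so_l1 : one_ ∊ l; so_ll : cle (prod l l) l;
  so_Ok : Ord k; so_lk : l ∊ k; so_small : forall i, i ∊ k -> cle i l; so_k : ~ cle k l }.

Lemma succ_ofI l k : Ord l -> emp ∊ l -> one_ ∊ l -> cle (prod l l) l -> (⊨ succ_card l k) -> succ_of l k.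
Proof.
  intros Ol l0 l1 ll (Ck & lk & Mk). apply cardinalP in Ck. destruct Ck as [Ok Ck].
  change (forall m, (⊨ cardinal m) /\ l ∊ m -> k = m \/ k ∊ m) in Mk.
  setoid_rewrite cardinalP in Mk.
  constructor; auto.
  - intros i Hi. assert (Oi : Ord i) by (eapply ord_in; eauto).
    (* [m] is the cardinality of [i]. If it were above [l], minimality of [k] among such cardinals
       would put [k] below or at [m], hence below or at [i]. *)
    destruct (ord_least (fun m => ceq m i) i) as (m & Om & Em & Km); [dfn|auto|apply cle_antisym; apply cle_refl|].
    assert (Sm : Sub m i).
    { destruct (ord_lin m i Om Oi) as [S|S]; [exact S|]. destruct (Km i S). apply cle_antisym; apply cle_refl. }
    destruct (ord_lin m l Om Ol) as [S|S].
    + apply cle_trans with m; [apply ceq_cle, Em|now apply cle_sub].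
    + exfalso. assert (L : k = m \/ k ∊ m).
      { apply Mk. split; [split; [exact Om|]|exact S]. intros b Hb E. apply (Km b Hb). apply ceq_cle in E. apply ceq_cle in Em.
        apply cle_antisym; eapply cle_trans; intuition eauto. }
      assert (Hk : k ∊ i \/ k = i). { apply ord_sub in Sm; auto. destruct L as [->|L]; [intuition|].
        left. destruct Sm as [->|Sm]; [exact L|]. eapply ord_trans; eauto. }
      destruct Hk as [Hk| ->]; [exact (no_cycle _ _ Hk Hi)|exact (no_refl _ Hi)].
  - intro H. apply (Ck l lk). apply cle_antisym; [|exact H]. apply cle_sub, ord_sub; auto.
Qed.

Section Succ.
Context {C : Choice V} {l k : V} (so : succ_of l k).
Let Ol := so_Ol l k so. Let l0 := so_l0 l k so. Let l1 := so_l1 l k so. Let ll := so_ll l k so.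
Let Ok := so_Ok l k so. Let lk := so_lk l k so. Let small := so_small l k so. Let nk := so_k l k so.

Lemma so_sub : Sub l k. Proof. apply ord_sub; auto. Qed.
Lemma so_k0 : emp ∊ k. Proof. apply so_sub, l0. Qed.
Lemma so_k1 : one_ ∊ k. Proof. apply so_sub, l1. Qed.
Lemma so_kk : cle (prod k k) k.
Proof. apply (hessenberg l); auto using so_sub. Qed.
Lemma so_lt A : ⊨ card_lt A k <-> cle A l.
Proof.
  change (⊨ card_lt A k) with ((⊨ card_le A k) /\ ~ (⊨ card_le k A)). rewrite !cleP. split.
  - intros [(f & Hf) N]. destruct (ord_subset_type (rep A (app f)) k Ok) as (θ & Oθ & S & E).
    { intros y Hy. rewrite repE in Hy by apply df1_app. destruct Hy as (x & Hx & ->). now apply Hf. }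
    apply ceq_cle in E. destruct E as [E1 E2].
    assert (A1 : cle A (rep A (app f))).
    { exists f. split; [|apply Hf]. intros x Hx. rewrite repE by apply df1_app. eauto. }
    assert (A2 : cle (rep A (app f)) A) by apply cle_image, df1_app.
    apply ord_sub in S; auto. destruct S as [->|S].
    + destruct N. eapply cle_trans; eauto.
    + eapply cle_trans; [exact A1|]. eapply cle_trans; [exact E2|]. auto.
  - intro H. split; [eapply cle_trans; [exact H|]; apply cle_sub, so_sub|].
    intro H'. apply nk. eapply cle_trans; eauto.
Qed.
Lemma so_big A : ~ cle A l -> cle k A.
Proof.
  intro N. destruct (wellorder A) as (θ & e & Oθ & I & S).
  destruct (ceq_cle θ A) as [E1 E2]; [exists e; auto|].
  destruct (ord_lin k θ Ok Oθ) as [H|H].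
  - eapply cle_trans; [|exact E1]. now apply cle_sub.
  - destruct N. eapply cle_trans; [exact E2|]. auto.
Qed.
Lemma so_suc i : i ∊ k -> suc i ∊ k.
Proof.
  intro Hi. destruct (suc_in k i Ok Hi) as [E|E]; [|exact E]. destruct nk. rewrite <- E. apply cle_suc; auto.
Qed.
(** The supremum of [B] is a union of at most [l] sets of size at most [l], so it has size at most
    [l] and differs from [k]. *)
Lemma so_regular B : Sub B k -> cle B l -> exists i, i ∊ k /\ forall b, b ∊ B -> b ∊ i.
Proof.
  intros S H. set (U := Union (rep B (fun b => b))).
  assert (EU : forall x, x ∊ U <-> exists b, b ∊ B /\ x ∊ b).
  { intro x. apply Union_repE. dfn. }
  assert (LU : cle U l) by (apply cle_Union; auto; dfn).
  assert (OU : Ord U). { apply ord_Union. intros x Hx. rewrite repE in Hx by dfn. destruct Hx as (b & Hb & ->). eapply ord_in; eauto. }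
  assert (SU : Sub U k). { intros x Hx. apply EU in Hx. destruct Hx as (b & Hb & Hx). apply (ord_trans k b); auto. }
  apply ord_sub in SU; auto. destruct SU as [E|HU]; [destruct nk; now rewrite <- E|].
  exists (suc U). split; [now apply so_suc|]. intros b Hb. apply sucE.
  assert (Sb : Sub b U) by (intros x Hx; apply EU; eauto). apply ord_sub in Sb; [tauto|apply (ord_in k); auto|exact OU].
Qed.
(** Closing off under [H]: each stage absorbs [H] of all earlier stages. The length [k], instead of
    ω, matters for antichains, where a set of size [l] has to be caught by a single stage. *)
Lemma so_closing J0 (H : V -> V) : df1 H -> cle J0 k -> (forall J, cle J k -> cle (H J) k) ->
  exists f, forall i, i ∊ k -> cle (app f i) k /\ Sub J0 (app f i) /\
    forall j, j ∊ i -> Sub (app f j) (app f i) /\ Sub (H (app f j)) (app f i).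
Proof.
  intros D L0 LH.
  pose (F := rec (fun i f => cup J0 (Union (rep i (fun j => cup (app f j) (H (app f j))))))).
  assert (DF : df1 F) by (unfold F; dfn).
  assert (E : forall i, F i = cup J0 (Union (rep i (fun j => cup (F j) (H (F j)))))).
  { intro i. unfold F at 1. rewrite rec_eq by dfn. f_equal. f_equal. apply set_ext. intro x.
    rewrite !repE by dfn. split; intros (j & Hj & ->); exists j; (split; [exact Hj|]); fold F;
    rewrite app_lam by auto; reflexivity. }
  exists (lam k F). intros i Hi. rewrite app_lam by assumption. split; [|split].
  - revert Hi. apply (ind (fun i => i ∊ k -> cle (F i) k)) with (x := i); [dfn|]. clear i. intros i IH Hi.
    rewrite E. pose proof so_k0. pose proof so_k1. pose proof so_kk. apply cle_cup; auto.
    apply cle_Union; auto; [dfn|eapply cle_trans; [apply small, Hi|]; apply cle_sub, so_sub|].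
    intros j Hj. assert (j ∊ k) by (apply (ord_trans k i); auto). apply cle_cup; auto.
  - rewrite E. intros x Hx. apply cupE. auto.
  - intros j Hj. assert (Hj' : j ∊ k) by (apply (ord_trans k i); auto). rewrite app_lam by assumption.
    rewrite (E i). split; intros x Hx; apply cupE; right; apply UnionE; exists (cup (F j) (H (F j)));
    (split; [rewrite repE by dfn; eauto|apply cupE; auto]).
Qed.
End Succ.
End Arithmetic.

(** * Covering locally small spaces *)

Section Covering.
Context {V : Type} {M : Model V} {C : Choice V} {l k : V} (so : succ_of l k).
Context (X t U : V).
Context (T1 : forall u, u ∊ t -> Sub u X) (T3 : forall s, Sub s t -> Union s ∊ t)
  (T4 : forall u v, u ∊ t -> v ∊ t -> cap u v ∊ t).
Context (FU : IsFun U X t) (NU : forall x, x ∊ X -> x ∊ app U x) (NS : forall x, x ∊ X -> cle (app U x) l).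
Context (KD : forall Y, Y ∊ t -> cle Y k -> ⊨ subspace_kappa_D k t U Y).
Implicit Types D E Y x y z p : V.
Let N x := app U x.
Local Lemma Nt x : x ∊ X -> N x ∊ t. Proof. intro H. now apply FU. Qed.
Local Lemma NX x : x ∊ X -> Sub (N x) X. Proof. intro H. now apply T1, Nt. Qed.
Let Ok := so_Ok l k so.

(** Closed discreteness, in a form that visibly passes to subsets. *)
Definition closed_discrete_set D := Sub D X /\ forall p, p ∊ X -> exists u, u ∊ t /\ p ∊ u /\ forall z, z ∊ u -> z ∊ D -> z = p.
Definition covers D z := exists x, x ∊ D /\ z ∊ app U x.
Definition sticky_set D := closed_discrete_set D /\ forall b, b ∊ X -> (exists z, z ∊ D /\ z ∊ app U b) -> covers D b.
Definition end_extends D E := Sub D E /\ forall z, z ∊ E -> ~ z ∊ D -> ~ covers D z.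
Lemma dp2_covers : dp2 covers. Proof. unfold covers. dfn. Qed.
Hint Extern 2 (dfn (fun e => covers _ _)) => apply (dp2_sub _ _ _ dp2_covers) : dfn.
Lemma dp1_sticky_set : dp1 sticky_set. Proof. unfold sticky_set, closed_discrete_set. dfn. Qed.
Hint Extern 2 (dfn (fun e => sticky_set _)) => apply (dp1_sub _ _ dp1_sticky_set) : dfn.
Lemma dp2_end_extends : dp2 end_extends. Proof. unfold end_extends. dfn. Qed.
Hint Extern 2 (dfn (fun e => end_extends _ _)) => apply (dp2_sub _ _ _ dp2_end_extends) : dfn.

Lemma covers_mono D E z : Sub D E -> covers D z -> covers E z.
Proof. intros S (x & Hx & H). exists x. auto. Qed.
Lemma end_extends_refl D : end_extends D D.
Proof. split; [apply Sub_refl|]. tauto. Qed.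
Lemma end_extends_trans D E F : end_extends D E -> end_extends E F -> end_extends D F.
Proof.
  intros [S H] [S' H']. split; [eapply Sub_trans; eauto|]. intros z Hz Nz Cz.
  destruct (classic (z ∊ E)) as [HE|HE]; [exact (H z HE Nz Cz)|].
  apply (H' z Hz HE). eapply covers_mono; eauto.
Qed.
Lemma closed_discrete_setE D : closed_discrete_set D -> ⊨ closed_discrete X t D.
Proof.
  intros [S H].
  change (((Sub D X) /\ exists c, c ∊ t /\ forall z, (z ∊ c -> z ∊ X /\ ~ z ∊ D) /\ (z ∊ X /\ ~ z ∊ D -> z ∊ c)) /\
    forall x, x ∊ D -> exists u, u ∊ t /\ forall z, (z ∊ u /\ z ∊ D -> z = x) /\ (z = x -> z ∊ u /\ z ∊ D)).
  split; [split; [exact S|]|].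
  - set (s := sep t (fun u => forall z, z ∊ u -> ~ z ∊ D)).
    exists (Union s). split.
    + apply T3. intros u Hu. unfold s in Hu. sepin Hu. tauto.
    + intro z. rewrite UnionE. split.
      * intros (u & Hu & Hz). unfold s in Hu. sepin Hu. split; [eapply T1; [apply Hu|exact Hz]|now apply Hu].
      * intros [Hz Nz]. destruct (H z Hz) as (u & Hu & Hzu & K). exists u. split; [|exact Hzu].
        unfold s. rewrite sepE by dfn. split; [exact Hu|]. intros w Hw Hw'. apply K in Hw; auto. now subst.
  - intros x Hx. destruct (H x (S x Hx)) as (u & Hu & Hxu & K). exists u. split; [exact Hu|].
    intro z. split; [intros []; auto|]. intros ->. auto.
Qed.

Lemma closed_discrete_set_sub D E : Sub E D -> closed_discrete_set D -> closed_discrete_set E.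
Proof.
  intros S [H K]. split; [eapply Sub_trans; eauto|]. intros p Hp. destruct (K p Hp) as (u & Hu & Hpu & W).
  exists u. auto.
Qed.
Lemma sticky_cup D E : sticky_set D -> sticky_set E -> sticky_set (cup D E).
Proof.
  intros [[S H] K] [[S' H'] K']. split; [split|].
  - intros z Hz. apply cupE in Hz. destruct Hz; auto.
  - intros p Hp. destruct (H p Hp) as (u & Hu & Hpu & W). destruct (H' p Hp) as (u' & Hu' & Hpu' & W').
    exists (cap u u'). split; [now apply T4|]. rewrite capE. split; [auto|].
    intros z Hz Hz'. rewrite capE in Hz. rewrite cupE in Hz'. destruct Hz, Hz'; auto.
  - intros b Hb (z & Hz & Hzb). apply cupE in Hz. destruct Hz as [Hz|Hz].
    + eapply covers_mono; [|apply K; eauto]. intros w Hw. apply cupE; auto.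
    + eapply covers_mono; [|apply K'; eauto]. intros w Hw. apply cupE; auto.
Qed.
(** End extension is what makes unions closed discrete. Near a point covered by a member [D] through
    [x], the set [U(x)] meets the union only inside [D], and closed discreteness of [D] applies. At
    a point [p] covered by no member, [U(p)] misses the union, since stickiness would otherwise make
    [p] covered. *)
Lemma sticky_chain c : (forall D, D ∊ c -> sticky_set D) -> (forall D E, D ∊ c -> E ∊ c -> end_extends D E \/ end_extends E D) ->
  sticky_set (Union c) /\ forall D, D ∊ c -> end_extends D (Union c).
Proof.
  intros H L.
  assert (SU : forall D, D ∊ c -> Sub D (Union c)) by (intros D HD z Hz; apply UnionE; eauto).
  assert (In : forall D z, D ∊ c -> z ∊ Union c -> covers D z -> z ∊ D).
  { intros D z HD Hz Cz. apply UnionE in Hz. destruct Hz as (E & HE & Hz).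
    apply NNPP. intro Nz. destruct (L D E HD HE) as [K|K]; [exact (proj2 K z Hz Nz Cz)|]. apply Nz, K, Hz. }
  split; [split; [split|]|].
  - intros z Hz. apply UnionE in Hz. destruct Hz as (D & HD & Hz). now apply (H D HD).
  - intros p Hp. destruct (classic (exists D, D ∊ c /\ covers D p)) as [(D & HD & x & Hx & Hpx)|Np].
    + destruct (proj2 (proj1 (H D HD)) p Hp) as (u & Hu & Hpu & W).
      assert (HxX : x ∊ X) by now apply (H D HD).
      exists (cap (app U x) u). split; [apply T4; [now apply Nt|exact Hu]|]. rewrite capE. split; [auto|].
      intros z Hz Hz'. rewrite capE in Hz. apply W; [tauto|]. apply In; auto. exists x. tauto.
    + exists (app U p). split; [now apply Nt|]. split; [auto|]. intros z Hz Hz'. apply UnionE in Hz'.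
      destruct Hz' as (D & HD & Hz'). destruct Np. exists D. split; [exact HD|]. apply (H D HD); eauto.
  - intros b Hb (z & Hz & Hzb). apply UnionE in Hz. destruct Hz as (D & HD & Hz).
    eapply covers_mono; [exact (SU D HD)|]. apply (H D HD); eauto.
  - intros D HD. split; [auto|]. intros z Hz Nz Cz. apply Nz, In; auto.
Qed.
Lemma sticky_sequence i f : Ord i -> (forall j, j ∊ i -> sticky_set (app f j)) ->
  (forall j j', j ∊ i -> j' ∊ j -> end_extends (app f j') (app f j)) ->
  sticky_set (Union (rep i (app f))) /\ forall j, j ∊ i -> end_extends (app f j) (Union (rep i (app f))).
Proof.
  intros Oi H L. destruct (sticky_chain (rep i (app f))) as [K K'].
  - intros D HD. rewrite repE in HD by apply df1_app. destruct HD as (j & Hj & ->). auto.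
  - intros D E HD HE. rewrite repE in HD by apply df1_app. rewrite repE in HE by apply df1_app.
    destruct HD as (j & Hj & ->). destruct HE as (j' & Hj' & ->).
    destruct (ord_tri j (ord_in _ _ Oi Hj) j' (ord_in _ _ Oi Hj')) as [W|[->|W]]; [left; auto|left; apply end_extends_refl|right; auto].
  - split; [exact K|]. intros j Hj. apply K'. rewrite repE by apply df1_app. eauto.
Qed.
(** If [U(z) ⊆ W] for [z] in [W], a point outside [W] can only be covered from outside [W]. *)
Lemma sticky_diff E W : (forall z, z ∊ W -> Sub (app U z) W) -> sticky_set E -> sticky_set (diff E W).
Proof.
  intros HW [L K]. split; [eapply closed_discrete_set_sub; [|exact L]; intros z Hz; now apply diffE in Hz|].
  intros b Hb (z & Hz & Hzb). apply diffE in Hz. destruct Hz as [Hz Nz].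
  assert (Nb : ~ b ∊ W) by (intro Wb; apply Nz, (HW b Wb), Hzb).
  destruct (K b Hb) as (x & Hx & Hbx); [eauto|]. exists x. split; [|exact Hbx].
  apply diffE. split; [exact Hx|]. intro Wx. apply Nb, (HW x Wx), Hbx.
Qed.

Definition up x := sep X (fun b => x ∊ app U b).
Lemma df1_up : df1 up. Proof. unfold up. dfn. Qed.
Hint Extern 2 (dt (fun e => up _)) => apply (df1_sub _ _ df1_up) : dfn.
Lemma upE x b : b ∊ up x <-> b ∊ X /\ x ∊ app U b.
Proof. unfold up. now rewrite sepE by dfn. Qed.

(** The subspaces [Y] that are reflecting: points lying in few [U(b)], [b] in [Y], lie in no
    [U(b)] with [b] outside [Y]. *)
Definition reflecting Y := Sub Y X /\ forall y, y ∊ Y -> Sub (app U y) Y /\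
  (cle (up y) l -> Sub (up y) Y) /\ (cle (cap (up y) Y) l -> cle (up y) l).

(** Close [x] under [U] and under sets [g(y)] of size at most [k]: [g(y)] is all of [up y] if that
    set has size at most [l], and otherwise a subset of size [k], which witnesses inside [Y] that
    [up y] is large. *)
Lemma reflecting_ex x : x ∊ X -> exists Y, reflecting Y /\ cle Y k /\ x ∊ Y.
Proof.
  intro Hx.
  destruct (choice_rel X (Pow X) (fun y S => Sub S (up y) /\ cle S k /\ (cle (up y) l -> S = up y) /\
    (cle S l -> cle (up y) l))) as (g & _ & Hg); [dfn| |].
  { intros y Hy. destruct (classic (cle (up y) l)) as [L|L].
    - exists (up y). split; [apply PowE; intros b Hb; now apply upE in Hb|]. split; [apply Sub_refl|].
      split; [|auto]. eapply cle_trans; [exact L|]. apply cle_sub, (so_sub so).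
    - destruct (so_big so _ L) as [f Hf]. assert (S : Sub (rep k (app f)) (up y)).
      { intros b Hb. rewrite repE in Hb by apply df1_app. destruct Hb as (i & Hi & ->). now apply Hf. }
      exists (rep k (app f)). split; [apply PowE; intros b Hb; apply S, upE in Hb; tauto|].
      split; [exact S|]. split; [apply cle_image, df1_app|]. split; [tauto|]. intro L'.
      destruct (so_k l k so). apply cle_trans with (rep k (app f)); [|exact L'].
      exists f. split; [|apply Hf]. intros i Hi. rewrite repE by apply df1_app. eauto. }
  pose proof (so_k0 so) as k0. pose proof (so_k1 so) as k1. pose proof (so_kk so) as kk.
  pose (H := fun J => Union (rep (cap J X) (fun y => cup (app U y) (app g y)))).
  destruct (so_closing so (sing x) H) as (f & Hf).
  - unfold H. dfn.
  - now apply cle_sing.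
  - intros J LJ. apply cle_Union; auto; [dfn| |].
    + eapply cle_trans; [|exact LJ]. apply cle_sub. intros z Hz. now apply capE in Hz.
    + intros y Hy. apply capE in Hy. apply cle_cup; auto.
      * eapply cle_trans; [apply NS; tauto|]. apply cle_sub, (so_sub so).
      * now apply Hg.
  - set (Y := cap X (Union (rep k (app f)))).
    assert (EY : forall y, y ∊ Y <-> y ∊ X /\ exists i, i ∊ k /\ y ∊ app f i).
    { intro y. unfold Y. now rewrite capE, Union_appE. }
    assert (K : forall y, y ∊ Y -> Sub (app U y) Y /\ Sub (app g y) Y).
    { intros y Hy. apply EY in Hy. destruct Hy as (Hy & i & Hi & Hyi).
      assert (Hs : suc i ∊ k) by now apply (so_suc so). destruct (Hf _ Hs) as (_ & _ & W).
      assert (Hc : Sub (cup (app U y) (app g y)) (app f (suc i))).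
      { intros z Hz. apply (proj2 (W i (proj2 (sucE i i) (or_intror eq_refl)))). unfold H. apply UnionE.
        exists (cup (app U y) (app g y)). split; [|exact Hz]. rewrite repE by dfn. exists y.
        split; [now apply capE|reflexivity]. }
      split; intros z Hz; apply EY; (split; [|exists (suc i); split; [exact Hs|apply Hc, cupE; auto]]).
      - eapply NX; eauto.
      - apply (Hg y Hy), upE in Hz. tauto. }
    exists Y. split; [split|split].
    + intros y Hy. now apply EY in Hy.
    + intros y Hy. destruct (K y Hy) as [K1 K2]. split; [exact K1|]. apply EY in Hy.
      destruct (Hg y (proj1 Hy)) as (G1 & G2 & G3 & G4). split.
      * intro L. now rewrite <- G3.
      * intro L. apply G4. eapply cle_trans; [|exact L]. apply cle_sub. intros z Hz. apply capE. auto.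
    + apply cle_trans with (Union (rep k (app f))); [apply cle_sub; intros z Hz; now apply capE in Hz|].
      apply cle_Union; auto using df1_app, cle_refl. intros i Hi. now apply Hf.
    + apply EY. split; [exact Hx|]. exists emp. split; [exact k0|]. apply (Hf emp k0). now apply singE.
Qed.
Lemma reflecting_open Y : reflecting Y -> Y ∊ t.
Proof.
  intros [S H]. replace Y with (Union (rep Y (app U))).
  - apply T3. intros u Hu. rewrite repE in Hu by apply df1_app. destruct Hu as (y & Hy & ->). now apply Nt, S.
  - apply set_ext. intro z. rewrite Union_appE. split; [|eauto].
    intros (y & Hy & Hz). apply (proj1 (H y Hy)), Hz.
Qed.

Lemma in_nbhdP f a b x z : IsFun f a b -> ⊨ in_nbhd f x z <-> x ∊ a /\ z ∊ app f x.
Proof.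
  intro F. change (⊨ in_nbhd f x z) with (exists u, (⊨ rel f x u) /\ z ∊ u). setoid_rewrite relP.
  split.
  - intros (u & Hu & Hz). apply (fun_rel f a b) in Hu; [|exact F]. destruct Hu as [Hx ->]. auto.
  - intros [Hx Hz]. exists (app f x). rewrite (fun_rel f a b) by exact F. auto.
Qed.

(** [E] is supplied by the [k]-[D] property of the subspace. As [Y] contains [U(y)] for its points
    [y], the trace assignment agrees with [U] on [Y]; what remains is that closed discreteness and
    stickiness pass from [Y] to [X]. *)
Lemma reflecting_extend Y D x : reflecting Y -> cle Y k -> Sub D Y -> sticky_set D -> cle D l -> x ∊ Y ->
  exists E, Sub E Y /\ sticky_set E /\ cle E l /\ end_extends D E /\ covers E x.
Proof.
  intros HY LY DY SD LD' Hx. pose proof (reflecting_open Y HY) as OY.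
  destruct (KD Y OY LY) as (s & W & Hs & HW & K).
  assert (Es : forall v, v ∊ s <-> exists u, u ∊ t /\ v = cap u Y).
  { intro v. destruct (Hs v) as [A B]. split.
    - intro Hv. destruct (A Hv) as (u & Hu & E). exists u. split; [exact Hu|]. apply set_ext. intro z.
      rewrite capE. destruct (E z). split; assumption.
    - intros (u & Hu & ->). apply B. exists u. split; [exact Hu|]. intro z. cbn. rewrite capE. tauto. }
  assert (st : Sub s t) by (intros v Hv; apply Es in Hv; destruct Hv as (u & Hu & ->); auto).
  assert (EW : forall x z, (⊨ in_nbhd W x z) <-> x ∊ Y /\ z ∊ app U x).
  { intros y z. change (⊨ in_nbhd W y z) with (exists u, (⊨ rel W y u) /\ z ∊ u). setoid_rewrite relP. split.
    - intros (u & Hu & Hz). destruct (HW (pair y u)) as [A _]. destruct (A Hu) as (y' & Hy' & u' & v & R & I & P).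
      apply relP in R. apply (fun_rel U X t) in R; [|exact FU]. destruct R as [Hy'' ->]. apply is_pairP in P. apply pair_inj in P. destruct P; subst.
      split; [exact Hy'|]. destruct (I z) as [I1 _]. apply (I1 Hz).
    - intros [Hy Hz]. exists (cap (app U y) Y). split; [|apply capE; split; [exact Hz|]; exact (proj1 (proj2 HY y Hy) z Hz)].
      apply (HW (pair y (cap (app U y) Y))). exists y. split; [exact Hy|]. exists (app U y), (cap (app U y) Y).
      split; [apply relP; rewrite (fun_rel U X t) by exact FU; split; [now apply HY|reflexivity]|].
      split; [intro w; cbn; rewrite capE; tauto|now apply is_pairP]. }
  assert (EC : forall E z, Sub E Y -> (⊨ covered W E z) <-> covers E z).
  { intros E z SE. change (⊨ covered W E z) with (exists x, x ∊ E /\ ⊨ in_nbhd W x z). unfold covers.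
    split; intros (w & Hw & H); exists w; (split; [exact Hw|]); apply EW in H || apply EW; auto. tauto. }
  assert (SC : ⊨ sticky_cond k Y s W D).
  { split; [|now apply (so_lt so)]. split.
    - destruct (closed_discrete_setE D (proj1 SD)) as [[_ (c & Hc & Ec)] Dd]. split; [split; [exact DY|]|].
      + exists (cap c Y). split; [apply Es; eauto|]. intro z. cbn. rewrite capE. specialize (Ec z). cbn in Ec.
        pose proof (proj1 HY z). tauto.
      + intros w Hw. destruct (Dd w Hw) as (u & Hu & Eu). exists (cap u Y). split; [apply Es; eauto|].
        intro z. cbn. rewrite capE. specialize (Eu z). cbn in Eu. split.
        * intros [[A B] B']. apply Eu. auto.
        * intros ->. destruct (proj2 Eu eq_refl). auto.
    - intros b Hb (z & Hz & H). apply EC; [exact DY|]. apply EW in H. apply SD; [now apply HY|]. exists z. tauto. }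
  destruct (K D SC x Hx) as (E & (([[EY (c & Hc & Ec)] Ed] & Est) & EL) & (SE & NE) & Ce).
  apply (so_lt so) in EL. change (Sub E Y) in EY.
  change (forall z, (z ∊ c -> z ∊ Y /\ ~ z ∊ E) /\ (z ∊ Y /\ ~ z ∊ E -> z ∊ c)) in Ec.
  change (forall x, x ∊ E -> exists u, u ∊ s /\ forall z, (z ∊ u /\ z ∊ E -> z = x) /\ (z = x -> z ∊ u /\ z ∊ E)) in Ed.
  assert (Est' : forall b, b ∊ Y -> (exists z, z ∊ E /\ z ∊ app U b) -> covers E b).
  { intros b Hb (z & Hz & H). apply EC; [exact EY|]. apply Est; [exact Hb|]. exists z. split; [exact Hz|]. apply EW. auto. }
  assert (LC : cle (Union (rep E (app U))) l).
  { apply cle_Union; auto using df1_app; try apply so. intros z Hz. apply NS. now apply HY, EY. }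
  (* The decisive use of reflection: the part of [up z] inside [Y] lies in the union of the [U(v)]
     for [v] in [E], which has size at most [l]. Hence [up z] itself is small, and therefore
     contained in [Y]. *)
  assert (R : forall b z, b ∊ X -> z ∊ E -> z ∊ app U b -> b ∊ Y).
  { intros b z Hb Hz H. destruct (proj2 HY z (EY z Hz)) as (_ & U1 & U2). apply U1; [apply U2|now apply upE].
    eapply cle_trans; [|exact LC]. apply cle_sub. intros w Hw. apply capE in Hw. destruct Hw as [Hw Hw'].
    apply upE in Hw. destruct (Est' w Hw') as (v & Hv & Hwv); [exists z; tauto|].
    apply UnionE. exists (app U v). split; [|exact Hwv]. rewrite repE by apply df1_app. eauto. }
  exists E. split; [exact EY|]. split; [split; [split|]|split; [exact EL|split; [split|]]].
  - intros z Hz. now apply HY, EY.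
  - intros p Hp. destruct (classic (p ∊ Y)) as [HpY|HpY].
    + destruct (classic (p ∊ E)) as [HpE|HpE].
      * destruct (Ed p HpE) as (u & Hu & Eu). exists u. split; [now apply st|].
        split; [now apply Eu|]. intros z Hz Hz'. now apply Eu.
      * exists c. split; [now apply st|]. split; [now apply Ec|]. intros z Hz Hz'. destruct (proj1 (Ec z) Hz). tauto.
    + exists (app U p). split; [now apply Nt|]. split; [auto|]. intros z Hz Hz'. destruct HpY. eapply R; eauto.
  - intros b Hb (z & Hz & H). apply Est'; [eapply R; eauto|eauto].
  - exact SE.
  - intros z Hz Nz Cz. apply NE. exists z. split; [split; assumption|]. now apply EC.
  - now apply EC.
Qed.

(** The invariant of the outer recursion: the covered region is closed under [U], as [sticky_diff]
    requires of the set that is removed. *)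
Definition closed_cov D := forall z, covers D z -> forall w, w ∊ app U z -> covers D w.
Lemma dp1_closed_cov : dp1 closed_cov. Proof. unfold closed_cov. dfn. Qed.

(** [D] may be large, so it never enters the conditions given to the [k]-[D] property. The small
    sets in [A] live in [Y] outside the region covered by [D]; stage [i] of the recursion takes care
    of the point of [Y] that the injection [en] sends to [i], and the result is united with [D] at
    the end. *)
Lemma closed_cov_extend D x : sticky_set D -> closed_cov D -> x ∊ X ->
  exists E, sticky_set E /\ closed_cov E /\ end_extends D E /\ covers E x.
Proof.
  intros SD CD Hx. destruct (reflecting_ex x Hx) as (Y & HY & LY & HxY). pose proof LY as [en Hen].
  set (A := sep (Pow Y) (fun E => sticky_set E /\ cle E l /\ forall z, z ∊ E -> ~ covers D z)).
  assert (EA : forall E, E ∊ A <-> Sub E Y /\ sticky_set E /\ cle E l /\ forall z, z ∊ E -> ~ covers D z)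
    by (intro E; unfold A; rewrite sepE by dfn; rewrite PowE; reflexivity).
  destruct (sequence A end_extends (fun i E => forall y, y ∊ Y -> app en y = i -> ~ covers D y -> covers E y) k) as (f & Hf);
    [exact dp2_end_extends|dfn|exact Ok| |].
  { intros i f Hi H. assert (Oi : Ord i) by (eapply ord_in; eauto).
    set (E0 := Union (rep i (app f))).
    destruct (sticky_sequence i f Oi) as [SE0 XE0].
    { intros j Hj. apply (EA (app f j)). now apply H. }
    { intros j j' Hj Hj'. now apply H. }
    fold E0 in SE0, XE0.
    assert (PE0 : forall z, z ∊ E0 -> exists j, j ∊ i /\ z ∊ app f j) by (intro z; apply Union_appE).
    assert (AE0 : E0 ∊ A).
    { apply EA. split; [|split; [exact SE0|split]].
      - intros z Hz. destruct (PE0 z Hz) as (j & Hj & Hz'). apply (proj1 (EA (app f j)) (proj1 (H j Hj))), Hz'.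
      - apply cle_Union; auto using df1_app; try apply so; [exact Hi|]. intros j Hj. apply (EA (app f j)). now apply H.
      - intros z Hz. destruct (PE0 z Hz) as (j & Hj & Hz'). apply (proj1 (EA (app f j)) (proj1 (H j Hj))), Hz'. }
    pose proof (proj1 (EA E0) AE0) as (B1 & B2 & B3 & B4).
    destruct (classic (exists y, y ∊ Y /\ app en y = i /\ ~ covers D y)) as [(y & Hy & Ey & Ny)|Ny].
    - destruct (reflecting_extend Y E0 y HY LY B1 B2 B3 Hy) as (E & E1 & E2 & E3 & E4 & E5).
      (* [W] is the region covered by [D]. Removing it preserves stickiness, and it loses nothing at
         [y]: a point of [W] whose neighbourhood contains [y] would put [y] into [W]. *)
      set (W := sep X (covers D)). assert (EWm : forall z, z ∊ W <-> z ∊ X /\ covers D z) by (intro; unfold W; now rewrite sepE by dfn).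
      assert (HW : forall z, z ∊ W -> Sub (app U z) W).
      { intros z Hz w Hw. apply EWm in Hz. destruct Hz as [Hz Cz]. apply EWm. split; [eapply NX; eauto|]. eapply CD; eauto. }
      assert (SE : Sub (diff E W) E) by (intros z Hz; now apply diffE in Hz).
      exists (diff E W). split; [|split].
      + apply EA. split; [eapply Sub_trans; eauto|]. split; [now apply sticky_diff|].
        split; [eapply cle_trans; [apply cle_sub, SE|exact E3]|]. intros z Hz Cz. apply diffE in Hz.
        apply (proj2 Hz), EWm. split; [apply HY, E1, Hz|exact Cz].
      + intros y' Hy' Ey' _. assert (y' = y) by (apply Hen; auto; congruence). subst y'.
        destruct E5 as (z & Hz & Hyz). exists z. split; [|exact Hyz]. apply diffE. split; [exact Hz|].
        intro Wz. apply Ny. apply (EWm y), (HW z Wz), Hyz.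
      + intros j Hj. apply end_extends_trans with E0; [now apply XE0|]. split.
        * intros z Hz. apply diffE. split; [now apply E4|]. intro Wz. apply EWm in Wz. exact (B4 z Hz (proj2 Wz)).
        * intros z Hz. apply E4, SE, Hz.
    - exists E0. split; [exact AE0|]. split; [|exact XE0]. intros y Hy Ey Nc. destruct Ny. eauto. }
  set (F := Union (rep k (app f))).
  destruct (sticky_sequence k f Ok) as [SF XF].
  { intros i Hi. apply (EA (app f i)). now apply Hf. }
  { intros i j Hi Hj. now apply Hf. }
  fold F in SF, XF.
  assert (PF : forall z, z ∊ F -> exists j, j ∊ k /\ z ∊ app f j) by (intro z; apply Union_appE).
  (* All of [Y] becomes covered. Since [Y] is closed under [U] and contains [F], this restores the
     invariant [closed_cov]. *)
  assert (CF : forall y, y ∊ Y -> covers (cup D F) y).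
  { intros y Hy. destruct (classic (covers D y)) as [H|H].
    - eapply covers_mono; [|exact H]. intros z Hz. apply cupE. auto.
    - assert (Hi : app en y ∊ k) by now apply Hen. destruct (Hf _ Hi) as (_ & K & _).
      eapply covers_mono; [|apply (K y Hy eq_refl H)]. intros z Hz. apply cupE. right. now apply (XF _ Hi). }
  exists (cup D F). split; [now apply sticky_cup|]. split; [|split].
  - intros z (y & Hy & Hz) w Hw. apply cupE in Hy. destruct Hy as [Hy|Hy].
    + eapply covers_mono; [|apply (CD z); [exists y; auto|exact Hw]]. intros v Hv. apply cupE. auto.
    + apply CF. destruct (PF y Hy) as (j & Hj & Hy'). 
      assert (HyY : y ∊ Y) by (apply (proj1 (proj1 (EA (app f j)) (proj1 (Hf j Hj)))), Hy').
      assert (HzY : z ∊ Y) by (apply (proj1 (proj2 HY y HyY)), Hz).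
      apply (proj1 (proj2 HY z HzY)), Hw.
  - split; [intros z Hz; apply cupE; auto|]. intros z Hz Nz. apply cupE in Hz. destruct Hz as [Hz|Hz]; [tauto|].
    destruct (PF z Hz) as (j & Hj & Hz'). exact (proj2 (proj2 (proj2 (proj1 (EA (app f j)) (proj1 (Hf j Hj))))) z Hz').
  - auto.
Qed.

(** One point of a well-order of [X] is treated at each step. The length [θ] is arbitrary, because
    [sticky_chain] passes limits of every cofinality and no size bound is imposed on the sets in
    [A]. *)
Lemma covering : exists D, closed_discrete_set D /\ forall x, x ∊ X -> covers D x.
Proof.
  pose proof dp1_closed_cov as DC.
  destruct (wellorder X) as (θ & e & Oθ & I & S).
  set (A := sep (Pow X) (fun E => sticky_set E /\ closed_cov E)).
  assert (EA : forall E, E ∊ A <-> sticky_set E /\ closed_cov E).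
  { intro E. unfold A. rewrite sepE by dfn. rewrite PowE. split; [tauto|]. intro H. split; [apply H|exact H]. }
  destruct (sequence A end_extends (fun i E => covers E (app e i)) θ) as (f & Hf); [exact dp2_end_extends|dfn|exact Oθ| |].
  { intros i f Hi H. assert (Oi : Ord i) by (eapply ord_in; eauto).
    destruct (sticky_sequence i f Oi) as [SE0 XE0].
    { intros j Hj. apply (EA (app f j)). now apply H. }
    { intros j j' Hj Hj'. now apply H. }
    destruct (closed_cov_extend (Union (rep i (app f))) (app e i)) as (E & E1 & E2 & E3 & E4).
    - exact SE0.
    - intros z (y & Hy & Hz) w Hw. apply Union_appE in Hy. destruct Hy as (j & Hj & Hy).
      eapply covers_mono; [apply (XE0 j Hj)|].
      apply (proj2 (proj1 (EA (app f j)) (proj1 (H j Hj))) z); [exists y; auto|exact Hw].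
    - now apply I.
    - exists E. split; [now apply EA|]. split; [exact E4|]. intros j Hj. eapply end_extends_trans; [now apply XE0|exact E3]. }
  destruct (sticky_sequence θ f Oθ) as [SF XF].
  { intros i Hi. apply (EA (app f i)). now apply Hf. }
  { intros i j Hi Hj. now apply Hf. }
  exists (Union (rep θ (app f))). split; [apply SF|]. intros x Hx. destruct (S x Hx) as (i & Hi & <-).
  eapply covers_mono; [apply (XF i Hi)|]. now apply Hf.
Qed.
End Covering.

Theorem locally_small_D {V : Type} {M : Model V} {C : Choice V} (l k : V) (so : succ_of l k) (Q : V -> V -> fm V) :
  ⊨ (∀ X t,
       topology X t ∧ hausdorff X t ∧ locally_lt k X t ∧ Q X t ∧
       (∀ U0, ona X t U0 ⇒
          ∃ U, ona X t U ∧ finer X U U0 ∧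
            ∀[Y ∈ t] card_le Y k ⇒ subspace_kappa_D k t U Y) ⇒
       D_space X t).
Proof.
  intros X t ((T1 & T2 & T3 & T4) & _ & (Ul & [FUl NUl] & LUl) & _ & H) U0 [FU0 NU0].
  apply IsFunP in FUl. apply IsFunP in FU0.
  assert (T4' : forall u v, u ∊ t -> v ∊ t -> cap u v ∊ t).
  { intros u v Hu Hv. apply (T4 u Hu v Hv). intro z. cbn. rewrite capE. tauto. }
  assert (rf : forall f x, IsFun f X t -> x ∊ X -> ⊨ rel f x (app f x)).
  { intros f x Ff Hx. apply relP. rewrite (fun_rel f X t) by exact Ff. auto. }
  (* Every assignment finer than this intersection refines [U0] and, at the same time, takes only
     small values. *)
  set (Us := lam X (fun x => cap (app U0 x) (app Ul x))).
  assert (FUs : IsFun Us X t).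
  { apply lam_fun; [dfn|]. intros x Hx. apply T4'; [now apply FU0|now apply FUl]. }
  destruct (H Us) as (U & [FU NU] & Fi & K).
  { split; [now apply IsFunP|]. intros x Hx u Hu. apply relP in Hu. rewrite (fun_rel _ _ _ _ _ FUs) in Hu.
    destruct Hu as [_ ->]. unfold Us. rewrite app_lam by first [dfn|assumption]. apply capE.
    split; [apply (NU0 x Hx)|apply (NUl x Hx)]; now apply rf. }
  apply IsFunP in FU.
  assert (Fi' : forall x, x ∊ X -> Sub (app U x) (cap (app U0 x) (app Ul x))).
  { intros x Hx z Hz. assert (K' : ⊨ in_nbhd Us x z).
    { apply (Fi x Hx). apply (in_nbhdP U X t); auto. }
    apply (in_nbhdP Us X t) in K'; auto. destruct K' as [_ K'].
    unfold Us in K'. rewrite app_lam in K' by first [dfn|assumption]. exact K'. }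
  destruct (covering so X t U) as (D & LDD & CD); auto.
  - intros s Hs. apply (T3 s Hs). intro z. cbn. rewrite UnionE. tauto.
  - intros x Hx. apply (NU x Hx). now apply rf.
  - intros x Hx. apply cle_trans with (app Ul x).
    + apply cle_sub. intros z Hz. apply Fi', capE in Hz; tauto.
    + apply (so_lt so), (LUl x Hx). now apply rf.
  - intros Y HY L. apply (K Y HY). now apply cleP.
  - exists D. split.
    + apply (closed_discrete_setE (l:=l) X t U); auto.
      intros s Hs. apply (T3 s Hs). intro z. cbn. rewrite UnionE. tauto.
    + intros x Hx. destruct (CD x Hx) as (y & Hy & Hxy). exists y. split; [exact Hy|].
      assert (y ∊ X) by now apply LDD. apply (in_nbhdP U0 X t); [exact FU0|]. split; [assumption|].
      apply Fi', capE in Hxy; tauto.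
Qed.

(** * The forcing relation *)

Section Forcing.
Context {V : Type} {M : Model V}.
Implicit Types a b c d p q r s t u v w x y z F T : V.

Record is_forcing_notion (P lo one : V) : Prop := {
  fn_dom : forall q p, pair q p ∊ lo -> q ∊ P /\ p ∊ P;
  fn_refl : forall p, p ∊ P -> pair p p ∊ lo;
  fn_trans : forall p q r, pair p q ∊ lo -> pair q r ∊ lo -> pair p r ∊ lo;
  fn_one : one ∊ P;
  fn_max : forall p, p ∊ P -> pair p one ∊ lo }.

Lemma is_forcingP P lo one : ⊨ is_forcing P lo one <-> is_forcing_notion P lo one /\ Sub lo (prod P P).
Proof.
  change (⊨ is_forcing P lo one) with
    ((forall c, c ∊ lo -> exists p, p ∊ P /\ exists q, q ∊ P /\ ⊨ is_pair p q c) /\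
     (forall p, p ∊ P -> ⊨ rel lo p p) /\
     (forall p q r, (⊨ rel lo p q) /\ (⊨ rel lo q r) -> ⊨ rel lo p r) /\
     one ∊ P /\ (forall p, p ∊ P -> ⊨ rel lo p one)).
  setoid_rewrite is_pairP. setoid_rewrite relP. split.
  - intros (H1 & H2 & H3 & H4 & H5). split; [constructor; eauto|].
    + intros q p H. destruct (H1 _ H) as (p' & Hp & q' & Hq & E). apply pair_inj in E. destruct E; subst. auto.
    + intros c H. destruct (H1 _ H) as (p' & Hp & q' & Hq & ->). apply prod_pair. auto.
  - intros [[H1 H2 H3 H4 H5] H6]. split; [|split; [auto|split; [intros p q r []; eauto|auto]]].
    intros c Hc. apply H6, prodE in Hc. destruct Hc as (p & Hp & q & Hq & ->). exists p. split; eauto.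
Qed.

Context {P lo one : V} (fn : is_forcing_notion P lo one).
Notation st q p := (pair q p ∊ lo).
Local Lemma st_l q p : st q p -> q ∊ P. Proof. intro H. now apply (fn_dom P lo one fn) in H. Qed.
Local Lemma st_r q p : st q p -> p ∊ P. Proof. intro H. now apply (fn_dom P lo one fn) in H. Qed.
Local Lemma st_refl p : p ∊ P -> st p p. Proof. apply (fn_refl P lo one fn). Qed.
Local Lemma st_trans p q r : st p q -> st q r -> st p r. Proof. apply (fn_trans P lo one fn). Qed.
Local Hint Resolve st_l st_r st_refl : core.

Definition dom s z := exists r, r ∊ P /\ pair z r ∊ s.
Definition fmem F p x s := forall q, st q p -> exists r, st r q /\
  exists z r', pair z r' ∊ s /\ st r r' /\ pair r (pair x z) ∊ F.
Definition feq F p s t := forall x, dom s x \/ dom t x -> forall q, st q p -> (fmem F q x s <-> fmem F q x t).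
Definition FE F T := Tr T /\ forall p, p ∊ P -> forall s, s ∊ T -> forall t, t ∊ T ->
  (pair p (pair s t) ∊ F <-> feq F p s t).
Lemma dp2_dom : dp2 dom. Proof. unfold dom. dfn. Qed.
Hint Extern 2 (dfn (fun e => dom _ _)) => apply (dp2_sub _ _ _ dp2_dom) : dfn.
Lemma dp4_fmem : dp4 fmem. Proof. unfold fmem. dfn. Qed.
Hint Extern 2 (dfn (fun e => fmem _ _ _ _)) => apply (dp4_sub _ _ _ _ _ dp4_fmem) : dfn.
Lemma dp4_feq : dp4 feq. Proof. unfold feq. dfn. Qed.
Hint Extern 2 (dfn (fun e => feq _ _ _ _)) => apply (dp4_sub _ _ _ _ _ dp4_feq) : dfn.
Lemma dp2_FE : dp2 FE. Proof. unfold FE. dfn. Qed.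
Hint Extern 2 (dfn (fun e => FE _ _)) => apply (dp2_sub _ _ _ dp2_FE) : dfn.

Lemma rel3P F p s t : ⊨ rel3 F p s t <-> pair p (pair s t) ∊ F.
Proof.
  change (⊨ rel3 F p s t) with (exists c, (⊨ is_pair s t c) /\ ⊨ rel F p c).
  setoid_rewrite is_pairP. setoid_rewrite relP. split; [intros (c & -> & H); exact H|eauto].
Qed.
Lemma forces_mem_fromP F p x s : ⊨ forces_mem_from lo F p x s <-> fmem F p x s.
Proof.
  change (⊨ forces_mem_from lo F p x s) with
   (forall q, (⊨ rel lo q p) -> exists r, (⊨ rel lo r q) /\
      exists z r', (⊨ rel s z r') /\ (⊨ rel lo r r') /\ ⊨ rel3 F r x z).
  setoid_rewrite relP. setoid_rewrite rel3P. reflexivity.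
Qed.
Lemma is_forces_eq_onP F T : ⊨ is_forces_eq_on P lo F T <-> FE F T.
Proof.
  change (⊨ is_forces_eq_on P lo F T) with
   (Tr T /\ forall p, p ∊ P -> forall s, s ∊ T -> forall t, t ∊ T ->
     ((⊨ rel3 F p s t) -> forall x, (exists r, r ∊ P /\ ⊨ rel s x r) \/ (exists r, r ∊ P /\ ⊨ rel t x r) ->
       forall q, (⊨ rel lo q p) -> ((⊨ forces_mem_from lo F q x s) -> ⊨ forces_mem_from lo F q x t) /\
        ((⊨ forces_mem_from lo F q x t) -> ⊨ forces_mem_from lo F q x s)) /\
     ((forall x, (exists r, r ∊ P /\ ⊨ rel s x r) \/ (exists r, r ∊ P /\ ⊨ rel t x r) ->
       forall q, (⊨ rel lo q p) -> ((⊨ forces_mem_from lo F q x s) -> ⊨ forces_mem_from lo F q x t) /\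
        ((⊨ forces_mem_from lo F q x t) -> ⊨ forces_mem_from lo F q x s)) -> ⊨ rel3 F p s t)).
  setoid_rewrite relP. setoid_rewrite rel3P. setoid_rewrite forces_mem_fromP. reflexivity.
Qed.

Lemma feq_ext F G s t p :
  (forall x z r, dom s x \/ dom t x -> dom s z \/ dom t z -> r ∊ P ->
     (pair r (pair x z) ∊ F <-> pair r (pair x z) ∊ G)) ->
  feq F p s t <-> feq G p s t.
Proof.
  intro H.
  assert (K : forall x q, dom s x \/ dom t x ->
    (fmem F q x s <-> fmem G q x s) /\ (fmem F q x t <-> fmem G q x t)).
  { intros x q Hx. split; split; intros W q' Hq'; destruct (W q' Hq') as (r & Hr & z & r' & Hz & Hr' & E);
    exists r; (split; [exact Hr|]); exists z, r'; (split; [exact Hz|]); (split; [exact Hr'|]);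
    apply H; auto; (left; exists r'; split; [now eauto|exact Hz]) || (right; exists r'; split; [now eauto|exact Hz]) || eauto. }
  unfold feq. split; intros W x Hx q Hq; specialize (W x Hx q Hq); destruct (K x q Hx) as [K1 K2]; tauto.
Qed.
Lemma dom_rank s x : dom s x -> rank x ∊ rank s.
Proof.
  intros (r & _ & H). eapply ord_trans; [apply rank_ord|apply rank_in, H|apply pair_rank].
Qed.
Lemma FE_dom F T s x : FE F T -> dom s x -> s ∊ T -> x ∊ T.
Proof.
  intros [HT _] (r & _ & H) Hs. apply (HT (upair x x)); [|apply upairE; auto].
  apply (HT (pair x r)); [exact (HT _ Hs _ H)|apply upairE; auto].
Qed.
(** Whether [s] and [t] are forced equal depends only on pairs of names of smaller rank. The
    induction is on a common bound [a] of both ranks, since the clause mixes names from [s] and from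
    [t]. *)
Lemma FE_unique F T G T' : FE F T -> FE G T' ->
  forall s t, s ∊ T -> s ∊ T' -> t ∊ T -> t ∊ T' -> forall p, p ∊ P ->
  (pair p (pair s t) ∊ F <-> pair p (pair s t) ∊ G).
Proof.
  intros HF HG.
  assert (K : forall a s t, s ∊ T -> s ∊ T' -> t ∊ T -> t ∊ T' -> Sub (rank s) a -> Sub (rank t) a ->
    forall p, p ∊ P -> (pair p (pair s t) ∊ F <-> pair p (pair s t) ∊ G)).
  { apply (ind (fun a => forall s t, s ∊ T -> s ∊ T' -> t ∊ T -> t ∊ T' -> Sub (rank s) a -> Sub (rank t) a ->
    forall p, p ∊ P -> (pair p (pair s t) ∊ F <-> pair p (pair s t) ∊ G))); [dfn|].
    intros a IH s t Hs Hs' Ht Ht' Rs Rt p Hp.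
    rewrite (proj2 HF), (proj2 HG) by assumption. apply feq_ext. intros x z r Hx Hz Hr.
    assert (Rx : rank x ∊ a) by (destruct Hx; [apply Rs|apply Rt]; now apply dom_rank).
    assert (Rz : rank z ∊ a) by (destruct Hz; [apply Rs|apply Rt]; now apply dom_rank).
    apply (IH (cup (rank x) (rank z))); auto.
    - destruct (ord_max (rank x) (rank z) (rank_ord x) (rank_ord z)) as [->| ->]; auto.
    - destruct Hx; eapply FE_dom; eauto.
    - destruct Hx; eapply FE_dom; eauto.
    - destruct Hz; eapply FE_dom; eauto.
    - destruct Hz; eapply FE_dom; eauto.
    - intros w Hw. apply cupE. auto.
    - intros w Hw. apply cupE. auto. }
  intros s t Hs Hs' Ht Ht'. apply (K (cup (rank s) (rank t))); auto; intros w Hw; apply cupE; auto.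
Qed.
Lemma sub_Vh a s x : Ord a -> dom s x -> Sub s (Vh a) -> x ∊ Vh a.
Proof.
  intros Oa (r & _ & H) S. apply S in H. rewrite VhE in * by exact Oa.
  eapply ord_trans; [exact Oa|exact H|apply pair_rank].
Qed.
(** Levels of the cumulative hierarchy serve as domains. The relation on [Vh a] reads each of its
    entries off some approximation on a lower level; by uniqueness it does not matter which. *)
Lemma FE_ex a : Ord a -> exists F, FE F (Vh a).
Proof.
  revert a. apply (ind (fun a => Ord a -> exists F, FE F (Vh a))); [dfn|]. intros a IH Oa.
  set (F := sep (prod P (prod (Vh a) (Vh a))) (fun c => exists p s t, c = pair p (pair s t) /\
    exists b G, b ∊ a /\ FE G (Vh b) /\ Sub s (Vh b) /\ Sub t (Vh b) /\ feq G p s t)).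
  assert (EF : forall p s t, p ∊ P -> s ∊ Vh a -> t ∊ Vh a -> (pair p (pair s t) ∊ F <->
     exists b G, b ∊ a /\ FE G (Vh b) /\ Sub s (Vh b) /\ Sub t (Vh b) /\ feq G p s t)).
  { intros p s t Hp Hs Ht. unfold F. rewrite sepE by dfn. rewrite !prod_pair. split.
    - intros [_ (p' & s' & t' & E & H)]. apply pair_inj in E. destruct E as [-> E]. apply pair_inj in E.
      destruct E as [-> ->]. exact H.
    - intro H. split; [auto|]. exists p, s, t. auto. }
  exists F. split; [now apply Vh_Tr|]. intros p Hp s Hs t Ht.
  assert (U : exists b, b ∊ a /\ Sub s (Vh b) /\ Sub t (Vh b)).
  { pose proof Hs as Hs1. pose proof Ht as Ht1. rewrite VhE in Hs1, Ht1 by exact Oa.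
    assert (K : cup (rank s) (rank t) ∊ a) by (destruct (ord_max _ _ (rank_ord s) (rank_ord t)) as [->| ->]; auto).
    exists (cup (rank s) (rank t)). split; [exact K|]. assert (Oc := ord_in _ _ Oa K).
    split; intros x Hx; apply VhE; auto; apply cupE; [left|right]; now apply rank_in. }
  destruct U as (b & Hb & Sb & Tb). assert (Ob := ord_in _ _ Oa Hb). destruct (IH b Hb Ob) as [G HG].
  assert (Vab : Sub (Vh b) (Vh a)).
  { intros x. rewrite !VhE by assumption. apply ord_trans; assumption. }
  
  assert (A : forall b' G', b' ∊ a -> FE G' (Vh b') -> forall x z r, x ∊ Vh b' -> z ∊ Vh b' -> r ∊ P ->
    (pair r (pair x z) ∊ F <-> pair r (pair x z) ∊ G')).
  { intros b' G' Hb' HG' x z r Hx Hz Hr. assert (Ob' := ord_in _ _ Oa Hb').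
    assert (Vab' : Sub (Vh b') (Vh a)). { intros w. rewrite !VhE by assumption. apply ord_trans; assumption. }
    rewrite EF by auto. rewrite (proj2 HG') by assumption. split.
    - intros (b2 & G2 & Hb2 & HG2 & S2 & T2 & E). assert (Ob2 := ord_in _ _ Oa Hb2).
      revert E. apply feq_ext. intros u v r0 Hu Hv Hr0. apply (FE_unique G' (Vh b') G2 (Vh b2)); auto;
      first [solve [destruct Hu; eapply sub_Vh; eauto] | solve [destruct Hv; eapply sub_Vh; eauto]
        | solve [destruct Hu; eapply FE_dom; eauto] | solve [destruct Hv; eapply FE_dom; eauto]].
    - intro E. exists b', G'. repeat (split; [assumption|]). split; [exact (Vh_Tr b' Ob' x Hx)|]. split; [exact (Vh_Tr b' Ob' z Hz)|exact E]. }
  rewrite EF by assumption. split.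
  - intros (b2 & G2 & Hb2 & HG2 & S2 & T2 & E). assert (Ob2 := ord_in _ _ Oa Hb2).
    revert E. apply feq_ext. intros u v r Hu Hv Hr. first [apply (A b2 G2) | symmetry; apply (A b2 G2)]; auto.
    + destruct Hu; eapply sub_Vh; eauto.
    + destruct Hv; eapply sub_Vh; eauto.
  - intro E. exists b, G. repeat (split; [assumption|]). revert E. apply feq_ext. intros u v r Hu Hv Hr. first [apply (A b G) | symmetry; apply (A b G)]; auto.
    + destruct Hu; eapply sub_Vh; eauto.
    + destruct Hv; eapply sub_Vh; eauto.
Qed.

Definition Feq p s t := exists F T, FE F T /\ s ∊ T /\ t ∊ T /\ pair p (pair s t) ∊ F.
Definition Fmem p x s := exists F T, FE F T /\ x ∊ T /\ s ∊ T /\ fmem F p x s.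
Lemma dp3_Feq : dp3 Feq. Proof. unfold Feq. dfn. Qed.
Lemma dp3_Fmem : dp3 Fmem. Proof. unfold Fmem. dfn. Qed.
Hint Extern 2 (dfn (fun e => Feq _ _ _)) => apply (dp3_sub _ _ _ _ dp3_Feq) : dfn.
Hint Extern 2 (dfn (fun e => Fmem _ _ _)) => apply (dp3_sub _ _ _ _ dp3_Fmem) : dfn.

Lemma forces_eqP p s t : ⊨ forces_eq P lo p s t <-> Feq p s t.
Proof.
  change (⊨ forces_eq P lo p s t) with
    (exists F T, (⊨ is_forces_eq_on P lo F T) /\ s ∊ T /\ t ∊ T /\ ⊨ rel3 F p s t).
  setoid_rewrite is_forces_eq_onP. setoid_rewrite rel3P. reflexivity.
Qed.
Lemma forces_memP p s t : ⊨ forces_mem P lo p s t <-> Fmem p s t.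
Proof.
  change (⊨ forces_mem P lo p s t) with
    (exists F T, (⊨ is_forces_eq_on P lo F T) /\ s ∊ T /\ t ∊ T /\ ⊨ forces_mem_from lo F p s t).
  setoid_rewrite is_forces_eq_onP. setoid_rewrite forces_mem_fromP. reflexivity.
Qed.

Lemma FE_large s t : exists F T, FE F T /\ s ∊ T /\ t ∊ T.
Proof.
  set (a := suc (cup (rank s) (rank t))).
  assert (Oc : Ord (cup (rank s) (rank t))) by (destruct (ord_max _ _ (rank_ord s) (rank_ord t)) as [->| ->]; apply rank_ord).
  assert (Oa : Ord a) by now apply ord_suc.
  destruct (FE_ex a Oa) as [F HF]. exists F, (Vh a). split; [exact HF|].
  assert (K : forall w, Sub w (cup (rank s) (rank t)) -> Ord w -> w ∊ a).
  { intros w S Ow. apply ord_sub in S; auto. unfold a. rewrite sucE. tauto. }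
  split; apply VhE; auto; apply K; auto using rank_ord; intros w Hw; apply cupE; auto.
Qed.
Lemma Feq_FE F T p s t : FE F T -> s ∊ T -> t ∊ T -> p ∊ P -> Feq p s t <-> pair p (pair s t) ∊ F.
Proof.
  intros HF Hs Ht Hp. split; [|intro; exists F, T; auto].
  intros (G & T' & HG & Hs' & Ht' & H). revert H. apply (FE_unique G T' F T); auto.
Qed.
Lemma Fmem_FE F T p x s : FE F T -> x ∊ T -> s ∊ T -> Fmem p x s <-> fmem F p x s.
Proof.
  intros HF Hs Ht. split; [|intro; exists F, T; auto].
  intros (G & T' & HG & Hs' & Ht' & H) q Hq. destruct (H q Hq) as (r & Hr & z & r' & Hz & Hr' & E).
  exists r. split; [exact Hr|]. exists z, r'. split; [exact Hz|]. split; [exact Hr'|].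
  assert (dom s z) by (exists r'; split; [eauto|exact Hz]).
  revert E. apply (FE_unique F T G T'); auto; first [solve [eapply FE_dom; eauto] | solve [eauto]].
Qed.
(** Together with [FeqE], this recursion equation replaces the approximations in all later
    arguments. *)
Lemma FmemE p x s : Fmem p x s <-> forall q, st q p -> exists r, st r q /\
  exists z r', pair z r' ∊ s /\ st r r' /\ Feq r x z.
Proof.
  destruct (FE_large x s) as (F & T & HF & Hx & Hs). rewrite (Fmem_FE F T) by assumption.
  split; intros H q Hq; destruct (H q Hq) as (r & Hr & z & r' & Hz & Hr' & E);
  (exists r; split; [exact Hr|]); exists z, r'; (split; [exact Hz|]); (split; [exact Hr'|]);
  assert (dom s z) by (exists r'; split; [eauto|exact Hz]).
  - apply (Feq_FE F T); auto; [eapply FE_dom; eauto|eauto].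
  - apply (Feq_FE F T) in E; auto; [eapply FE_dom; eauto|eauto].
Qed.
Lemma FeqE p s t : p ∊ P -> Feq p s t <->
  forall x, dom s x \/ dom t x -> forall q, st q p -> (Fmem q x s <-> Fmem q x t).
Proof.
  intro Hp. destruct (FE_large s t) as (F & T & HF & Hs & Ht).
  rewrite (Feq_FE F T), (proj2 HF) by assumption.
  unfold feq. split; intros H x Hx q Hq; specialize (H x Hx q Hq);
  assert (HxT : x ∊ T) by (destruct Hx; eapply FE_dom; eauto);
  rewrite !(Fmem_FE F T) in *; auto.
Qed.

Lemma Fmem_mono p q x s : Fmem p x s -> st q p -> Fmem q x s.
Proof. rewrite !FmemE. intros H Hq r Hr. apply H. eapply st_trans; eauto. Qed.
Lemma Feq_mono p q s t : Feq p s t -> st q p -> Feq q s t.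
Proof.
  intros H Hq. rewrite FeqE in * by eauto. intros x Hx r Hr. apply H; [exact Hx|]. eapply st_trans; eauto.
Qed.
Lemma Fmem_dense p x s : (forall q, st q p -> exists r, st r q /\ Fmem r x s) -> Fmem p x s.
Proof.
  intro H. apply FmemE. intros q Hq. destruct (H q Hq) as (r & Hr & K). rewrite FmemE in K.
  destruct (K r) as (r1 & Hr1 & W); [eauto|]. exists r1. split; [eapply st_trans; eauto|exact W].
Qed.
Lemma Feq_dense p s t : p ∊ P -> (forall q, st q p -> exists r, st r q /\ Feq r s t) -> Feq p s t.
Proof.
  intros Hp H. rewrite FeqE by exact Hp. intros x Hx q Hq.
  split; intro K; apply Fmem_dense; intros q1 Hq1; destruct (H q1 ltac:(eapply st_trans; eauto)) as (r & Hr & E);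
  exists r; (split; [exact Hr|]); rewrite FeqE in E by eauto; apply (E x Hx r); eauto;
  (eapply Fmem_mono; [exact K|eapply st_trans; eauto]).
Qed.
Lemma Feq_refl p s : p ∊ P -> Feq p s s.
Proof. intro Hp. rewrite FeqE by exact Hp. reflexivity. Qed.
Lemma Feq_sym p s t : p ∊ P -> Feq p s t -> Feq p t s.
Proof. intros Hp. rewrite !FeqE by exact Hp. intros H x Hx q Hq. symmetry. apply H; tauto. Qed.
Lemma Fmem_dom p z r s : pair z r ∊ s -> st p r -> Fmem p z s.
Proof.
  intros H Hr. apply FmemE. intros q Hq. exists q. split; [eauto|]. exists z, r. split; [exact H|].
  split; [eapply st_trans; eauto|]. apply Feq_refl. eauto.
Qed.
(** Transitivity for [s], [t], [u] requires transitivity for the names occurring in them, so it is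
    proved by induction on a common bound of the three ranks. *)
Lemma Feq_trans p s t u : p ∊ P -> Feq p s t -> Feq p t u -> Feq p s u.
Proof.
  assert (K : forall a s t u p, p ∊ P -> Sub (rank s) a -> Sub (rank t) a -> Sub (rank u) a ->
    Feq p s t -> Feq p t u -> Feq p s u).
  2: { intros Hp. apply (K (cup (rank s) (cup (rank t) (rank u)))); auto; intros w; rewrite !cupE; auto. }
  clear p s t u. apply (ind (fun a => forall s t u p, p ∊ P -> Sub (rank s) a -> Sub (rank t) a -> Sub (rank u) a ->
    Feq p s t -> Feq p t u -> Feq p s u)); [dfn|].
  intros a IH.
  assert (T3 : forall x y z p, p ∊ P -> rank x ∊ a -> rank y ∊ a -> rank z ∊ a -> Feq p x y -> Feq p y z -> Feq p x z).
  { intros x y z p Hp Rx Ry Rz. set (b := cup (rank x) (cup (rank y) (rank z))).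
    assert (Hb : b ∊ a).
    { unfold b. assert (O1 : Ord (cup (rank y) (rank z))) by (destruct (ord_max _ _ (rank_ord y) (rank_ord z)) as [->| ->]; apply rank_ord).
      destruct (ord_max _ _ (rank_ord x) O1) as [->| ->]; [exact Rx|].
      destruct (ord_max _ _ (rank_ord y) (rank_ord z)) as [->| ->]; assumption. }
    apply (IH b Hb); auto; intros w Hw; unfold b; rewrite !cupE; auto. }
  (* A witness that [x] belongs to [s] is matched with one in [t] and then with one in [u]; the
     resulting three equalities between names of smaller rank are composed by [T3]. *)
  assert (W : forall s t u p, p ∊ P -> Sub (rank s) a -> Sub (rank t) a -> Sub (rank u) a ->
    Feq p s t -> Feq p t u -> forall x, rank x ∊ a -> forall q, st q p -> Fmem q x s -> Fmem q x u).
  { intros s t u p Hp Rs Rt Ru E1 E2 x Rx q Hq H. rewrite FeqE in E1, E2 by exact Hp.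
    apply FmemE. intros q1 Hq1. rewrite FmemE in H. destruct (H q1 Hq1) as (r & Hr & z & r' & Hz & Hr' & F1).
    assert (Hrp : st r p) by (eapply st_trans; [exact Hr|]; eapply st_trans; eauto).
    assert (Dz : dom s z) by (exists r'; split; [eauto|exact Hz]).
    assert (H2 : Fmem r z t) by (apply (E1 z); auto; eapply Fmem_dom; eauto).
    rewrite FmemE in H2. destruct (H2 r) as (r2 & Hr2 & z2 & r2' & Hz2 & Hr2' & F2); [eauto|].
    assert (Dz2 : dom t z2) by (exists r2'; split; [eauto|exact Hz2]).
    assert (H3 : Fmem r2 z2 u) by (apply (E2 z2); [auto|exact (st_trans _ _ _ Hr2 Hrp)|eapply Fmem_dom; eauto]).
    rewrite FmemE in H3. destruct (H3 r2) as (r3 & Hr3 & z3 & r3' & Hz3 & Hr3' & F3); [eauto|].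
    assert (Dz3 : dom u z3) by (exists r3'; split; [eauto|exact Hz3]).
    exists r3. split; [exact (st_trans _ _ _ Hr3 (st_trans _ _ _ Hr2 Hr))|].
    exists z3, r3'. split; [exact Hz3|]. split; [exact Hr3'|].
    assert (rank z ∊ a) by (now apply Rs, dom_rank). assert (rank z2 ∊ a) by (now apply Rt, dom_rank).
    assert (rank z3 ∊ a) by (now apply Ru, dom_rank).
    assert (P3 : r3 ∊ P) by exact (st_l _ _ Hr3).
    apply (T3 x z2 z3 r3); try assumption. apply (T3 x z z2 r3); try assumption.
    - eapply Feq_mono; [exact F1|]. exact (st_trans _ _ _ Hr3 Hr2).
    - exact (Feq_mono _ _ _ _ F2 Hr3). }
  intros s t u p Hp Rs Rt Ru E1 E2. rewrite FeqE by exact Hp. intros x Hx q Hq.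
  pose proof (Feq_sym _ _ _ Hp E1) as E1'. pose proof (Feq_sym _ _ _ Hp E2) as E2'.
  assert (Rx : rank x ∊ a) by (destruct Hx; [apply Rs|apply Ru]; now apply dom_rank).
  split; [apply (W s t u p)|apply (W u t s p)]; auto.
Qed.
Lemma Fmem_eq_l p x y s : p ∊ P -> Feq p x y -> Fmem p x s -> Fmem p y s.
Proof.
  intros Hp E H. apply FmemE. intros q Hq. rewrite FmemE in H. destruct (H q Hq) as (r & Hr & z & r' & Hz & Hr' & K).
  exists r. split; [exact Hr|]. exists z, r'. split; [exact Hz|]. split; [exact Hr'|].
  assert (Pr : r ∊ P) by exact (st_l _ _ Hr).
  apply Feq_trans with x; [exact Pr| |exact K]. apply Feq_sym; [exact Pr|].
  eapply Feq_mono; [exact E|]. exact (st_trans _ _ _ Hr Hq).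
Qed.
Lemma Fmem_eq_r p x s t : p ∊ P -> Feq p s t -> Fmem p x s -> Fmem p x t.
Proof.
  intros Hp E H. apply Fmem_dense. intros q Hq. rewrite FmemE in H. destruct (H q Hq) as (r & Hr & z & r' & Hz & Hr' & K).
  assert (Pr : r ∊ P) by exact (st_l _ _ Hr).
  exists r. split; [exact Hr|]. apply Fmem_eq_l with z; [exact Pr|now apply Feq_sym|].
  rewrite FeqE in E by exact Hp. apply (E z).
  - left. exists r'. split; [exact (st_r _ _ Hr')|exact Hz].
  - exact (st_trans _ _ _ Hr Hq).
  - eapply Fmem_dom; eauto.
Qed.
End Forcing.

Existing Class is_forcing_notion.
#[export] Hint Extern 2 (dfn (fun e => Feq _ _ _)) => apply (dp3_sub _ _ _ _ dp3_Feq) : dfn.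
#[export] Hint Extern 2 (dfn (fun e => Fmem _ _ _)) => apply (dp3_sub _ _ _ _ dp3_Fmem) : dfn.
#[export] Hint Extern 2 (dfn (fun e => dom _ _)) => apply (dp2_sub _ _ _ dp2_dom) : dfn.

(** This is [forces] with the forcing notion given by bare elements of the structure, so that the
    relation can be expressed by formulas and compared between a structure and its elementary
    submodels. *)
Fixpoint fcs {V : Type} (mem : V -> V -> Prop) (P lo p : V) (phi : fm V) : Prop :=
  match phi with
  | Mem s t => holds mem (forces_mem P lo p s t)
  | Eq s t => holds mem (forces_eq P lo p s t)
  | Not phi => forall q, holds mem (rel lo q p) -> ~ fcs mem P lo q phi
  | And phi psi => fcs mem P lo p phi /\ fcs mem P lo p psi
  | Or phi psi => forall q, holds mem (rel lo q p) ->
      exists r, holds mem (rel lo r q) /\ (fcs mem P lo r phi \/ fcs mem P lo r psi)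
  | Imp phi psi => forall q, holds mem (rel lo q p) -> fcs mem P lo q phi -> fcs mem P lo q psi
  | All phi => forall s, fcs mem P lo p (phi s)
  | Ex phi => forall q, holds mem (rel lo q p) ->
      exists r, holds mem (rel lo r q) /\ exists s, fcs mem P lo r (phi s)
  end.

(** Formulas uniform in the structure and in their parameters. *)
Inductive ufm : (forall A : Type, (nat -> A) -> fm A) -> Prop :=
| u_mem i j : ufm (fun A e => Mem (e i) (e j))
| u_eq i j : ufm (fun A e => Eq (e i) (e j))
| u_not f : ufm f -> ufm (fun A e => Not (f A e))
| u_and f g : ufm f -> ufm g -> ufm (fun A e => And (f A e) (g A e))
| u_or f g : ufm f -> ufm g -> ufm (fun A e => Or (f A e) (g A e))
| u_imp f g : ufm f -> ufm g -> ufm (fun A e => Imp (f A e) (g A e))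
| u_all (f : forall A, A -> (nat -> A) -> fm A) :
    ufm (fun A e => f A (e 0) (fun n => e (S n))) -> ufm (fun A e => All (fun x => f A x e))
| u_ex (f : forall A, A -> (nat -> A) -> fm A) :
    ufm (fun A e => f A (e 0) (fun n => e (S n))) -> ufm (fun A e => Ex (fun x => f A x e)).

Create HintDb ufm.
#[export] Hint Constants Opaque : ufm.
#[export] Hint Resolve u_mem u_eq u_not u_and u_or u_imp u_all u_ex : ufm.
Ltac ufm := cbv beta; solve [auto 300 with ufm nocore].

Lemma ufm_formula p : ufm (fun A e => inst p e).
Proof.
  induction p.
  - apply u_mem.
  - apply u_eq.
  - apply (u_not (fun A e => inst p e) IHp).
  - apply (u_and _ _ IHp1 IHp2).
  - refine (u_all (fun A x e => inst p (scons x e)) _).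
    replace (fun (A : Type) (e : nat -> A) => inst p (scons (e 0) (fun n => e (S n))))
      with (fun (A : Type) (e : nat -> A) => inst p e); [exact IHp|].
    apply functional_extensionality_dep; intro A. apply functional_extensionality; intro e.
    f_equal. apply functional_extensionality; intros [|n]; reflexivity.
Qed.
Lemma ufm_inst p r : ufm (fun A e => inst p (fun n => e (r n))).
Proof.
  replace (fun (A : Type) (e : nat -> A) => inst p (fun n => e (r n)))
    with (fun (A : Type) (e : nat -> A) => inst (ren r p) e); [apply ufm_formula|].
  apply functional_extensionality_dep; intro A. apply functional_extensionality; intro e.
  apply inst_ren.
Qed.

Section ForcingRelation.
Context {V : Type} {M : Model V} {P lo one : V} {fn : is_forcing_notion P lo one}.
Implicit Types p q r s t x y z : V.
Notation st q p := (pair q p ∊ lo).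
Notation fc := (fcs mem P lo).

Lemma fc_mono phi p q : fc p phi -> st q p -> fc q phi.
Proof.
  intros H Hq. assert (T : forall r, (⊨ rel lo r q) -> ⊨ rel lo r p).
  { intros r. rewrite !relP. intro Hr. eapply (fn_trans P lo one fn); eauto. }
  revert p q H Hq T. induction phi; intros u v H0 Hv T; cbn [fcs] in *.
  - rewrite forces_memP in *. eapply (Fmem_mono fn); eauto.
  - rewrite forces_eqP in *. eapply (Feq_mono fn); eauto.
  - intros r Hr. apply H0, T, Hr.
  - destruct H0; split; eauto.
  - intros r Hr. apply H0, T, Hr.
  - intros r Hr. apply H0, T, Hr.
  - intro s. eauto.
  - intros r Hr. apply H0, T, Hr.
Qed.
Lemma fc_dense phi p : p ∊ P -> (forall q, st q p -> exists r, st r q /\ fc r phi) -> fc p phi.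
Proof.
  revert p. induction phi; intros u Hu H0; cbn [fcs] in *.
  - rewrite forces_memP. apply (Fmem_dense fn). intros q Hq. destruct (H0 q Hq) as (r & Hr & K).
    rewrite forces_memP in K. eauto.
  - rewrite forces_eqP. apply (Feq_dense fn); [exact Hu|]. intros q Hq. destruct (H0 q Hq) as (r & Hr & K).
    rewrite forces_eqP in K. eauto.
  - intros q Hq K. apply relP in Hq. destruct (H0 q Hq) as (r & Hr & K'). apply (K' r).
    + apply relP. apply (fn_refl P lo one fn). now apply (fn_dom P lo one fn) in Hr.
    + eapply fc_mono; eauto.
  - split; [apply IHphi1|apply IHphi2]; auto; intros q Hq; destruct (H0 q Hq) as (r & Hr & K1 & K2); eauto.
  - intros q Hq. apply relP in Hq. destruct (H0 q Hq) as (r & Hr & K). destruct (K r) as (r2 & Hr2 & K2).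
    + apply relP. apply (fn_refl P lo one fn). now apply (fn_dom P lo one fn) in Hr.
    + exists r2. split; [|exact K2]. apply relP in Hr2. apply relP. eapply (fn_trans P lo one fn); eauto.
  - intros q Hq K. apply relP in Hq. apply IHphi2; [now apply (fn_dom P lo one fn) in Hq|].
    intros q1 Hq1. destruct (H0 q1) as (r & Hr & K'); [eapply (fn_trans P lo one fn); eauto|].
    exists r. split; [exact Hr|]. apply K'.
    + apply relP. apply (fn_refl P lo one fn). now apply (fn_dom P lo one fn) in Hr.
    + eapply fc_mono; [exact K|]. eapply (fn_trans P lo one fn); eauto.
  - intro s. apply H; auto. intros q Hq. destruct (H0 q Hq) as (r & Hr & K). eauto.
  - intros q Hq. apply relP in Hq. destruct (H0 q Hq) as (r & Hr & K). destruct (K r) as (r2 & Hr2 & K2).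
    + apply relP. apply (fn_refl P lo one fn). now apply (fn_dom P lo one fn) in Hr.
    + exists r2. split; [|exact K2]. apply relP in Hr2. apply relP. eapply (fn_trans P lo one fn); eauto.
Qed.

(** The definability theorem for forcing. Uniformity of [f] excludes formulas whose quantifier
    bodies depend on their argument in an undefinable way. *)
Lemma dfn_fc f : ufm f -> dfn (fun e => fc (e 0) (f V (fun n => e (S n)))).
Proof.
  induction 1; cbn [fcs].
  - apply (dfn_iff (fun e => Fmem (P:=P) (lo:=lo) (e 0) (e (S i)) (e (S j)))); [|dfn].
    intro e. symmetry. apply forces_memP.
  - apply (dfn_iff (fun e => Feq (P:=P) (lo:=lo) (e 0) (e (S i)) (e (S j)))); [|dfn].
    intro e. symmetry. apply forces_eqP.
  - apply (dfn_iff (fun e => forall q, st q (e 0) -> ~ fc q (f V (fun n => e (S n))))).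
    { intro e. setoid_rewrite relP. reflexivity. }
    apply dfn_all. apply dfn_imp; [dfn|]. apply dfn_not.
    exact (dfn_shift _ (fun n => match n with 0 => 0 | S n => S (S n) end) IHufm).
  - apply dfn_and; assumption.
  - apply (dfn_iff (fun e => forall q, st q (e 0) -> exists r, st r q /\ (fc r (f V (fun n => e (S n))) \/ fc r (g V (fun n => e (S n)))))).
    { intro e. setoid_rewrite relP. reflexivity. }
    apply dfn_all. apply dfn_imp; [dfn|]. apply dfn_ex. apply dfn_and; [dfn|]. apply dfn_or.
    + exact (dfn_shift _ (fun n => match n with 0 => 0 | S n => S (S (S n)) end) IHufm1).
    + exact (dfn_shift _ (fun n => match n with 0 => 0 | S n => S (S (S n)) end) IHufm2).
  - apply (dfn_iff (fun e => forall q, st q (e 0) -> fc q (f V (fun n => e (S n))) -> fc q (g V (fun n => e (S n))))).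
    { intro e. setoid_rewrite relP. reflexivity. }
    apply dfn_all. apply dfn_imp; [dfn|]. apply dfn_imp.
    + exact (dfn_shift _ (fun n => match n with 0 => 0 | S n => S (S n) end) IHufm1).
    + exact (dfn_shift _ (fun n => match n with 0 => 0 | S n => S (S n) end) IHufm2).
  - apply (dfn_all (fun x e => fc (e 0) (f V x (fun n => e (S n))))).
    exact (dfn_shift _ (fun n => match n with 0 => 1 | 1 => 0 | S (S n) => S (S n) end) IHufm).
  - apply (dfn_iff (fun e => forall q, st q (e 0) -> exists r, st r q /\ exists s, fc r (f V s (fun n => e (S n))))).
    { intro e. setoid_rewrite relP. reflexivity. }
    apply dfn_all. apply dfn_imp; [dfn|]. apply dfn_ex. apply dfn_and; [dfn|].
    apply (dfn_ex (fun s e => fc (e 0) (f V s (fun n => e (S (S (S n))))))).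
    exact (dfn_shift _ (fun n => match n with 0 => 1 | 1 => 0 | S (S n) => S (S (S (S n))) end) IHufm).
Qed.
Lemma dp2_fc f v : ufm f -> dp2 (fun p z => fc p (f V (scons z v))).
Proof.
  intro H. refine (dfn_iff _ _ _ (dfn_res (fun n => match n with 0 => inl 0 | 1 => inl 1 | S (S n) => inr (v n) end) _ (dfn_fc f H))).
  intro e. cbn. match goal with |- fc _ (f V ?a) <-> fc _ (f V ?b) => replace a with b; [reflexivity|] end.
  apply functional_extensionality; intros [|n]; reflexivity.
Qed.
Lemma dp3_fc f v : ufm f -> dp3 (fun p z w => fc p (f V (scons z (scons w v)))).
Proof.
  intro H. refine (dfn_iff _ _ _ (dfn_res (fun n => match n with 0 => inl 0 | 1 => inl 1 | 2 => inl 2 | S (S (S n)) => inr (v n) end) _ (dfn_fc f H))).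
  intro e. cbn. match goal with |- fc _ (f V ?a) <-> fc _ (f V ?b) => replace a with b; [reflexivity|] end.
  apply functional_extensionality; intros [|[|n]]; reflexivity.
Qed.
End ForcingRelation.

(** [G] is a predicate outside the model; genericity concerns only those dense sets that are
    elements of the model. *)
Class Generic {V : Type} {M : Model V} (P lo : V) (G : V -> Prop) : Prop := {
  gen_P : forall p, G p -> p ∊ P;
  gen_ex : exists p, G p;
  gen_up : forall p q, G q -> pair q p ∊ lo -> G p;
  gen_dir : forall p q, G p -> G q -> exists r, G r /\ pair r p ∊ lo /\ pair r q ∊ lo;
  gen_meets : forall D, (forall p, p ∊ P -> exists q, q ∊ D /\ pair q p ∊ lo) -> exists p, G p /\ p ∊ D }.

(** * Names modulo a generic filter and the truth lemma *)

Section Extension.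
Context {V : Type} {M : Model V} {P lo one : V} {fn : is_forcing_notion P lo one}.
Context {G : V -> Prop} {gen : Generic P lo G}.
Implicit Types p q r s t x y z : V.
Notation st q p := (pair q p ∊ lo).
Notation fc := (fcs mem P lo).

Lemma gen_dense (D : V -> Prop) p : dp1 D -> G p ->
  (forall q, st q p -> exists r, st r q /\ D r) -> exists r, G r /\ D r /\ st r p.
Proof.
  intros HD Hp H.
  (* Adding the conditions incompatible with [p] turns density below [p] into density everywhere;
     the filter, which contains [p], cannot meet the added part. *)
  destruct (gen_meets (sep P (fun q => (D q /\ st q p) \/ forall r, ~ (st r q /\ st r p)))) as (q & Gq & Hq).
  { intros q Hq. destruct (classic (exists r, st r q /\ st r p)) as [(r & Hr & Hr')|N].
    - destruct (H r Hr') as (r2 & Hr2 & D2). exists r2. rewrite sepE by dfn. split.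
      + split; [now apply (fn_dom P lo one fn) in Hr2|]. left. split; [exact D2|]. eapply (fn_trans P lo one fn); eauto.
      + eapply (fn_trans P lo one fn); eauto.
    - exists q. rewrite sepE by dfn. split; [|now apply (fn_refl P lo one fn)].
      split; [exact Hq|]. right. intros r Hr. apply N. eauto. }
  sepin Hq. destruct Hq as [_ [[Dq Hq]|N]]; [eauto|].
  destruct (gen_dir p q Hp Gq) as (r & _ & Hr & Hr'). destruct (N r). auto.
Qed.

Definition eqG s t := exists p, G p /\ Feq (P:=P) (lo:=lo) p s t.
Definition memG s t := exists p, G p /\ Fmem (P:=P) (lo:=lo) p s t.
Lemma eqG_refl s : eqG s s.
Proof. destruct gen_ex as [p Hp]. exists p. split; [exact Hp|]. apply (Feq_refl fn). now apply gen_P. Qed.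
Lemma eqG_sym s t : eqG s t -> eqG t s.
Proof. intros (p & Hp & H). exists p. split; [exact Hp|]. apply (Feq_sym fn); auto. now apply gen_P. Qed.
Lemma eqG_trans s t u : eqG s t -> eqG t u -> eqG s u.
Proof.
  intros (p & Hp & H) (q & Hq & H'). destruct (gen_dir p q Hp Hq) as (r & Hr & Rp & Rq).
  exists r. split; [exact Hr|]. apply (Feq_trans fn) with t; [now apply gen_P| |]; eapply (Feq_mono fn); eauto.
Qed.
Lemma memG_congr s t s' t' : eqG s s' -> eqG t t' -> memG s t -> memG s' t'.
Proof.
  intros (p & Hp & E) (q & Hq & E') (r & Hr & H).
  destruct (gen_dir p q Hp Hq) as (u & Hu & Up & Uq). destruct (gen_dir u r Hu Hr) as (w & Hw & Wu & Wr).
  assert (Pw : w ∊ P) by now apply gen_P.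
  exists w. split; [exact Hw|]. apply (Fmem_eq_l fn) with s; [exact Pw| |].
  - eapply (Feq_mono fn); [exact E|]. exact (fn_trans P lo one fn _ _ _ Wu Up).
  - apply (Fmem_eq_r fn) with t; [exact Pw| |eapply (Fmem_mono fn); eauto].
    eapply (Feq_mono fn); [exact E'|]. exact (fn_trans P lo one fn _ _ _ Wu Uq).
Qed.
Lemma memGE x s : memG x s <-> exists z r, pair z r ∊ s /\ G r /\ eqG x z.
Proof.
  split.
  - intros (p & Hp & H). rewrite (FmemE fn) in H.
    destruct (gen_dense (fun r => exists z r', pair z r' ∊ s /\ st r r' /\ Feq (P:=P) (lo:=lo) r x z) p) as (r & Gr & (z & r' & Hz & Hr' & E) & _);
      [dfn|exact Hp|exact H|]. exists z, r'. split; [exact Hz|]. split; [exact (gen_up _ _ Gr Hr')|]. exists r. auto.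
  - intros (z & r & Hz & Hr & E). apply (memG_congr z s); [now apply eqG_sym|apply eqG_refl|].
    exists r. split; [exact Hr|]. eapply (Fmem_dom fn); [exact Hz|]. apply (fn_refl P lo one fn). now apply gen_P.
Qed.
(** If [q] does not force equality, some extension of [q] forces a name [x] into one side and
    excludes it from the other below. So the conditions that force equality or have such a witness
    are dense, and the second alternative contradicts the hypothesis. *)
Lemma eqG_ext s t : (forall x, memG x s <-> memG x t) -> eqG s t.
Proof.
  intro H. destruct gen_ex as [p Hp].
  pose (Bad := fun q x s t => Fmem (P:=P) (lo:=lo) q x s /\ forall r, st r q -> ~ Fmem (P:=P) (lo:=lo) r x t).
  assert (DB : dp4 Bad) by (unfold Bad; dfn).
  destruct (gen_dense (fun q => Feq (P:=P) (lo:=lo) q s t \/ exists x, Bad q x s t \/ Bad q x t s) p) as (q & Gq & Dq & _); [dfn|exact Hp| |].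
  { intros q Hq. assert (Pq : q ∊ P) by now apply (fn_dom P lo one fn) in Hq.
    destruct (classic (Feq (P:=P) (lo:=lo) q s t)) as [E|N].
    - exists q. split; [now apply (fn_refl P lo one fn)|auto].
    - assert (W : forall s t x r, st r q -> Fmem (P:=P) (lo:=lo) r x s -> ~ Fmem (P:=P) (lo:=lo) r x t ->
        exists r', st r' q /\ Bad r' x s t).
      { intros s' t' x r Hr Fs Nt. apply NNPP. intro C. apply Nt. apply (Fmem_dense fn).
        intros r1 Hr1. apply NNPP. intro C'. apply C. exists r1. split; [eapply (fn_trans P lo one fn); eauto|].
        split; [eapply (Fmem_mono fn); eauto|]. intros r2 Hr2 K. apply C'. eauto. }
      apply NNPP. intro C. apply N. rewrite (FeqE fn) by exact Pq. intros x _ r Hr.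
      split; intro K; apply NNPP; intro N'.
      + destruct (W s t x r Hr K N') as (r' & Hr' & B). apply C. exists r'. split; [exact Hr'|]. eauto.
      + destruct (W t s x r Hr K N') as (r' & Hr' & B). apply C. exists r'. split; [exact Hr'|]. eauto. }
  assert (W : forall s t x, Bad q x s t -> memG x s /\ ~ memG x t).
  { intros s' t' x [B1 B2]. split; [exists q; auto|]. intros (r & Gr & K).
    destruct (gen_dir q r Gq Gr) as (r1 & _ & H1 & H2). apply (B2 r1 H1). eapply (Fmem_mono fn); eauto. }
  destruct Dq as [E|(x & [B|B])]; [exists q; auto| |]; apply W in B; destruct (H x); tauto.
Qed.

(** Each class of names modulo [G] is represented by the name that [the] selects from it. Equality
    in the extension thereby becomes equality of the type, which is how [holds] interprets [≡]. *)
Definition ext_of (G : V -> Prop) : Type :=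
  { s : V | the (fun t => exists p, G p /\ Feq (P:=P) (lo:=lo) p s t) = s }.
Notation N := (ext_of G).
Lemma rp_idem s : the (eqG (the (eqG s))) = the (eqG s).
Proof.
  f_equal. apply functional_extensionality; intro t. apply propositional_extensionality.
  assert (K : eqG s (the (eqG s))) by (apply the_spec; exists s; apply eqG_refl).
  split; intro H; [eapply eqG_trans; eauto|eapply eqG_trans; [apply eqG_sym, K|exact H]].
Qed.
Definition cls s : N := exist _ (the (eqG s)) (rp_idem s).
Definition memN (a b : N) : Prop := memG (proj1_sig a) (proj1_sig b).
Lemma cls_eq s t : cls s = cls t <-> eqG s t.
Proof.
  split.
  - intro E. apply (f_equal (@proj1_sig _ _)) in E. cbn in E.
    assert (K : eqG s (the (eqG s))) by (apply the_spec; exists s; apply eqG_refl).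
    assert (K' : eqG t (the (eqG t))) by (apply the_spec; exists t; apply eqG_refl).
    eapply eqG_trans; [exact K|]. rewrite E. now apply eqG_sym.
  - intro E. apply eq_sig_hprop; [intros; apply proof_irrelevance|]. cbn. f_equal.
    apply functional_extensionality; intro u. apply propositional_extensionality.
    split; intro H; eapply eqG_trans; eauto using eqG_sym.
Qed.
Lemma cls_mem s t : memN (cls s) (cls t) <-> memG s t.
Proof.
  assert (K : eqG s (the (eqG s))) by (apply the_spec; exists s; apply eqG_refl).
  assert (K' : eqG t (the (eqG t))) by (apply the_spec; exists t; apply eqG_refl).
  unfold memN. cbn. split; apply memG_congr; auto using eqG_sym.
Qed.
Lemma cls_rep (m : N) : cls (proj1_sig m) = m.
Proof.
  destruct m as [s Hs]. apply eq_sig_hprop; [intros; apply proof_irrelevance|]. exact Hs.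
Qed.
Lemma memNE m s : memN m (cls s) <-> exists z r, pair z r ∊ s /\ G r /\ m = cls z.
Proof.
  rewrite <- (cls_rep m), cls_mem, memGE. setoid_rewrite cls_eq. reflexivity.
Qed.
Lemma extN (a b : N) : (forall m, memN m a <-> memN m b) -> a = b.
Proof.
  rewrite <- (cls_rep a), <- (cls_rep b). intro H. apply cls_eq, eqG_ext. intro x. rewrite <- !cls_mem. apply H.
Qed.

(** Apart from the atomic formulas and conjunction, the cases rest on density: by definability of
    forcing, the conditions that decide a formula or settle an instance of it form a set of the
    model, which [G] meets. *)
Theorem truth f : ufm f -> forall v, holds memN (f N (fun n => cls (v n))) <-> exists p, G p /\ fc p (f V v).
Proof.
  intro U. assert (common : forall phi psi, (exists p, G p /\ fc p phi) -> (exists p, G p /\ fc p psi) ->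
    exists p, G p /\ fc p phi /\ fc p psi).
  { intros phi psi (p & Hp & H) (q & Hq & H'). destruct (gen_dir p q Hp Hq) as (r & Hr & Rp & Rq).
    exists r. split; [exact Hr|]. split; eapply fc_mono; eauto. }
  assert (decide : forall f v, ufm f -> exists p, G p /\ (fc p (f V v) \/ fc p (Not (f V v)))).
  { intros g v Ug. destruct gen_ex as [p Hp].
    assert (D1 : dp1 (fun q => fc q (g V v))) by exact (dfn_res (fun n => match n with 0 => inl 0 | S n => inr (v n) end) _ (dfn_fc g Ug)).
    assert (D2 : dp1 (fun q => fc q (Not (g V v)))) by exact (dfn_res (fun n => match n with 0 => inl 0 | S n => inr (v n) end) _ (dfn_fc _ (u_not g Ug))).
    destruct (gen_dense (fun q => fc q (g V v) \/ fc q (Not (g V v))) p) as (q & Gq & Dq & _); [dfn|exact Hp| |eauto].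
    intros q Hq. destruct (classic (exists r, st r q /\ fc r (g V v))) as [(r & Hr & K)|Nn]; [eauto|].
    exists q. split; [apply (fn_refl P lo one fn); now apply (fn_dom P lo one fn) in Hq|]. right.
    intros r Hr K. apply Nn. apply relP in Hr. eauto. }
  assert (contra : forall phi, (exists p, G p /\ fc p phi) -> ~ exists p, G p /\ fc p (Not phi)).
  { intros phi H H'. destruct (common _ _ H H') as (p & Hp & K & K'). apply (K' p); [|exact K].
    apply relP, (fn_refl P lo one fn). now apply gen_P. }
  assert (below : forall q r, st r q -> ⊨ rel lo r q) by (intros; now apply relP).
  assert (rfl : forall q, G q -> ⊨ rel lo q q) by (intros; apply relP, (fn_refl P lo one fn); now apply gen_P).
  induction U; intro v; cbn [holds fcs].
  - rewrite cls_mem. setoid_rewrite forces_memP. reflexivity.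
  - rewrite cls_eq. setoid_rewrite forces_eqP. reflexivity.
  - rewrite IHU. split.
    + intro Nn. destruct (decide f v U) as (p & Hp & [K|K]); [destruct Nn; eauto|eauto].
    + intros H H'. eapply contra; eauto.
  - rewrite IHU1, IHU2. split.
    + intros [H H']. now apply common.
    + intros (p & Hp & H & H'). split; eauto.
  - rewrite IHU1, IHU2. split.
    + intros [(p & Hp & H)|(p & Hp & H)]; exists p; (split; [exact Hp|]); intros q Hq; apply relP in Hq;
      exists q; (split; [apply relP, (fn_refl P lo one fn); now apply (fn_dom P lo one fn) in Hq|]);
      [left|right]; eapply fc_mono; eauto.
    + intros H. destruct (decide f v U1) as (p & Hp & [K|K]); [left; eauto|].
      destruct (decide g v U2) as (p' & Hp' & [K'|K']); [right; eauto|]. exfalso.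
      destruct H as (q & Hq & H). destruct (gen_dir p p' Hp Hp') as (r & Hr & R1 & R2).
      destruct (gen_dir q r Hq Hr) as (r1 & Hr1 & R3 & R4).
      destruct (H r1 (below _ _ R3)) as (r2 & Hr2 & [W|W]).
      * apply (K r2); [|exact W]. apply relP in Hr2. apply relP.
        exact (fn_trans P lo one fn _ _ _ Hr2 (fn_trans P lo one fn _ _ _ R4 R1)).
      * apply (K' r2); [|exact W]. apply relP in Hr2. apply relP.
        exact (fn_trans P lo one fn _ _ _ Hr2 (fn_trans P lo one fn _ _ _ R4 R2)).
  - rewrite IHU1, IHU2. split.
    + intro H. destruct (decide f v U1) as (p & Hp & [K|K]).
      * destruct (H (ex_intro _ p (conj Hp K))) as (q & Hq & W). exists q. split; [exact Hq|].
        intros r Hr _. eapply fc_mono; [exact W|now apply relP].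
      * exists p. split; [exact Hp|]. intros q Hq W. destruct (K q Hq W).
    + intros (p & Hp & H) W. destruct W as (q & Hq & W). destruct (gen_dir p q Hp Hq) as (r & Hr & R1 & R2).
      exists r. split; [exact Hr|]. apply H; [now apply below|]. eapply fc_mono; eauto.
  - split.
    + intro H. assert (D1 : dp1 (fun q => fc q (All (fun x => f V x v)))).
      { exact (dfn_res (fun n => match n with 0 => inl 0 | S n => inr (v n) end) _ (dfn_fc _ (u_all f U))). }
      assert (D2 : dp2 (fun q s => fc q (Not (f V s v)))).
      { exact (dfn_res (fun n => match n with 0 => inl 0 | 1 => inl 1 | S (S n) => inr (v n) end) _ (dfn_fc _ (u_not _ U))). }
      destruct gen_ex as [p Hp].
      (* The conditions that force the universal statement or refute a particular instance are
         dense. *)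
      destruct (gen_dense (fun q => fc q (All (fun x => f V x v)) \/ exists s, fc q (Not (f V s v))) p) as (q & Gq & Dq & _); [|exact Hp| |].
      * apply dfn_or; [exact D1|]. apply (dfn_ex (fun s e => fc (e 0) (Not (f V s v)))).
        exact (dfn_shift _ (fun n => match n with 0 => 1 | _ => 0 end) D2).
      * intros q Hq. assert (Pq : q ∊ P) by now apply (fn_dom P lo one fn) in Hq.
        destruct (classic (exists r s, st r q /\ fc r (Not (f V s v)))) as [(r & s & Hr & K)|Nn]; [eauto|].
        exists q. split; [now apply (fn_refl P lo one fn)|]. left. intro s. apply fc_dense; [exact Pq|].
        intros r Hr. apply NNPP. intro C. apply Nn. exists r, s. split; [exact Hr|]. intros r1 Hr1 W. apply C.
        exists r1. split; [now apply relP|exact W].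
      * destruct Dq as [K|[s K]]; [exists q; split; [exact Gq|exact K]|]. exfalso.
        specialize (IHU (scons s v)). cbn in IHU. apply (contra (f V s v)); [|eauto]. apply IHU. exact (H (cls s)).
    + intros (p & Hp & H) m. rewrite <- (cls_rep m). specialize (IHU (scons (proj1_sig m) v)). cbn in IHU.
      apply IHU. exists p. split; [exact Hp|apply H].
  - split.
    + intros [m H]. rewrite <- (cls_rep m) in H. specialize (IHU (scons (proj1_sig m) v)). cbn in IHU.
      apply IHU in H. destruct H as (p & Hp & H). exists p. split; [exact Hp|]. intros q Hq. apply relP in Hq.
      exists q. split; [apply relP, (fn_refl P lo one fn); now apply (fn_dom P lo one fn) in Hq|].
      exists (proj1_sig m). eapply fc_mono; eauto.
    + intros (p & Hp & H).
      assert (D2 : dp2 (fun q s => fc q (f V s v))).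
      { exact (dfn_res (fun n => match n with 0 => inl 0 | 1 => inl 1 | S (S n) => inr (v n) end) _ (dfn_fc _ U)). }
      destruct (gen_dense (fun q => exists s, fc q (f V s v)) p) as (q & Gq & [s K] & _); [|exact Hp| |].
      * apply (dfn_ex (fun s e => fc (e 0) (f V s v))).
        exact (dfn_shift _ (fun n => match n with 0 => 1 | _ => 0 end) D2).
      * intros q Hq. apply relP in Hq. destruct (H q Hq) as (r & Hr & K). apply relP in Hr. eauto.
      * exists (cls s). specialize (IHU (scons s v)). cbn in IHU. apply IHU. eauto.
Qed.
End Extension.

(** * Generic extensions *)

Section ExtensionModel.
Context {V : Type} {M : Model V} {P lo one : V} {fn : is_forcing_notion P lo one}.
Context {G : V -> Prop} {gen : Generic P lo G}.
Implicit Types p q r s t x y z B : V.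
Notation st q p := (pair q p ∊ lo).
Notation fc := (fcs mem P lo).
Notation N := (ext_of (P:=P) (lo:=lo) G).
Notation memN := (memN (P:=P) (lo:=lo) (G:=G)).
Notation cls := (cls (P:=P) (lo:=lo) (G:=G)).
Notation memNE := (memNE (fn:=fn) (gen:=gen)).

(** The standard name for the set of those [z] in [B] that satisfy [f]. Union, power set and
    separation in the extension are all obtained from names of this form. *)
Definition compn (f : forall A, (nat -> A) -> fm A) (v : nat -> V) B : V :=
  sep (prod B P) (fun c => exists z q, c = pair z q /\ fc q (f V (scons z v))).
Lemma compn_pair f v B z q : ufm f ->
  pair z q ∊ compn f v B <-> z ∊ B /\ q ∊ P /\ fc q (f V (scons z v)).
Proof.
  intro U. pose proof (dp2_fc (P:=P) (lo:=lo) f v U) as D. unfold compn. rewrite sepE by dfn. rewrite prod_pair. split.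
  - intros [H (z' & q' & E & K)]. apply pair_inj in E. destruct E; subst. tauto.
  - intros (H1 & H2 & H3). split; [tauto|]. eauto.
Qed.
Lemma compnE f v B m : ufm f ->
  memN m (cls (compn f v B)) <-> exists z, z ∊ B /\ m = cls z /\ holds memN (f N (scons m (fun n => cls (v n)))).
Proof.
  intro U. rewrite memNE.
  assert (E : forall z, (fun n => cls (scons z v n)) = scons (cls z) (fun n => cls (v n)))
    by (intro z; apply functional_extensionality; intros [|n]; reflexivity).
  split.
  - intros (z & q & H & Gq & ->). rewrite compn_pair in H by exact U. exists z. split; [tauto|]. split; [reflexivity|].
    rewrite <- E. apply (truth f U). exists q. tauto.
  - intros (z & Hz & -> & H). rewrite <- E in H. apply (truth f U) in H. destruct H as (q & Gq & H).
    exists z, q. rewrite compn_pair by exact U. split; [|auto]. split; [exact Hz|]. split; [now apply gen_P|exact H].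
Qed.
Lemma compN f (v : nat -> N) B : ufm f -> exists b, forall m,
  memN m b <-> exists z, z ∊ B /\ m = cls z /\ holds memN (f N (scons m v)).
Proof.
  intro U. exists (cls (compn f (fun n => proj1_sig (v n)) B)). intro m. rewrite compnE by exact U.
  replace (fun n => cls (proj1_sig (v n))) with v; [reflexivity|].
  apply functional_extensionality; intro n. symmetry. apply cls_rep.
Qed.
Definition full B := prod B (sing one).
Lemma df1_full : df1 full. Proof. unfold full. dfn. Qed.
Lemma gen_one : G one.
Proof.
  destruct (gen_ex (P:=P) (lo:=lo) (G:=G)) as [p Hp]. apply (gen_up one p Hp).
  apply (fn_max P lo one fn). now apply (gen_P (lo:=lo)).
Qed.
Lemma fullE m B : memN m (cls (full B)) <-> exists z, z ∊ B /\ m = cls z.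
Proof.
  rewrite memNE. unfold full. split.
  - intros (z & r & H & _ & ->). apply prod_pair in H. exists z. tauto.
  - intros (z & Hz & ->). exists z, one. rewrite prod_pair, singE. auto using gen_one.
Qed.
Lemma members m s : memN m (cls s) -> exists z, z ∊ Union (Union s) /\ rank z ∊ rank s /\ m = cls z.
Proof.
  intro H. apply memNE in H. destruct H as (z & r & H & _ & ->). exists z. split; [now apply pair_Union in H|].
  split; [|reflexivity]. eapply ord_trans; [apply rank_ord|apply rank_in, H|apply pair_rank].
Qed.

Definition chk x := rec (fun x f => rep x (fun y => pair (app f y) one)) x.
Lemma df1_chk : df1 chk. Proof. unfold chk. dfn. Qed.
Lemma chkE x c : c ∊ chk x <-> exists y, y ∊ x /\ c = pair (chk y) one.
Proof.
  pose proof df1_chk as D. unfold chk at 1. rewrite rec_eq by dfn. rewrite repE by dfn.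
  split; intros (y & Hy & ->); exists y; (split; [exact Hy|]);
  rewrite app_lam by assumption; reflexivity.
Qed.
Definition emb x : N := cls (chk x).
Lemma embE m x : memN m (emb x) <-> exists y, y ∊ x /\ m = emb y.
Proof.
  unfold emb. rewrite memNE. split.
  - intros (z & r & H & _ & ->). apply chkE in H. destruct H as (y & Hy & E). apply pair_inj in E. destruct E; subst. eauto.
  - intros (y & Hy & ->). exists (chk y), one. split; [apply chkE; eauto|]. split; [apply gen_one|reflexivity].
Qed.
(** Forced membership in a check name yields, under a stronger condition, a forced equality with the
    check name of an actual element, to which the induction hypothesis applies. A single condition
    is thus enough. *)
Lemma chk_inj x : forall y p, p ∊ P -> Feq (P:=P) (lo:=lo) p (chk x) (chk y) -> x = y.
Proof.
  pose proof df1_chk as D.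
  revert x. apply (ind (fun x => forall y p, p ∊ P -> Feq (P:=P) (lo:=lo) p (chk x) (chk y) -> x = y)); [dfn|].
  assert (K : forall x y p, p ∊ P -> Feq (P:=P) (lo:=lo) p (chk x) (chk y) -> forall w, w ∊ x ->
    exists u r, u ∊ y /\ r ∊ P /\ Feq (P:=P) (lo:=lo) r (chk w) (chk u)).
  { intros x y p Hp H w Hw.
    assert (H1 : Fmem (P:=P) (lo:=lo) p (chk w) (chk y)).
    { apply (Fmem_eq_r fn) with (chk x); [exact Hp|exact H|]. apply (Fmem_dom fn) with one.
      - apply chkE. eauto.
      - now apply (fn_max P lo one fn). }
    rewrite (FmemE fn) in H1. destruct (H1 p) as (r & Hr & z & r' & Hz & Hr' & E); [now apply (fn_refl P lo one fn)|].
    apply chkE in Hz. destruct Hz as (u & Hu & E'). apply pair_inj in E'. destruct E'; subst.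
    exists u, r. split; [exact Hu|]. split; [now apply (fn_dom P lo one fn) in Hr|exact E]. }
  intros x IH y p Hp H. apply Sub_antisym.
  - intros w Hw. destruct (K x y p Hp H w Hw) as (u & r & Hu & Hr & E). now rewrite (IH w Hw u r Hr E).
  - intros w Hw. destruct (K y x p Hp (Feq_sym fn _ _ _ Hp H) w Hw) as (u & r & Hu & Hr & E).
    rewrite <- (IH u Hu w r Hr); [exact Hu|]. now apply (Feq_sym fn).
Qed.
Lemma emb_inj x y : emb x = emb y -> x = y.
Proof.
  intro E. apply cls_eq in E. destruct E as (p & Hp & E). eapply chk_inj; eauto. now apply (gen_P (lo:=lo)).
Qed.
Lemma emb_mem x y : memN (emb x) (emb y) <-> x ∊ y.
Proof.
  rewrite embE. split; [intros (z & Hz & E); apply emb_inj in E; now subst|eauto].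
Qed.

#[export] Instance ext_model : Model N.
Proof.
  refine {| mem := memN |}.
  - intros a b H. apply extN. intro m. apply (H m).
  - (* foundation: descend along the ranks of the names *)
    intros a [y0 Hy0]. change (memN y0 a) in Hy0.
    change (exists y : N, memN y a /\ ~ exists z : N, memN z a /\ memN z y). apply NNPP. intro Nm.
    rewrite <- (cls_rep a) in *. set (s := proj1_sig a) in *.
    set (psi := fun (A : Type) (e : nat -> A) => All (fun u => Imp (Mem u (e 0)) (Ex (fun w => And (Mem w (e 0)) (Mem w u))))).
    assert (U : ufm psi) by (unfold psi; ufm).
    destruct (proj1 (truth psi U (fun _ => s))) as (p & Hp & F).
    { intros y Hy. apply NNPP. intro C. apply Nm. exists y. split; [exact Hy|]. exact C. }
    assert (W : forall z, forall q, st q p -> ~ Fmem (P:=P) (lo:=lo) q z s).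
    { apply (rank_ind (fun z => forall q, st q p -> ~ Fmem (P:=P) (lo:=lo) q z s)); [dfn|].
      intros z IH q Hq H.
      assert (Rq : ⊨ rel lo q q) by (apply relP, (fn_refl P lo one fn); now apply (fn_dom P lo one fn) in Hq).
      destruct (F z q (proj2 (relP _ _ _) Hq) (proj2 (forces_memP _ _ _) H) q Rq) as (r & Hr & w & H1 & H2).
      apply relP in Hr. apply forces_memP in H1. apply forces_memP in H2.
      assert (Pr : r ∊ P) by now apply (fn_dom P lo one fn) in Hr.
      rewrite (FmemE fn) in H2. destruct (H2 r (fn_refl P lo one fn r Pr)) as (r2 & Hr2 & w2 & r' & Hw2 & Hr' & E).
      assert (Pr2 : r2 ∊ P) by now apply (fn_dom P lo one fn) in Hr2.
      apply (IH w2) with r2.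
      - eapply ord_trans; [apply rank_ord|apply rank_in, Hw2|apply pair_rank].
      - exact (fn_trans P lo one fn _ _ _ Hr2 (fn_trans P lo one fn _ _ _ Hr Hq)).
      - apply (Fmem_eq_l fn) with w; [exact Pr2|exact E|]. eapply (Fmem_mono fn); eauto. }
    rewrite <- (cls_rep y0), cls_mem in Hy0. destruct Hy0 as (q & Hq & H).
    destruct (gen_dir p q Hp Hq) as (r & Hr & Rp & Rq). apply (W (proj1_sig y0) r Rp). eapply (Fmem_mono fn); eauto.
  - intros a b. exists (cls (full (upair (proj1_sig a) (proj1_sig b)))). intro z.
    change ((memN z (cls (full (upair (proj1_sig a) (proj1_sig b)))) -> z = a \/ z = b) /\
      (z = a \/ z = b -> memN z (cls (full (upair (proj1_sig a) (proj1_sig b)))))).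
    rewrite fullE. setoid_rewrite upairE. split.
    + intros (u & [->| ->] & ->); rewrite cls_rep; auto.
    + intros [->| ->]; [exists (proj1_sig a)|exists (proj1_sig b)]; rewrite cls_rep; auto.
  - intros a. set (s := proj1_sig a).
    (* Elements of elements of [a] have names of rank below [rank s], so this level contains enough
       names. *)
    destruct (compN (fun A e => Ex (fun u => And (Mem u (e 1)) (Mem (e 0) u))) (fun _ => a) (Vh (rank s))) as [b Hb]; [ufm|].
    exists b. intro z. specialize (Hb z). split; [intro H; apply Hb in H; destruct H as (u & _ & _ & H); exact H|].
    intro H. apply Hb. pose proof H as (y & Hy & Hz). change (memN y a) in Hy. change (memN z y) in Hz.
    rewrite <- (cls_rep a) in Hy. apply members in Hy. destruct Hy as (y1 & _ & Ry & ->).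
    apply members in Hz. destruct Hz as (z1 & _ & Rz & ->). exists z1. split; [|split; [reflexivity|exact H]].
    apply VhE; [apply rank_ord|]. eapply ord_trans; [apply rank_ord|exact Ry|exact Rz].
  - intros a. set (s := proj1_sig a).
    destruct (compN (fun A e => subset (e 0) (e 1)) (fun _ => a) (Pow (prod (Union (Union s)) P))) as [b Hb]; [unfold subset; ufm|].
    exists b. intro m. specialize (Hb m). split; [intro H; apply Hb in H; destruct H as (u & _ & _ & H); exact H|].
    (* A subset [m] of [a] has a name made of pairs of a name from [Union (Union s)] and a condition
       that forces it into [m]; such names range over a set. *)
    intro H. apply Hb. exists (compn (fun A e => Mem (e 0) (e 1)) (fun _ => proj1_sig m) (Union (Union s))).
    split; [|split; [|exact H]].
    + apply PowE. intros c Hc. unfold compn in Hc. pose proof (dp2_fc (P:=P) (lo:=lo) (fun A e => Mem (e 0) (e 1)) (fun _ => proj1_sig m) (u_mem 0 1)). sepin Hc. apply Hc.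
    + apply extN. intro w. rewrite compnE by apply u_mem. cbn [holds scons]. rewrite cls_rep. split.
      * intro Hw. assert (Hwa : memN w (cls s)) by (unfold s; rewrite cls_rep; exact (H w Hw)).
        apply members in Hwa. destruct Hwa as (z & Hz & _ & ->). eauto.
      * intros (z & _ & _ & Hw). exact Hw.
  - exists (emb om). split.
    + exists (emb emp). split; [apply emb_mem, om_0|]. intros z Hz. change (memN z (emb emp)) in Hz. apply embE in Hz.
      destruct Hz as (y & Hy & _). destruct (empE y Hy).
    + intros x Hx. change (memN x (emb om)) in Hx. apply embE in Hx. destruct Hx as (n & Hn & ->).
      exists (emb (suc n)). split; [apply emb_mem, om_S, Hn|]. intro z.
      assert (E : memN z (emb (suc n)) <-> memN z (emb n) \/ z = emb n).
      { rewrite !embE. setoid_rewrite sucE. split.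
        - intros (y & [Hy| ->] & ->); eauto.
        - intros [(y & Hy & ->)| ->]; eauto. }
      destruct E as [E1 E2]. split; [exact E1|exact E2].
  - intros p v a. set (s := proj1_sig a).
    destruct (compN (fun A e => And (Mem (e 0) (e 1)) (inst p (fun n => e (match n with 0 => 0 | S n => S (S n) end))))
      (scons a v) (Union (Union s))) as [b Hb]; [apply u_and; [apply u_mem|apply ufm_inst]|].
    assert (Ev : forall m, (fun n => scons m (scons a v) (match n with 0 => 0 | S n => S (S n) end)) = scons m v)
      by (intro m; apply functional_extensionality; intros [|n]; reflexivity).
    exists b. intro m. specialize (Hb m). cbn [holds] in Hb. rewrite Ev in Hb. split.
    + intro H. apply Hb in H. destruct H as (z & _ & _ & H). exact H.
    + intro H. apply Hb. assert (Hm : memN m (cls s)) by (unfold s; rewrite cls_rep; apply H).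
      apply members in Hm. destruct Hm as (z & Hz & _ & ->). exists z. split; [exact Hz|]. split; [reflexivity|exact H].
  - intros p v a H. set (s := proj1_sig a). set (v' := fun n => proj1_sig (v n)).
    (* The witness depends on the condition that forces it, so collection in the ground model runs
       over pairs of a name and a condition. *)
    set (R := fun c y => exists x q, c = pair x q /\ fc q (inst p (scons x (scons y v')))).
    assert (D : dp2 R).
    { pose proof (dp3_fc (P:=P) (lo:=lo) (fun A e => inst p e) v' (ufm_formula p)) as D. unfold R. apply dfn_ex, dfn_ex, dfn_and; [dfn|]. apply (dp3_sub _ (fun e => e 0) (fun e => e 1) (fun e => e 3) D); dfn. }
    destruct (collection (prod (Union (Union s)) P) R D) as [B HB].
    assert (Ev : forall x y, (fun n => cls (scons x (scons y v') n)) = scons (cls x) (scons (cls y) v)).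
    { intros x y. apply functional_extensionality; intros [|[|n]]; try reflexivity. apply cls_rep. }
    exists (cls (full B)). intros m Hm. destruct (H m Hm) as [y [Hy _]].
    change (memN m a) in Hm. rewrite <- (cls_rep a) in Hm. apply members in Hm. destruct Hm as (x & Hx & _ & ->).
    rewrite <- (cls_rep y), <- Ev in Hy. apply (truth (fun A e => inst p e) (ufm_formula p)) in Hy. destruct Hy as (q & Gq & Hq).
    destruct (HB (pair x q)) as (y1 & Hy1 & x' & q' & E & K).
    { apply prod_pair. split; [exact Hx|now apply (gen_P (lo:=lo))]. }
    { exists (proj1_sig y), x, q. auto. }
    apply pair_inj in E. destruct E; subst x' q'.
    exists (cls y1). split; [apply fullE; eauto|]. rewrite <- Ev.
    apply (truth (fun A e => inst p e) (ufm_formula p)). eauto.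
Defined.
End ExtensionModel.

(** * Ground model sets in the extension, and the axiom of choice *)

Section Absoluteness.
Context {V : Type} {M : Model V} {P lo one : V} {fn : is_forcing_notion P lo one}.
Context {G : V -> Prop} {gen : Generic P lo G}.
Notation st q p := (pair q p ∊ lo).
Notation fc := (fcs mem P lo).
Notation N := (ext_of (P:=P) (lo:=lo) G).
Notation cls := (cls (P:=P) (lo:=lo) (G:=G)).
Notation emb := (emb (fn:=fn) (gen:=gen)).
Implicit Types (m : N) (x y z a b c f p q : V).

Lemma fullE' m B : m ∊ cls (full (one:=one) B) <-> exists z, z ∊ B /\ m = cls z.
Proof. apply fullE. Qed.
Lemma embE' m x : m ∊ emb x <-> exists y, y ∊ x /\ m = emb y.
Proof. apply embE. Qed.
Lemma emb_mem' x y : emb x ∊ emb y <-> x ∊ y.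
Proof. apply emb_mem. Qed.
Lemma clsE m s : m ∊ cls s <-> exists z r, pair z r ∊ s /\ G r /\ m = cls z.
Proof. apply memNE. Qed.
Lemma emb_upair x y : emb (upair x y) = upair (emb x) (emb y).
Proof.
  apply set_ext. intro m. rewrite embE', upairE. setoid_rewrite upairE. split.
  - intros (z & [->| ->] & ->); auto.
  - intros [->| ->]; eauto.
Qed.
Lemma emb_pair x y : emb (pair x y) = pair (emb x) (emb y).
Proof. unfold pair at 2. now rewrite <- !emb_upair. Qed.
Lemma emb_sub x y : Sub x y -> Sub (emb x) (emb y).
Proof. intros S m Hm. apply embE' in Hm. destruct Hm as (z & Hz & ->). apply emb_mem'. auto. Qed.
Lemma emb_emp : emb emp = emp.
Proof. apply emp_eq. intros m Hm. apply embE' in Hm. destruct Hm as (z & Hz & _). exact (empE z Hz). Qed.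
Lemma emb_suc x : emb (suc x) = suc (emb x).
Proof.
  apply set_ext. intro m. rewrite embE', sucE, embE'. setoid_rewrite sucE. split.
  - intros (z & [Hz| ->] & ->); eauto.
  - intros [(z & Hz & ->)| ->]; eauto.
Qed.
Lemma emb_Tr x : Tr x -> Tr (emb x).
Proof. intros T m Hm. apply embE' in Hm. destruct Hm as (z & Hz & ->). apply emb_sub, T, Hz. Qed.
Lemma emb_Ord x : Ord x -> Ord (emb x).
Proof.
  intros [T H]. split; [now apply emb_Tr|]. intros m Hm. apply embE' in Hm. destruct Hm as (z & Hz & ->). apply emb_Tr, H, Hz.
Qed.
Lemma emb_prod a b m : m ∊ prod (emb a) (emb b) <-> exists x y, x ∊ a /\ y ∊ b /\ m = emb (pair x y).
Proof.
  rewrite prodE. split.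
  - intros (u & Hu & w & Hw & ->). apply embE' in Hu. apply embE' in Hw. destruct Hu as (x & Hx & ->). destruct Hw as (y & Hy & ->).
    exists x, y. now rewrite emb_pair.
  - intros (x & y & Hx & Hy & ->). exists (emb x). rewrite emb_mem'. split; [exact Hx|]. exists (emb y).
    rewrite emb_mem', emb_pair. auto.
Qed.
Lemma emb_prod_eq a b : prod (emb a) (emb b) = emb (prod a b).
Proof.
  apply set_ext. intro m. rewrite emb_prod, embE'. split.
  - intros (x & y & Hx & Hy & ->). exists (pair x y). rewrite prod_pair. auto.
  - intros (c & Hc & ->). apply prodE in Hc. destruct Hc as (x & Hx & y & Hy & ->). eauto 6.
Qed.

Lemma emb_fun f a b : IsFun f a b -> IsFun (emb f) (emb a) (emb b) /\ forall x, x ∊ a -> app (emb f) (emb x) = emb (app f x).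
Proof.
  intro F.
  assert (K : forall x, x ∊ a -> app (emb f) (emb x) = emb (app f x)).
  { intros x Hx. apply app_eq.
    - rewrite <- emb_pair, emb_mem', (fun_rel f a b) by exact F. auto.
    - intros m Hm. apply embE' in Hm. destruct Hm as (c & Hc & E).
      pose proof F as [F1 _]. rewrite F1, lamE in Hc by apply df1_app. destruct Hc as (x' & Hx' & ->).
      rewrite emb_pair in E. apply pair_inj in E. destruct E as [E ->]. apply emb_inj in E. now subst. }
  split; [|exact K]. split.
  - apply set_ext. intro m. rewrite embE', lamE by apply df1_app. split.
    + intros (c & Hc & ->). pose proof F as [F1 _]. rewrite F1, lamE in Hc by apply df1_app. destruct Hc as (x & Hx & ->).
      exists (emb x). rewrite emb_mem', K, emb_pair by exact Hx. auto.
    + intros (u & Hu & ->). apply embE' in Hu. destruct Hu as (x & Hx & ->). exists (pair x (app f x)).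
      rewrite (fun_rel f a b), K, emb_pair by assumption. auto.
  - intros u Hu. apply embE' in Hu. destruct Hu as (x & Hx & ->). rewrite K, emb_mem' by exact Hx. now apply F.
Qed.
Lemma emb_fun_inv h a b : IsFun (emb h) (emb a) (emb b) -> IsFun h a b /\ forall x, x ∊ a -> app (emb h) (emb x) = emb (app h x).
Proof.
  intro F.
  assert (R : forall x, x ∊ a -> exists y, y ∊ b /\ pair x y ∊ h /\ app (emb h) (emb x) = emb y).
  { intros x Hx. assert (Hb : app (emb h) (emb x) ∊ emb b) by (apply F; now apply emb_mem').
    apply embE' in Hb. destruct Hb as (y & Hy & E). exists y. split; [exact Hy|]. split; [|exact E].
    rewrite <- emb_mem', emb_pair. apply (fun_rel (emb h) (emb a) (emb b)); [exact F|]. rewrite emb_mem'. auto. }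
  assert (K : forall x y, pair x y ∊ h -> x ∊ a /\ app (emb h) (emb x) = emb y).
  { intros x y H. rewrite <- emb_mem', emb_pair in H. apply (fun_rel (emb h) (emb a) (emb b)) in H; [|exact F].
    rewrite emb_mem' in H. intuition. }
  assert (A : forall x, x ∊ a -> app h x ∊ b /\ pair x (app h x) ∊ h /\ app (emb h) (emb x) = emb (app h x)).
  { intros x Hx. destruct (R x Hx) as (y & Hy & Hp & E). replace (app h x) with y; [auto|]. symmetry.
    apply app_eq; [exact Hp|]. intros y' Hy'. apply K in Hy'. destruct Hy' as [_ E']. rewrite E in E'. apply emb_inj in E'. auto. }
  split; [|intros x Hx; now apply A]. split; [|intros x Hx; now apply A].
  apply set_ext. intro c. rewrite lamE by apply df1_app. split.
  - intro Hc. assert (Hj : emb c ∊ emb h) by now apply emb_mem'. pose proof F as [F1 _]. rewrite F1, lamE in Hj by apply df1_app.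
    destruct Hj as (u & Hu & E). apply embE' in Hu. destruct Hu as (x & Hx & ->). exists x. split; [exact Hx|].
    rewrite (proj2 (proj2 (A x Hx))), <- emb_pair in E. now apply emb_inj in E.
  - intros (x & Hx & ->). now apply A.
Qed.
Lemma emb_Inj f a b : IsFun f a b -> Inj f a b <-> Inj (emb f) (emb a) (emb b).
Proof.
  intro F. destruct (emb_fun f a b F) as [F' K]. split; intros [H I]; split.
  - apply F'.
  - intros u w Hu Hw. apply embE' in Hu. apply embE' in Hw. destruct Hu as (x & Hx & ->). destruct Hw as (y & Hy & ->).
    rewrite !K by assumption. intro E. apply emb_inj in E. f_equal. auto.
  - apply F.
  - intros x y Hx Hy E. apply emb_inj, I; rewrite ?emb_mem'; auto. rewrite !K by assumption. congruence.
Qed.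
Lemma emb_cle a b : cle a b -> cle (emb a) (emb b).
Proof.
  intros [f Hf]. exists (emb (lam a (app f))). apply emb_Inj; [eapply Inj_IsFun; eauto|].
  apply InjI; [apply df1_app|apply Hf|apply Hf].
Qed.
Lemma emb_Surj f a b : IsFun f a b -> Surj f a b <-> Surj (emb f) (emb a) (emb b).
Proof.
  intro F. destruct (emb_fun f a b F) as [F' K]. split; intros S.
  - intros u Hu. apply embE' in Hu. destruct Hu as (y & Hy & ->). destruct (S y Hy) as (x & Hx & <-).
    exists (emb x). rewrite emb_mem'. split; [exact Hx|now apply K].
  - intros y Hy. destruct (S (emb y)) as (u & Hu & E); [now apply emb_mem'|]. apply embE' in Hu. destruct Hu as (x & Hx & ->).
    exists x. split; [exact Hx|]. rewrite K in E by exact Hx. now apply emb_inj in E.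
Qed.
Lemma emb_ceq a b : ceq a b -> ceq (emb a) (emb b).
Proof. intro E. apply ceq_cle in E. apply cle_antisym; apply emb_cle; tauto. Qed.

Definition generic_set : N := cls (rep P (fun p => pair (chk (one:=one) p) p)).
Lemma generic_setE m : m ∊ generic_set <-> exists p, G p /\ m = emb p.
Proof.
  unfold generic_set. rewrite clsE. pose proof (df1_chk (one:=one)) as D. split.
  - intros (z & r & H & Gr & ->). rewrite repE in H by dfn. destruct H as (p & Hp & E).
    apply pair_inj in E. destruct E; subst. exists p. auto.
  - intros (p & Gp & ->). exists (chk (one:=one) p), p. split; [|auto]. rewrite repE by dfn. exists p.
    split; [now apply (gen_P (lo:=lo))|reflexivity].
Qed.

Lemma cls_full_upair s t : cls (full (one:=one) (upair s t)) = upair (cls s) (cls t).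
Proof.
  apply set_ext. intro m. rewrite fullE', upairE. setoid_rewrite upairE. split.
  - intros (z & [->| ->] & ->); auto.
  - intros [->| ->]; eauto.
Qed.
Definition opn s t := full (one:=one) (upair (full (one:=one) (upair s s)) (full (one:=one) (upair s t))).
Lemma cls_opn s t : cls (opn s t) = pair (cls s) (cls t).
Proof. unfold opn, pair. now rewrite !cls_full_upair. Qed.
Lemma df2_opn : df2 opn.
Proof. pose proof (df1_full (one:=one)) as D. unfold opn. dfn. Qed.

(** The names of rank below [rank s] are well-ordered in the ground model. In the extension their
    values form a function on an ordinal that reaches every element of every member of the family,
    and least indices make the choice. *)
#[export] Instance ext_choice {C : Choice V} : Choice N.
Proof.
  intros s0 Hs. change (forall m, m ∊ s0 -> exists z : N, z ∊ m) in Hs.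
  rewrite <- (cls_rep s0) in *. set (s := proj1_sig s0) in *.
  destruct (wellorder (Vh (rank s))) as (θ & e & Oθ & I & S).
  pose proof df2_opn as D. pose proof (df1_chk (one:=one)) as D'.
  set (f := cls (full (one:=one) (rep θ (fun i => opn (chk (one:=one) i) (app e i))))).
  assert (Ef : forall m, m ∊ f <-> exists i, i ∊ θ /\ m = pair (emb i) (cls (app e i))).
  { intro m. unfold f. rewrite fullE'. split.
    - intros (z & Hz & ->). rewrite repE in Hz by dfn. destruct Hz as (i & Hi & ->). exists i. now rewrite cls_opn.
    - intros (i & Hi & ->). exists (opn (chk (one:=one) i) (app e i)). rewrite cls_opn, repE by dfn. eauto. }
  assert (Fu : forall i u w, pair i u ∊ f -> pair i w ∊ f -> u = w).
  { intros i u w Hu Hw. apply Ef in Hu. apply Ef in Hw. destruct Hu as (x & Hx & E). destruct Hw as (y & Hy & E').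
    apply pair_inj in E. apply pair_inj in E'. destruct E as [-> ->], E' as [E ->]. apply emb_inj in E. now subst. }
  destruct (least_fun (cls s) (fun m i => exists u, pair i u ∊ f /\ u ∊ m) (emb θ)) as (g & Hg); [dfn|now apply emb_Ord| |].
  { intros m Hm. destruct (Hs m Hm) as (u & Hu). pose proof Hm as Hm'. apply members in Hm'.
    destruct Hm' as (z & _ & Rz & ->). pose proof Hu as Hu'. apply members in Hu'. destruct Hu' as (w & _ & Rw & ->).
    destruct (S w) as (i & Hi & <-).
    { apply VhE; [apply rank_ord|]. eapply ord_trans; [apply rank_ord|exact Rz|exact Rw]. }
    exists (emb i). rewrite emb_mem'. split; [exact Hi|]. exists (cls (app e i)). split; [apply Ef; eauto|exact Hu]. }
  pose (F := fun m => app f (app g m)).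
  assert (K : forall m, m ∊ cls s -> F m ∊ m).
  { intros m Hm. destruct (Hg m Hm) as (_ & (u & Hu & Hum) & _). unfold F. rewrite (app_eq f (app g m) u); eauto. }
  exists (lam (cls s) F), (Union (cls s)). split; [|split].
  - intro z. cbn -[Union]. destruct (UnionE (cls s) z) as [U1 U2]. split; [exact U1|exact U2].
  - apply IsFunP. apply lam_fun; [unfold F; dfn|]. intros m Hm. apply UnionE. exists m. split; [exact Hm|]. now apply K.
  - intros m Hm z Hz. apply relP in Hz. rewrite pair_lam in Hz by (unfold F; dfn). destruct Hz as [_ ->]. now apply K.
Qed.
End Absoluteness.

(** * Cohen forcing *)

#[export] Hint Extern 2 (dt (fun e => full _)) => apply (df1_sub _ _ df1_full) : dfn.
Section Powers.
Context {V : Type} {M : Model V} {C : Choice V}.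
Implicit Types a b c f g p q r x y z A B J K : V.

Definition two : V := suc (suc emp).
Lemma twoE x : x ∊ two <-> x = emp \/ x = suc emp.
Proof. unfold two. rewrite !sucE. pose proof (empE x). tauto. Qed.
Lemma Pow_two a : cle (Pow a) (Fun a two).
Proof.
  apply cleI with (fun A => lam a (fun i => ite (i ∊ A) (suc emp) emp)); [dfn| |].
  - intros A HA. apply FunE, lam_fun; [dfn|]. intros i Hi. apply twoE.
    destruct (classic (i ∊ A)); [rewrite ite_true|rewrite ite_false]; auto.
  - assert (K : forall A B, A ∊ Pow a -> lam a (fun i => ite (i ∊ A) (suc emp) emp) = lam a (fun i => ite (i ∊ B) (suc emp) emp) -> Sub A B).
    { intros A B HA E i Hi. assert (Ha : i ∊ a) by (rewrite PowE in HA; auto).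
      apply (f_equal (fun f => app f i)) in E. rewrite !app_lam in E by first [assumption|dfn].
      rewrite (ite_true (i ∊ A)) in E by exact Hi. apply NNPP. intro Ni. rewrite ite_false in E by exact Ni.
      exact (emp_neq_one (eq_sym E)). }
    intros A B HA HB E. apply Sub_antisym; [apply K|apply K]; auto.
Qed.
Lemma Pow_cle a b : cle a b -> cle (Pow a) (Pow b).
Proof.
  intros (f & Hf & If). assert (D : df1 (app f)) by apply df1_app. apply cleI with (fun A => rep A (app f)); [dfn| |].
  - intros A HA. rewrite PowE in *. intros y Hy. rewrite repE in Hy by exact D. destruct Hy as (x & Hx & ->). auto.
  - assert (K : forall A B, A ∊ Pow a -> B ∊ Pow a -> rep A (app f) = rep B (app f) -> Sub A B).
    { intros A B HA HB E x Hx. rewrite PowE in *.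
      assert (H : app f x ∊ rep A (app f)) by (rewrite repE by exact D; eauto).
      rewrite E, repE in H by exact D. destruct H as (x' & Hx' & E'). apply If in E'; auto. now subst. }
    intros A B HA HB E. apply Sub_antisym; apply K; auto.
Qed.
Lemma Fun_cle a b b' : cle b b' -> cle (Fun a b) (Fun a b').
Proof.
  intros (g & Hg & Ig). apply cleI with (fun f => lam a (fun x => app g (app f x))); [dfn| |].
  - intros f Hf. apply FunE in Hf. apply FunE, lam_fun; [dfn|]. intros x Hx. apply Hg. now apply Hf.
  - intros f h Hf Hh E. apply FunE in Hf. apply FunE in Hh. apply (fun_ext _ _ _ _ _ Hf Hh). intros x Hx.
    apply (f_equal (fun u => app u x)) in E. rewrite !app_lam in E by first [assumption|dfn].
    apply Ig; [now apply Hf|now apply Hh|exact E].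
Qed.
(** A pair becomes the function with its first coordinate at [emp] and its second everywhere else;
    the two [Union (sep ..)] terms are the projections. *)
Lemma prod_Fun d m : emp ∊ d -> suc emp ∊ d -> cle (prod m m) (Fun d m).
Proof.
  intros d0 d1.
  apply cleI with (fun c => lam d (fun i => ite (i = emp) (Union (sep m (fun x => exists y, c = pair x y)))
     (Union (sep m (fun y => exists x, c = pair x y))))); [dfn| |].
  all: assert (K : forall x y, x ∊ m -> y ∊ m -> Union (sep m (fun x' => exists y', pair x y = pair x' y')) = x /\
     Union (sep m (fun y' => exists x', pair x y = pair x' y')) = y).
  1,3: intros x y Hx Hy; split; (apply Union_sep_eq; [dfn|assumption|eauto|intros z _ [w E]; apply pair_inj in E; intuition]).
  - intros c Hc. apply prodE in Hc. destruct Hc as (x & Hx & y & Hy & ->). destruct (K x y Hx Hy) as [E1 E2]. rewrite E1, E2.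
    apply FunE, lam_fun; [dfn|]. intros i Hi. destruct (classic (i = emp)); [rewrite ite_true|rewrite ite_false]; auto.
  - intros c c' Hc Hd. apply prodE in Hc. destruct Hc as (x & Hx & y & Hy & ->). destruct (K x y Hx Hy) as [-> ->].
    apply prodE in Hd. destruct Hd as (x' & Hx' & y' & Hy' & ->). destruct (K x' y' Hx' Hy') as [-> ->].
    intro E. pose proof (f_equal (fun f => app f emp) E) as A. pose proof (f_equal (fun f => app f (suc emp)) E) as B.
    cbv beta in A, B. rewrite !app_lam in A by first [assumption|dfn]. rewrite !app_lam in B by first [assumption|dfn].
    rewrite !ite_true in A by reflexivity. rewrite !ite_false in B by (intro C'; exact (emp_neq_one (eq_sym C'))). now subst.
Qed.
(** A subset of [B] of size at most [K] is coded by the function [K -> B ∪ {B}] inverting an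
    injection into [K], with junk value [B]. *)
Lemma small_subsets B K : cle (sep (Pow B) (fun p => cle p K)) (Fun K (suc B)).
Proof.
  destruct (choice_rel (sep (Pow B) (fun p => cle p K)) (Pow (prod B K)) (fun p f => Inj f p K)) as (c & _ & Hc); [dfn| |].
  { intros p Hp. sepin Hp. destruct Hp as [Hp [f Hf]]. exists (lam p (app f)). split.
    - rewrite PowE in *. intros z Hz. rewrite lamE in Hz by apply df1_app. destruct Hz as (x & Hx & ->).
      apply prod_pair. split; [auto|now apply Hf].
    - apply InjI; [apply df1_app|apply Hf|apply Hf]. }
  pose (F := fun p i => ite (exists x, x ∊ p /\ app (app c p) x = i) (Union (sep p (fun x => app (app c p) x = i))) B).
  assert (D : df2 F) by (unfold F; dfn).
  assert (F1 : forall p x, p ∊ sep (Pow B) (fun p => cle p K) -> x ∊ p -> F p (app (app c p) x) = x).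
  { intros p x Hp Hx. unfold F. rewrite ite_true by eauto. apply Union_sep_eq; [dfn|exact Hx|reflexivity|].
    intros x' Hx' E. now apply (Hc p Hp) in E. }
  apply cleI with (fun p => lam K (F p)); [dfn| |].
  - intros p Hp. apply FunE, lam_fun; [dfn|]. intros i Hi. apply sucE.
    destruct (classic (exists x, x ∊ p /\ app (app c p) x = i)) as [(x & Hx & <-)|N].
    + left. rewrite F1 by assumption. sepin Hp. destruct Hp as [Hp _]. rewrite PowE in Hp. auto.
    + right. unfold F. now rewrite ite_false.
  - assert (W : forall p q, p ∊ sep (Pow B) (fun p => cle p K) -> q ∊ sep (Pow B) (fun p => cle p K) ->
      lam K (F p) = lam K (F q) -> Sub p q).
    { intros p q Hp Hq E x Hx. assert (Hi : app (app c p) x ∊ K) by (apply (Hc p Hp); exact Hx).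
      apply (f_equal (fun u => app u (app (app c p) x))) in E. rewrite !app_lam in E by first [assumption|dfn].
      rewrite F1 in E by assumption.
      destruct (classic (exists y, y ∊ q /\ app (app c q) y = app (app c p) x)) as [(y & Hy & Ey)|N].
      - rewrite <- Ey, F1 in E by assumption. now subst.
      - unfold F in E. rewrite ite_false in E by exact N. sepin Hp. destruct Hp as [Hp _]. rewrite PowE in Hp.
        apply Hp in Hx. rewrite E in Hx. destruct (no_refl _ Hx). }
    intros p q Hp Hq E. apply Sub_antisym; apply W; auto.
Qed.
End Powers.

Section Cohen.
Context {V : Type} {M : Model V} {C : Choice V}.
Context (l k mu : V) (so : succ_of l k) (Omu : Ord mu) (kmu : k ∊ mu).
Context (h2l : ceq (Fun l two) k) (hmu : cle (Fun k mu) mu).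
Implicit Types a b c f g p q r x y z A B J K : V.
Let Ok := so_Ok l k so. Let l0 := so_l0 l k so. Let l1 := so_l1 l k so. Let ll := so_ll l k so.
Let k0 := so_k0 so. Let k1 := so_k1 so. Let kk := so_kk so.

Lemma two_l : cle two l.
Proof. apply cle_sub. intros x Hx. apply twoE in Hx. destruct Hx as [->| ->]; assumption. Qed.
Lemma l_k : cle l k. Proof. apply cle_sub, (so_sub so). Qed.
(** This is the computation [k^l = (2^l)^l = 2^(l·l) = 2^l = k]. With [e] coding elements of [k] by
    functions from [l] to [two], a function [g] is coded by the set of pairs [(i, u)] with [u] in
    the code of [g(i)]. *)
Lemma Fun_l_k : cle (Fun l k) k.
Proof.
  destruct (ceq_cle _ _ h2l) as [L1 [e He]].
  set (B := prod l (prod l two)).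
  assert (LB : cle B l).
  { unfold B. eapply cle_trans; [|exact ll]. apply cle_prod; [apply cle_refl|]. eapply cle_trans; [|exact ll].
    apply cle_prod; [apply cle_refl|apply two_l]. }
  apply cle_trans with (Pow B).
  2: { eapply cle_trans; [apply Pow_cle, LB|]. eapply cle_trans; [apply Pow_two|exact L1]. }
  pose (F := fun g => sep B (fun c => exists i u, c = pair i u /\ u ∊ app e (app g i))).
  assert (EF : forall g i u, g ∊ Fun l k -> i ∊ l -> pair i u ∊ F g <-> u ∊ app e (app g i)).
  { intros g i u Hg Hi. unfold F. rewrite sepE by dfn. split.
    - intros [_ (i' & u' & E & H)]. apply pair_inj in E. destruct E; subst. exact H.
    - intro H. split; [|eauto]. apply prod_pair. split; [exact Hi|]. apply FunE in Hg.
      assert (K : app e (app g i) ∊ Fun l two) by (apply He; now apply Hg).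
      apply FunE in K. destruct K as [E K]. rewrite E, lamE in H by apply df1_app.
      destruct H as (x & Hx & ->). apply prod_pair. auto. }
  apply cleI with F; [unfold F; dfn| |].
  - intros g _. apply PowE. intros c Hc. unfold F in Hc. sepin Hc. apply Hc.
  - intros g h Hg Hh E. pose proof Hg as Hg'. pose proof Hh as Hh'. apply FunE in Hg'. apply FunE in Hh'.
    apply (fun_ext _ _ _ _ _ Hg' Hh'). intros i Hi. apply He; [now apply Hg'|now apply Hh'|].
    apply set_ext. intro u. rewrite <- (EF g i u), <- (EF h i u) by assumption. now rewrite E.
Qed.
Lemma mu0 : emp ∊ mu. Proof. eapply ord_trans; eauto. Qed.
Lemma mu1 : suc emp ∊ mu. Proof. eapply ord_trans; eauto. Qed.
Lemma k_mu : cle k mu. Proof. apply cle_sub, ord_sub; auto. Qed.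
Lemma mumu : cle (prod mu mu) mu.
Proof. eapply cle_trans; [|exact hmu]. now apply prod_Fun. Qed.

(** At the index [(ξ, i)] a condition may decide whether [i] belongs to the [ξ]-th new subset of
    [k]. *)
Definition Cohen_index := prod mu k.
Definition functional p := forall x y y', pair x y ∊ p -> pair x y' ∊ p -> y = y'.
Lemma dp1_functional : dp1 functional. Proof. unfold functional. dfn. Qed.
Definition Cohen_set := sep (Pow (prod Cohen_index two)) (fun p => functional p /\ cle p l).
Definition Cohen_order := sep (prod Cohen_set Cohen_set) (fun c => exists q p, c = pair q p /\ Sub p q).
Lemma Cohen_setE p : p ∊ Cohen_set <-> Sub p (prod Cohen_index two) /\ functional p /\ cle p l.
Proof. pose proof dp1_functional. unfold Cohen_set. rewrite sepE by dfn. now rewrite PowE. Qed.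
Lemma Cohen_orderE q p : pair q p ∊ Cohen_order <-> q ∊ Cohen_set /\ p ∊ Cohen_set /\ Sub p q.
Proof.
  unfold Cohen_order. rewrite sepE by dfn. rewrite prod_pair. split.
  - intros [H (q' & p' & E & S)]. apply pair_inj in E. destruct E; subst. tauto.
  - intros (H1 & H2 & H3). split; [auto|eauto].
Qed.
Lemma emp_Cohen : emp ∊ Cohen_set.
Proof.
  apply Cohen_setE. split; [|split].
  - intros z Hz. destruct (empE z Hz).
  - intros x y y' H. destruct (empE _ H).
  - apply cle_sub. intros z Hz. destruct (empE z Hz).
Qed.
Lemma Cohen_forcing : is_forcing_notion Cohen_set Cohen_order emp.
Proof.
  constructor.
  - intros q p H. apply Cohen_orderE in H. tauto.
  - intros p H. apply Cohen_orderE. auto using Sub_refl.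
  - intros p q r H H'. rewrite Cohen_orderE in *. intuition. eapply Sub_trans; eauto.
  - apply emp_Cohen.
  - intros p H. apply Cohen_orderE. split; [exact H|]. split; [apply emp_Cohen|]. intros z Hz. destruct (empE z Hz).
Qed.
Lemma Cohen_order_sub : Sub Cohen_order (prod Cohen_set Cohen_set).
Proof. intros c Hc. unfold Cohen_order in Hc. sepin Hc. apply Hc. Qed.

Lemma compat_cup p q : p ∊ Cohen_set -> q ∊ Cohen_set -> (forall x y y', pair x y ∊ p -> pair x y' ∊ q -> y = y') -> cup p q ∊ Cohen_set.
Proof.
  rewrite !Cohen_setE. intros (P1 & P2 & P3) (Q1 & Q2 & Q3) H. split; [|split].
  - intros z Hz. apply cupE in Hz. destruct Hz; auto.
  - intros x y y' Hy Hy'. apply cupE in Hy. apply cupE in Hy'. destruct Hy as [Hy|Hy], Hy' as [Hy'|Hy'].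
    + eapply P2; eauto.
    + eapply H; eauto.
    + symmetry. eapply H; eauto.
    + eapply Q2; eauto.
  - apply cle_cup; auto.
Qed.
Lemma Cohen_below p q : p ∊ Cohen_set -> Sub q p -> q ∊ Cohen_set.
Proof.
  rewrite !Cohen_setE. intros (P1 & P2 & P3) S. split; [eapply Sub_trans; eauto|]. split.
  - intros x y y' H H'. apply (P2 x); auto.
  - eapply cle_trans; [apply cle_sub, S|exact P3].
Qed.

Lemma Cohen_closed i f : i ∊ k -> (forall j, j ∊ i -> app f j ∊ Cohen_set /\ forall j', j' ∊ j -> pair (app f j) (app f j') ∊ Cohen_order) ->
  exists q, q ∊ Cohen_set /\ forall j, j ∊ i -> pair q (app f j) ∊ Cohen_order.
Proof.
  intros Hi H. assert (Oi : Ord i) by (eapply ord_in; eauto). set (q := Union (rep i (app f))).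
  assert (Eq : forall z, z ∊ q <-> exists j, j ∊ i /\ z ∊ app f j).
  { intro z. apply Union_appE. }
  assert (K : q ∊ Cohen_set).
  { apply Cohen_setE. split; [|split].
    - intros z Hz. apply Eq in Hz. destruct Hz as (j & Hj & Hz). destruct (H j Hj) as [K _]. apply Cohen_setE in K. now apply K.
    - intros x y y' Hy Hy'. apply Eq in Hy. apply Eq in Hy'. destruct Hy as (j & Hj & Hy). destruct Hy' as (j' & Hj' & Hy').
      destruct (H j Hj) as [K L]. destruct (H j' Hj') as [K' L']. apply Cohen_setE in K. apply Cohen_setE in K'.
      destruct (ord_tri j (ord_in _ _ Oi Hj) j' (ord_in _ _ Oi Hj')) as [W|[->|W]].
      + apply (proj1 (proj2 K') x); auto. specialize (L' j W). apply Cohen_orderE in L'. now apply L'.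
      + apply (proj1 (proj2 K') x); auto.
      + apply (proj1 (proj2 K) x); auto. specialize (L j' W). apply Cohen_orderE in L. now apply L.
    - apply cle_Union; auto using df1_app; [apply so, Hi|]. intros j Hj. destruct (H j Hj) as [K _]. now apply Cohen_setE in K. }
  exists q. split; [exact K|]. intros j Hj. apply Cohen_orderE. split; [exact K|]. split; [now apply H|].
  intros z Hz. apply Eq. eauto.
Qed.

Definition Fn J := sep Cohen_set (fun p => Sub p (prod J two)).
(** A condition supported on [J] is a subset of size at most [l] of a set of size at most [k], and
    [k^l = k] bounds the number of these. *)
Lemma Fn_small J : cle J k -> cle (Fn J) k.
Proof.
  intro LJ. set (B := prod J two).
  assert (LB : cle B k).
  { unfold B. eapply cle_trans; [|exact kk]. apply cle_prod; [exact LJ|]. eapply cle_trans; [apply two_l|apply l_k]. }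
  apply cle_trans with (sep (Pow B) (fun p => cle p l)).
  - apply cle_sub. intros p Hp. unfold Fn in Hp. sepin Hp. rewrite sepE by dfn. rewrite PowE. rewrite Cohen_setE in Hp. tauto.
  - eapply cle_trans; [apply small_subsets|]. eapply cle_trans; [apply Fun_cle|apply Fun_l_k]. apply cle_suc; auto.
Qed.
Definition dom_part p := sep Cohen_index (fun x => exists y, pair x y ∊ p).
Lemma dmE p x : p ∊ Cohen_set -> x ∊ dom_part p <-> exists y, pair x y ∊ p.
Proof.
  intro Hp. unfold dom_part. rewrite sepE by dfn. split; [tauto|]. intros [y Hy]. split; [|eauto].
  apply Cohen_setE in Hp. apply (proj1 Hp), prod_pair in Hy. tauto.
Qed.
Lemma dm_small p : p ∊ Cohen_set -> cle (dom_part p) l.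
Proof.
  intro Hp. apply cle_trans with p; [|now apply Cohen_setE in Hp].
  apply cle_surj with (fun c x => exists y, c = pair x y); [dfn| |].
  - intros x Hx. apply dmE in Hx; [|exact Hp]. destruct Hx as [y Hy]. eauto.
  - intros c x x' _ [y ->] [y' E]. apply pair_inj in E. tauto.
Qed.
Definition compat p q := forall x y y', pair x y ∊ p -> pair x y' ∊ q -> y = y'.
Lemma dp2_compat : dp2 compat. Proof. unfold compat. dfn. Qed.

(** A closing-off argument in place of a Δ-system. Choose for every [p] compatible with some element
    of [A] one such element [c(p)], and let [J] have size at most [k] and contain the domain of
    [c(p)] for every [p] supported on a stage of [J]. The restriction [a0] of an [a] in [A] to [J]
    is such a [p]; then [c(a0)] is compatible with [a], hence equal to it. So all of [A] is
    supported on [J]. *)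
Lemma Cohen_antichain A : Sub A Cohen_set -> (forall a b, a ∊ A -> b ∊ A -> compat a b -> a = b) -> cle A k.
Proof.
  intros SA AA. pose proof dp2_compat as Dc.
  set (P0 := sep Cohen_set (fun p => exists a, a ∊ A /\ compat p a)).
  destruct (choice_rel P0 A compat) as (c & Hc & Hc'); [exact Dc| |].
  { intros p Hp. unfold P0 in Hp. sepin Hp. apply Hp. }
  pose (H := fun J => Union (rep (cap (Fn J) P0) (fun p => dom_part (app c p)))).
  assert (DH : df1 H) by (unfold H, Fn, dom_part; dfn).
  assert (Ddm : df1 dom_part) by (unfold dom_part; dfn).
  destruct (so_closing so emp H DH) as (f & Hf).
  { apply cle_sub. intros z Hz. destruct (empE z Hz). }
  { intros J LJ. unfold H. apply cle_Union; auto; [dfn| |].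
    - eapply cle_trans; [|apply (Fn_small J LJ)]. apply cle_sub. intros z Hz. now apply capE in Hz.
    - intros p Hp. apply capE in Hp. eapply cle_trans; [|apply l_k]. apply dm_small, SA. now apply Hc. }
  set (J := Union (rep k (app f))).
  assert (EJ : forall x, x ∊ J <-> exists i, i ∊ k /\ x ∊ app f i).
  { intro x. apply Union_appE. }
  assert (LJ : cle J k) by (apply cle_Union; auto using df1_app, cle_refl; intros i Hi; now apply Hf).
  eapply cle_trans; [|apply (Fn_small J LJ)]. apply cle_sub. intros a Ha. pose proof (SA a Ha) as Pa.
  assert (K : forall x, x ∊ dom_part a -> x ∊ J).
  2: { unfold Fn. rewrite sepE by dfn. split; [exact Pa|]. intros z Hz. pose proof Pa as Pa'. apply Cohen_setE in Pa'.
       pose proof (proj1 Pa' z Hz) as Hz'. apply prodE in Hz'. destruct Hz' as (x & Hx & y & Hy & ->).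
       apply prod_pair. split; [|exact Hy]. apply K, dmE; eauto. }
  set (a0 := sep a (fun c => exists x y, c = pair x y /\ x ∊ J)).
  assert (Sa0 : Sub a0 a) by (intros z Hz; unfold a0 in Hz; sepin Hz; apply Hz).
  assert (Pa0 : a0 ∊ Cohen_set) by (eapply Cohen_below; eauto).
  assert (Da0 : forall x, x ∊ dom_part a0 -> exists i, i ∊ k /\ x ∊ app f i).
  { intros x Hx. apply dmE in Hx; [|exact Pa0]. destruct Hx as [y Hy]. unfold a0 in Hy. sepin Hy.
    destruct Hy as [_ (x' & y' & E & Hx')]. apply pair_inj in E. destruct E; subst. now apply EJ. }
  (* The at most [l] points of the domain of [a0] each enter at some stage below [k]; by regularity
     a single stage [i] contains them all. *)
  destruct (least_fun (dom_part a0) (fun x i => x ∊ app f i) k) as (g & Hg); [dfn|exact Ok|exact Da0|].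
  destruct (so_regular so (rep (dom_part a0) (app g))) as (i & Hi & Hb).
  { intros b Hb. rewrite repE in Hb by apply df1_app. destruct Hb as (x & Hx & ->). now apply Hg. }
  { eapply cle_trans; [apply cle_image, df1_app|]. now apply dm_small. }
  assert (Fa0 : a0 ∊ cap (Fn (app f i)) P0).
  { apply capE. split.
    - unfold Fn. rewrite sepE by dfn. split; [exact Pa0|]. intros z Hz. pose proof Pa0 as Pa'. apply Cohen_setE in Pa'.
      pose proof (proj1 Pa' z Hz) as Hz'. apply prodE in Hz'. destruct Hz' as (x & Hx & y & Hy & ->).
      apply prod_pair. split; [|exact Hy]. assert (Hxd : x ∊ dom_part a0) by (apply dmE; eauto).
      destruct (Hg x Hxd) as (G1 & G2 & _). assert (Gi : app g x ∊ i) by (apply Hb; rewrite repE by apply df1_app; eauto).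
      destruct (Hf i Hi) as (_ & _ & W). apply (proj1 (W _ Gi)), G2.
    - unfold P0. rewrite sepE by dfn. split; [exact Pa0|]. exists a. split; [exact Ha|]. intros x y y' Hy Hy'.
      apply Cohen_setE in Pa. apply (proj1 (proj2 Pa) x); auto. }
  assert (Pa0' : a0 ∊ P0) by now apply capE in Fa0.
  assert (Dc' : forall x, x ∊ dom_part (app c a0) -> x ∊ J).
  { intros x Hx. assert (Hs : suc i ∊ k) by now apply (so_suc so). apply EJ. exists (suc i). split; [exact Hs|].
    destruct (Hf _ Hs) as (_ & _ & W). apply (proj2 (W i (proj2 (sucE i i) (or_intror eq_refl)))).
    unfold H. apply UnionE. exists (dom_part (app c a0)). split; [|exact Hx]. rewrite repE by dfn. eauto. }
  assert (Hca : app c a0 ∊ A) by now apply Hc.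
  (* The domain of [c(a0)] lies in [J], and on [J] the conditions [a] and [a0] agree; compatibility
     with [a0] is therefore compatibility with [a]. *)
  assert (E : a = app c a0).
  { apply AA; auto. intros x y y' Hy Hy'. apply (Hc' a0 Pa0' x y y'); [|exact Hy'].
    unfold a0. rewrite sepE by dfn. split; [exact Hy|]. exists x, y. split; [reflexivity|].
    apply Dc', dmE; eauto. }
  rewrite E. exact Dc'.
Qed.

Lemma Cohen_index_mu : cle Cohen_index mu.
Proof. unfold Cohen_index. eapply cle_trans; [|apply mumu]. apply cle_prod; [apply cle_refl|apply k_mu]. Qed.
Lemma two_mu : cle two mu.
Proof. eapply cle_trans; [apply two_l|]. eapply cle_trans; [apply l_k|apply k_mu]. Qed.
Lemma small_mu B : cle B mu -> cle (sep (Pow B) (fun p => cle p k)) mu.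
Proof.
  intro L. eapply cle_trans; [apply small_subsets|]. eapply cle_trans; [apply Fun_cle|exact hmu].
  apply cle_suc; auto using mu0, mu1, mumu.
Qed.
Lemma Cohen_set_mu : cle Cohen_set mu.
Proof.
  apply cle_trans with (sep (Pow (prod Cohen_index two)) (fun p => cle p k)).
  - apply cle_sub. intros p Hp. apply Cohen_setE in Hp. rewrite sepE by dfn. rewrite PowE. split; [tauto|].
    eapply cle_trans; [apply Hp|apply l_k].
  - apply small_mu. eapply cle_trans; [|apply mumu]. apply cle_prod; [apply Cohen_index_mu|apply two_mu].
Qed.
(** Nice names for functions from [k] to [two]: a pair [(x, p)] says that [p] gives the value 1 at
    [x]. The antichain condition keeps them of size at most [k], and [mu^k = mu] then bounds their
    number. *)
Definition nice := sep (Pow (prod k Cohen_set)) (fun n => cle n k).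
Lemma nice_mu : cle nice mu.
Proof. apply small_mu. eapply cle_trans; [|apply mumu]. apply cle_prod; [apply k_mu|apply Cohen_set_mu]. Qed.
End Cohen.

(** * Preservation *)

Lemma u_upair x y z : ufm (fun A e => is_upair (e x) (e y) (e z)).
Proof. unfold is_upair. ufm. Qed.
#[export] Hint Resolve u_upair : ufm.
Lemma u_pair x y z : ufm (fun A e => is_pair (e x) (e y) (e z)).
Proof. unfold is_pair. ufm. Qed.
#[export] Hint Resolve u_pair : ufm.
Lemma u_rel x y z : ufm (fun A e => rel (e x) (e y) (e z)).
Proof. unfold rel. ufm. Qed.
#[export] Hint Resolve u_rel : ufm.
Lemma u_subset x y : ufm (fun A e => subset (e x) (e y)).
Proof. unfold subset. ufm. Qed.
#[export] Hint Resolve u_subset : ufm.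
Lemma u_is_fun x y z : ufm (fun A e => is_fun (e x) (e y) (e z)).
Proof. unfold is_fun. ufm. Qed.
#[export] Hint Resolve u_is_fun : ufm.

(** * Generic filters over a countable model, closure and antichain conditions *)

Section Generics.
Context {V : Type} {M : Model V} {P lo one : V} {fn : is_forcing_notion P lo one}.
Context (en : nat -> V) (Hen : forall x, exists n, en n = x).
Notation st q p := (pair q p ∊ lo).
Notation fc := (fcs mem P lo).
Implicit Types p q r : V.

(** Rasiowa-Sikorski: [en] lists the whole model, and step [n] moves into the set [en n] whenever it
    contains an extension of the current condition. *)
Lemma generic_ex p : p ∊ P -> exists G, Generic P lo G /\ G p.
Proof.
  intro Hp.
  pose (good := fun d q r => st r q /\ ((exists r', r' ∊ d /\ st r' q) -> r ∊ d)).
  pose (next := fun d q => the (good d q)).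
  assert (Hnext : forall d q, q ∊ P -> good d q (next d q)).
  { intros d q Hq. apply the_spec. destruct (classic (exists r, r ∊ d /\ st r q)) as [(r & H & H')|N].
    - exists r. split; auto.
    - exists q. split; [now apply (fn_refl P lo one fn)|]. intro H. destruct (N H). }
  pose (s := nat_rect (fun _ => V) p (fun n q => next (en n) q)).
  assert (Ps : forall n, s n ∊ P).
  { induction n; [exact Hp|]. destruct (Hnext (en n) (s n) IHn) as [H _]. now apply (fn_dom P lo one fn) in H. }
  assert (S1 : forall n, st (s (S n)) (s n)) by (intro n; apply (Hnext (en n) (s n) (Ps n))).
  assert (Sle : forall n m, n <= m -> st (s m) (s n)).
  { intros n m H. induction H; [now apply (fn_refl P lo one fn)|]. exact (fn_trans P lo one fn _ _ _ (S1 m) IHle). }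
  exists (fun q => exists n, st (s n) q). split; [constructor|].
  - intros q [n H]. now apply (fn_dom P lo one fn) in H.
  - exists p, 0. apply (Sle 0 0). lia.
  - intros q r [n H] H'. exists n. exact (fn_trans P lo one fn _ _ _ H H').
  - intros q r [n H] [m H']. exists (s (n + m)). split; [exists (n + m); now apply (fn_refl P lo one fn)|].
    split; eapply (fn_trans P lo one fn); [|exact H| |exact H']; apply Sle; lia.
  - intros D HD. destruct (Hen D) as [n <-]. exists (s (S n)). split; [exists (S n); now apply (fn_refl P lo one fn)|].
    destruct (Hnext (en n) (s n) (Ps n)) as [_ K]. apply K. apply HD, Ps.
  - exists 0. apply (Sle 0 0). lia.
Qed.

(** Truth in all generic extensions implies being forced: otherwise some [q] below [p] has no
    extension forcing the formula, which contradicts the truth lemma for a filter through [q].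
    Forcing statements can thus be proved semantically. *)
Lemma forced f v p : ufm f -> p ∊ P ->
  (forall G (gen : Generic P lo G), G p -> holds (memN (P:=P) (lo:=lo) (G:=G)) (f (ext_of G) (fun n => cls (v n)))) ->
  fc p (f V v).
Proof.
  intros U Hp H. apply fc_dense; [exact Hp|]. intros q Hq. apply NNPP. intro N.
  destruct (generic_ex q) as (G & gen & Gq); [now apply (fn_dom P lo one fn) in Hq|].
  assert (Gp : G p) by exact (gen_up p q Gq Hq).
  pose proof (H G gen Gp) as K. apply (truth f U) in K. destruct K as (r & Gr & K).
  destruct (gen_dir q r Gq Gr) as (w & Gw & Wq & Wr). apply N. exists w. split; [exact Wq|]. eapply fc_mono; eauto.
Qed.

Context {C : Choice V} {l k : V} (so : succ_of l k).
Context (Pclosed : forall i f, i ∊ k ->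
  (forall j, j ∊ i -> app f j ∊ P /\ forall j', j' ∊ j -> st (app f j) (app f j')) ->
  exists q, q ∊ P /\ forall j, j ∊ i -> st q (app f j)).
Context (Pcc : forall A, Sub A P ->
  (forall a b, a ∊ A -> b ∊ A -> (exists r, st r a /\ st r b) -> a = b) -> cle A k).
Let Ok := so_Ok l k so.
Notation chk := (chk (one:=one)).
Notation jg g := (emb (fn:=fn) (gen:=g)).

Section Name.
Context (σ b c : V).
Definition isf p := fc p (is_fun σ (chk b) (chk c)).
Definition relf p x y := fc p (rel σ (chk x) (chk y)).
Lemma dp3_relf : dp3 relf.
Proof.
  pose proof (dp3_fc (P:=P) (lo:=lo) (fun A e => rel (e 2) (e 0) (e 1)) (fun _ => σ) (u_rel 2 0 1)) as D.
  pose proof (df1_chk (one:=one)) as D'. unfold relf.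
  apply (dp3_sub _ (fun e => e 0) (fun e => chk (e 1)) (fun e => chk (e 2)) D); dfn.
Qed.
Lemma truth_isf G {gen : Generic P lo G} : IsFun (cls (G:=G) σ) (jg gen b) (jg gen c) <-> exists p, G p /\ isf p.
Proof.
  rewrite <- IsFunP.
  exact (truth (fun A e => is_fun (e 0) (e 1) (e 2)) (u_is_fun 0 1 2) (fun n => match n with 0 => σ | 1 => chk b | _ => chk c end)).
Qed.
Lemma truth_relf G {gen : Generic P lo G} x y : pair (jg gen x) (jg gen y) ∊ cls (G:=G) σ <-> exists p, G p /\ relf p x y.
Proof.
  rewrite <- relP.
  exact (truth (fun A e => rel (e 0) (e 1) (e 2)) (u_rel 0 1 2) (fun n => match n with 0 => σ | 1 => chk x | _ => chk y end)).
Qed.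
Lemma relf_app G {gen : Generic P lo G} x y : IsFun (cls (G:=G) σ) (jg gen b) (jg gen c) -> x ∊ b ->
  app (cls (G:=G) σ) (jg gen x) = jg gen y <-> exists p, G p /\ relf p x y.
Proof.
  intros F Hx. rewrite <- truth_relf, (fun_rel _ _ _ _ _ F), emb_mem'. intuition.
Qed.
(** A value is computed in an arbitrary generic extension through [p], and the condition responsible
    for it is then taken back to the ground model. *)
Lemma relf_decide p x : p ∊ P -> isf p -> x ∊ b -> exists q y, st q p /\ y ∊ c /\ relf q x y.
Proof.
  intros Hp F Hx. destruct (generic_ex p Hp) as (G & gen & Gp).
  assert (F' : IsFun (cls (G:=G) σ) (jg gen b) (jg gen c)) by (apply truth_isf; eauto).
  assert (Hy : app (cls (G:=G) σ) (jg gen x) ∊ jg gen c) by (apply F'; now apply emb_mem').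
  apply embE' in Hy. destruct Hy as (y & Hy & E). apply relf_app in E; auto. destruct E as (q & Gq & R).
  destruct (gen_dir p q Gp Gq) as (r & _ & Rp & Rq). exists r, y. split; [exact Rp|]. split; [exact Hy|].
  eapply fc_mono; eauto.
Qed.
Lemma relf_unique p x y y' : p ∊ P -> isf p -> x ∊ b -> relf p x y -> relf p x y' -> y = y'.
Proof.
  intros Hp F Hx R R'. destruct (generic_ex p Hp) as (G & gen & Gp).
  assert (F' : IsFun (cls (G:=G) σ) (jg gen b) (jg gen c)) by (apply truth_isf; eauto).
  assert (E : app (cls (G:=G) σ) (jg gen x) = jg gen y) by (apply relf_app; eauto).
  assert (E' : app (cls (G:=G) σ) (jg gen x) = jg gen y') by (apply relf_app; eauto).
  rewrite E in E'. now apply emb_inj in E'.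
Qed.
Lemma isf_mono p q : isf p -> st q p -> isf q. Proof. apply fc_mono. Qed.
Lemma relf_mono p q x y : relf p x y -> st q p -> relf q x y. Proof. apply fc_mono. Qed.

(** The values are decided one after the other along a descending sequence of length [b]; closure
    provides lower bounds at every stage and at the end. So the conditions that decide the whole
    function are dense below [p]. *)
Lemma ground_function G {gen : Generic P lo G} : b ∊ k ->
  IsFun (cls (G:=G) σ) (jg gen b) (jg gen c) -> exists h, cls (G:=G) σ = jg gen h.
Proof.
  intros Hb F. assert (Ob : Ord b) by (eapply ord_in; eauto). pose proof dp3_relf as DR.
  pose proof F as Hp. apply truth_isf in Hp. destruct Hp as (p & Gp & Fp).
  destruct (gen_dense (fun r => exists h, IsFun h b c /\ forall x, x ∊ b -> relf r x (app h x)) p) as (r & Gr & (h & Fh & Hh) & _); [dfn|exact Gp| |].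
  - intros q Hq. assert (Pq : q ∊ P) by now apply (fn_dom P lo one fn) in Hq.
    destruct (sequence (sep P (fun r => st r q)) (fun r r' => st r' r) (fun x r => exists y, y ∊ c /\ relf r x y) b) as (f & Hf); [dfn|dfn|exact Ob| |].
    { intros i f Hi H.
      assert (L : exists r, r ∊ P /\ st r q /\ forall i', i' ∊ i -> st r (app f i')).
      (* A lower bound of the empty sequence need not be below [q], so this case is treated
         separately. *)
      { destruct (classic (i = emp)) as [->|Ni].
        - exists q. split; [exact Pq|]. split; [now apply (fn_refl P lo one fn)|]. intros i' Hi'. destruct (empE _ Hi').
        - destruct (nonempty i Ni) as [i0 Hi0]. destruct (Pclosed i f) as (r & Pr & Hr).
          + eapply ord_trans; eauto.
          + intros i' Hi'. destruct (H i' Hi') as (K & _ & L). sepin K. split; [apply K|exact L].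
          + exists r. split; [exact Pr|]. split; [|exact Hr]. destruct (H i0 Hi0) as (K & _). sepin K.
            exact (fn_trans P lo one fn _ _ _ (Hr i0 Hi0) (proj2 K)). }
      destruct L as (r & Pr & Rq & Lr).
      destruct (relf_decide r i) as (r' & y & Hr' & Hy & R); [exact Pr| |exact Hi|].
      { eapply isf_mono; [exact Fp|]. exact (fn_trans P lo one fn _ _ _ Rq Hq). }
      exists r'. rewrite sepE by dfn. split; [|split; [eauto|]].
      - split; [now apply (fn_dom P lo one fn) in Hr'|]. exact (fn_trans P lo one fn _ _ _ Hr' Rq).
      - intros i' Hi'. exact (fn_trans P lo one fn _ _ _ Hr' (Lr i' Hi')). }
    assert (L : exists r, r ∊ P /\ st r q /\ forall i, i ∊ b -> st r (app f i)).
    { destruct (classic (b = emp)) as [->|Ni].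
      - exists q. split; [exact Pq|]. split; [now apply (fn_refl P lo one fn)|]. intros i' Hi'. destruct (empE _ Hi').
      - destruct (nonempty b Ni) as [i0 Hi0]. destruct (Pclosed b f Hb) as (r & Pr & Hr).
        + intros i Hi. destruct (Hf i Hi) as (K & _ & L). sepin K. split; [apply K|exact L].
        + exists r. split; [exact Pr|]. split; [|exact Hr]. destruct (Hf i0 Hi0) as (K & _). sepin K.
          exact (fn_trans P lo one fn _ _ _ (Hr i0 Hi0) (proj2 K)). }
    destruct L as (r & Pr & Rq & Lr). exists r. split; [exact Rq|].
    destruct (choice_rel b c (fun x y => relf r x y)) as (h & Fh & Hh); [dfn| |eauto].
    intros x Hx. destruct (Hf x Hx) as (_ & (y & Hy & R) & _). exists y. split; [exact Hy|]. eapply relf_mono; eauto.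
  - exists h. destruct (emb_fun (gen:=gen) h b c Fh) as [Fj Kj]. apply (fun_ext _ _ _ _ _ F Fj).
    intros m Hm. apply embE' in Hm. destruct Hm as (x & Hx & ->). rewrite Kj by exact Hx.
    apply relf_app; auto. eauto.
Qed.

(** Conditions below [p] that decide different values at [x] are incompatible. The antichain
    condition therefore leaves at most [k] candidates, and their set is definable in the ground
    model. *)
Lemma cover_function G {gen : Generic P lo G} :
  IsFun (cls (G:=G) σ) (jg gen b) (jg gen c) -> exists F : V -> V, df1 F /\
    forall x, x ∊ b -> Sub (F x) c /\ cle (F x) k /\
      forall y, app (cls (G:=G) σ) (jg gen x) = jg gen y -> y ∊ F x.
Proof.
  intros F. pose proof dp3_relf as DR.
  pose proof F as Hp. apply truth_isf in Hp. destruct Hp as (p & Gp & Fp).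
  exists (fun x => sep c (fun y => exists q, st q p /\ relf q x y)). split; [dfn|]. intros x Hx. split; [|split].
  - intros y Hy. sepin Hy. apply Hy.
  - set (B := sep c (fun y => exists q, st q p /\ relf q x y)).
    destruct (choice_rel B P (fun y q => st q p /\ relf q x y)) as (f & Hf & Hf'); [dfn| |].
    { intros y Hy. unfold B in Hy. sepin Hy. destruct Hy as (_ & q & Hq & R). exists q.
      split; [now apply (fn_dom P lo one fn) in Hq|auto]. }
    assert (K : forall y y', y ∊ B -> y' ∊ B -> (exists r, st r (app f y) /\ st r (app f y')) -> y = y').
    { intros y y' Hy Hy' (r & R1 & R2). destruct (Hf' y Hy) as [A1 A2]. destruct (Hf' y' Hy') as [_ A2'].
      apply (relf_unique r x); auto.
      - now apply (fn_dom P lo one fn) in R1.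
      - eapply isf_mono; [exact Fp|]. exact (fn_trans P lo one fn _ _ _ R1 A1).
      - eapply relf_mono; eauto.
      - eapply relf_mono; eauto. }
    apply cle_trans with (rep B (app f)).
    + exists f. split.
      * intros y Hy. rewrite repE by apply df1_app. eauto.
      * intros y y' Hy Hy' E. apply K; auto. exists (app f y). rewrite <- E.
        assert (app f y ∊ P) by now apply Hf. split; now apply (fn_refl P lo one fn).
    + apply Pcc.
      * intros q Hq. rewrite repE in Hq by apply df1_app. destruct Hq as (y & Hy & ->). now apply Hf.
      * intros q q' Hq Hq' R. rewrite repE in Hq, Hq' by apply df1_app. destruct Hq as (y & Hy & ->).
        destruct Hq' as (y' & Hy' & ->). f_equal. auto.
  - intros y E. rewrite sepE by dfn. assert (Hy : jg gen y ∊ jg gen c) by (rewrite <- E; apply F; now apply emb_mem').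
    apply emb_mem' in Hy. split; [exact Hy|]. apply relf_app in E; auto. destruct E as (q & Gq & R).
    destruct (gen_dir p q Gp Gq) as (r & _ & Rp & Rq). exists r. split; [exact Rp|]. eapply relf_mono; eauto.
Qed.
End Name.

Section Preservation.
Context {G : V -> Prop} {gen : Generic P lo G}.
Notation N := (ext_of (P:=P) (lo:=lo) G).
Notation jj := (jg gen).

Lemma ground_fun (F : N) b c : b ∊ k -> IsFun F (jj b) (jj c) -> exists h, F = jj h /\ IsFun h b c.
Proof.
  intros Hb HF. rewrite <- (cls_rep F) in HF. destruct (ground_function _ b c G Hb HF) as [h E].
  exists h. rewrite <- (cls_rep F). split; [exact E|]. rewrite E in HF. now apply emb_fun_inv in HF.
Qed.
Lemma cover_fun (F : N) b c : IsFun F (jj b) (jj c) -> exists H : V -> V, df1 H /\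
    forall x, x ∊ b -> Sub (H x) c /\ cle (H x) k /\ forall y, app F (jj x) = jj y -> y ∊ H x.
Proof. rewrite <- (cls_rep F). apply cover_function. Qed.
Lemma emb_two : jj two = two.
Proof. unfold two. now rewrite !emb_suc, emb_emp. Qed.
Lemma ground_subset (A : N) b : b ∊ k -> Sub A (jj b) -> exists x, A = jj x.
Proof.
  intros Hb S. assert (D : df1 (fun i : N => ite (i ∊ A) (suc emp) emp)) by dfn.
  destruct (ground_fun (lam (jj b) (fun i => ite (i ∊ A) (suc emp) emp)) b two Hb) as (h & E & Fh).
  { rewrite emb_two. apply lam_fun; [exact D|]. intros i Hi. apply twoE.
    destruct (classic (i ∊ A)); [rewrite ite_true|rewrite ite_false]; auto. }
  assert (K : forall x, x ∊ b -> jj x ∊ A <-> app h x = suc emp).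
  { intros x Hx. assert (E' : app (jj h) (jj x) = jj (app h x)) by (apply (emb_fun h b two); auto).
    rewrite <- E, app_lam in E' by first [exact D|now apply emb_mem']. split; intro H.
    - rewrite ite_true in E' by exact H. apply (emb_inj (gen:=gen)). now rewrite <- E', emb_suc, emb_emp.
    - apply NNPP. intro Nx. rewrite ite_false, H, emb_suc, emb_emp in E' by exact Nx. exact (emp_neq_one E'). }
  exists (sep b (fun x => app h x = suc emp)). apply set_ext. intro m. rewrite embE'. split.
  - intro Hm. pose proof (S m Hm) as Hm'. apply embE' in Hm'. destruct Hm' as (x & Hx & ->). exists x.
    rewrite sepE by dfn. split; [|reflexivity]. split; [exact Hx|now apply K].
  - intros (x & Hx & ->). sepin Hx. apply K; tauto.
Qed.

(** A bijection with domain below [k] already lies in the ground model. For [b] at least [k], the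
    covering sets exhibit [a] in the ground model as a union of [b] many sets of size at most [k],
    so [a] has size at most that of [b]. *)
Lemma emb_cardinal a : ⊨ cardinal a -> ⊨ cardinal (jj a).
Proof.
  rewrite !cardinalP. intros [Oa Ca]. split; [now apply emb_Ord|]. intros m Hm (f & If & Sf).
  apply embE' in Hm. destruct Hm as (b & Hb & ->). assert (Ob : Ord b) by (eapply ord_in; eauto).
  set (F := lam (jj b) (app f)).
  assert (HF : IsFun F (jj b) (jj a)) by (eapply Inj_IsFun; eauto).
  assert (EF : forall u, u ∊ jj b -> app F u = app f u) by (intros; apply app_lam; auto using df1_app).
  assert (IF : Inj F (jj b) (jj a)) by (apply InjI; [apply df1_app|apply If|apply If]).
  assert (SF : Surj F (jj b) (jj a)).
  { intros y Hy. destruct (Sf y Hy) as (x & Hx & E). exists x. rewrite EF; auto. }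
  destruct (classic (b ∊ k)) as [Hbk|Hbk].
  - destruct (ground_fun F b a Hbk HF) as (h & E & Fh). rewrite E in IF, SF.
    apply (Ca b Hb). exists h. split; [now apply (emb_Inj h b a Fh)|now apply (emb_Surj h b a Fh)].
  - assert (Skb : Sub k b) by (destruct (ord_lin k b Ok Ob); tauto).
    assert (Slb : Sub l b) by (eapply Sub_trans; [apply (so_sub so)|exact Skb]).
    assert (bb : cle (prod b b) b) by (apply (hessenberg l); auto; apply so).
    destruct (cover_fun F b a HF) as (H & DH & HH).
    apply (Ca b Hb). apply cle_antisym; [apply cle_sub, ord_sub; auto|].
    apply cle_trans with (Union (rep b H)).
    + apply cle_sub. intros y Hy. destruct (SF (jj y)) as (u & Hu & E); [now apply emb_mem'|].
      apply embE' in Hu. destruct Hu as (x & Hx & ->). apply UnionE. exists (H x).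
      rewrite repE by exact DH. split; [eauto|]. now apply (HH x Hx).
    + apply (cle_Union b bb b H DH (cle_refl b)).
      intros x Hx. eapply cle_trans; [now apply (HH x Hx)|]. now apply cle_sub.
Qed.

Lemma emb_succ_card : ⊨ cardinal k -> ⊨ succ_card (jj l) (jj k).
Proof.
  intro Ck. split; [now apply emb_cardinal|]. split; [apply emb_mem', so|].
  intros m [Cm Hm]. apply cardinalP in Cm. destruct Cm as [Om Cm].
  assert (Ojk : Ord (jj k)) by now apply emb_Ord.
  destruct (ord_tri _ Ojk _ Om) as [H|[H|H]]; [right; exact H|left; exact H|]. exfalso.
  apply embE' in H. destruct H as (z & Hz & ->). apply (Cm (jj l) Hm). apply cle_antisym.
  - apply cle_sub. apply ord_sub; auto. apply emb_Ord, so.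
  - apply emb_cle. now apply so.
Qed.

Lemma cofinal_mapP {W : Type} {MW : Model W} (f d a : W) : ⊨ cofinal_map f d a <->
  IsFun f d a /\ forall x, x ∊ a -> exists i, i ∊ d /\ (x = app f i \/ x ∊ app f i).
Proof.
  change (⊨ cofinal_map f d a) with ((⊨ is_fun f d a) /\ forall x, x ∊ a -> exists i, i ∊ d /\ exists y, y ∊ a /\
    (⊨ rel f i y) /\ (x = y \/ x ∊ y)).
  setoid_rewrite IsFunP. setoid_rewrite relP. split; intros [F H]; (split; [exact F|]); intros x Hx.
  - destruct (H x Hx) as (i & Hi & y & Hy & R & K). apply (fun_rel f d a) in R; [|exact F]. destruct R as [_ ->]. eauto.
  - destruct (H x Hx) as (i & Hi & K). exists i. split; [exact Hi|]. exists (app f i). split; [now apply F|].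
    split; [now apply (fun_rel f d a)|exact K].
Qed.
Lemma is_cofP {W : Type} {MW : Model W} (a d : W) : ⊨ is_cof a d <->
  Ord a /\ Ord d /\ (exists f, ⊨ cofinal_map f d a) /\ forall e, e ∊ d -> ~ exists f, ⊨ cofinal_map f e a.
Proof. reflexivity. Qed.

(** A cofinal map whose domain [e] is at least [k] need not lie in the ground model, but each of its
    values lies in a ground model set [H x] of size at most [k]. Since [k] is below the cofinality
    [d], these sets are bounded in [a], and choosing bounds gives a cofinal map from [e] in the
    ground model. *)
Lemma emb_cof a d : ⊨ is_cof a d -> ⊨ is_cof (jj a) (jj d).
Proof.
  rewrite !is_cofP. setoid_rewrite cofinal_mapP. intros (Oa & Od & (f & Ff & Cf) & Nd).
  split; [now apply emb_Ord|]. split; [now apply emb_Ord|]. split.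
  - destruct (emb_fun (gen:=gen) f d a Ff) as [Fj Kj]. exists (jj f). split; [exact Fj|].
    intros m Hm. apply embE' in Hm. destruct Hm as (x & Hx & ->). destruct (Cf x Hx) as (i & Hi & K).
    exists (jj i). rewrite Kj by exact Hi. rewrite !emb_mem'. split; [exact Hi|]. destruct K as [<-|K]; auto.
  - intros m Hm (g & Fg & Cg). apply embE' in Hm. destruct Hm as (e & He & ->).
    assert (Oe : Ord e) by (eapply ord_in; eauto).
    destruct (classic (e ∊ k)) as [Hek|Hek].
    + destruct (ground_fun g e a Hek Fg) as (h & -> & Fh). destruct (emb_fun (gen:=gen) h e a Fh) as [_ Kj].
      apply (Nd e He). exists h. split; [exact Fh|]. intros x Hx. destruct (Cg (jj x)) as (u & Hu & K); [now apply emb_mem'|].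
      apply embE' in Hu. destruct Hu as (i & Hi & ->). rewrite Kj in K by exact Hi. rewrite emb_mem' in K. exists i.
      split; [exact Hi|]. destruct K as [K|K]; [left; now apply emb_inj in K|auto].
    + assert (Hkd : k ∊ d).
      { destruct (ord_tri k Ok e Oe) as [H|[->|H]]; [eapply ord_trans; eauto|exact He|tauto]. }
      destruct (cover_fun g e a Fg) as (H & DH & HH).
      assert (Val : forall x, x ∊ e -> exists y, y ∊ a /\ app g (jj x) = jj y /\ y ∊ H x).
      { intros x Hx. assert (Hy : app g (jj x) ∊ jj a) by (apply Fg; now apply emb_mem').
        apply embE' in Hy. destruct Hy as (y & Hy & E). exists y. split; [exact Hy|]. split; [exact E|]. now apply (HH x Hx). }
      assert (Bd : forall x, x ∊ e -> exists z, z ∊ a /\ forall y, y ∊ H x -> y ∊ z).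
      { intros x Hx. destruct (HH x Hx) as (S1 & (t & Ht & It) & _). destruct (Val x Hx) as (y0 & Hy0 & _ & Hy0').
        (* If [H x] were unbounded, inverting the injection [t] of [H x] into [k] would give a
           cofinal map from [k]; [y0] is its value at points that [t] does not reach. *)
        apply NNPP. intro Nz. apply (Nd k Hkd).
        pose (T := fun i => ite (exists y, y ∊ H x /\ app t y = i) (Union (sep (H x) (fun y => app t y = i))) y0).
        assert (DT : df1 T) by (unfold T; dfn).
        assert (T1 : forall y, y ∊ H x -> T (app t y) = y).
        { intros y Hy. unfold T. rewrite ite_true by eauto. apply Union_sep_eq; [dfn|exact Hy|reflexivity|].
          intros y' Hy' E. now apply It. }
        exists (lam k T). split.
        - apply lam_fun; [exact DT|]. intros i Hi. destruct (classic (exists y, y ∊ H x /\ app t y = i)) as [(y & Hy & <-)|Ni].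
          + rewrite T1; auto.
          + unfold T. rewrite ite_false; auto.
        - intros z Hz. apply NNPP. intro Nz'. apply Nz. exists z. split; [exact Hz|]. intros y Hy.
          assert (Oy : Ord y) by exact (ord_in _ _ Oa (S1 y Hy)). assert (Oz : Ord z) by exact (ord_in _ _ Oa Hz).
          destruct (ord_tri y Oy z Oz) as [K|K]; [exact K|]. destruct Nz'. exists (app t y). split; [auto|].
          rewrite app_lam, T1 by auto. destruct K as [->|K]; auto. }
      destruct (choice_rel e a (fun x z => forall y, y ∊ H x -> y ∊ z)) as (h & Fh & Hh); [dfn|exact Bd|].
      apply (Nd e He). exists h. split; [exact Fh|]. intros z Hz. destruct (Cg (jj z)) as (u & Hu & K); [now apply emb_mem'|].
      apply embE' in Hu. destruct Hu as (x & Hx & ->). exists x. split; [exact Hx|]. right.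
      destruct (Val x Hx) as (y & Hy & E & Hy'). rewrite E, emb_mem' in K. pose proof (Hh x Hx y Hy') as L.
      destruct K as [K|K]; [apply emb_inj in K; now subst|].
      assert (Hhx : app h x ∊ a) by now apply Fh. eapply ord_trans; [exact (ord_in _ _ Oa Hhx)|exact L|exact K].
Qed.

Lemma is_twoP {W : Type} {MW : Model W} (t : W) : ⊨ is_two t <-> t = two.
Proof.
  change (⊨ is_two t) with (exists a b, (⊨ empty a) /\ (⊨ is_succ a b) /\ ⊨ is_succ b t).
  assert (K : forall a b : W, (⊨ is_succ a b) <-> b = suc a).
  { intros a b. cbn. split.
    - intro H. apply set_ext. intro z. rewrite sucE. exact (conj (proj1 (H z)) (proj2 (H z))).
    - intros -> z. split; apply sucE. }
  split.
  - intros (a & b & E & H1 & H2). apply K in H1. apply K in H2. apply emp_eq in E. now subst.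
  - intros ->. exists emp, (suc emp). rewrite !K. split; [exact empE|auto].
Qed.
Lemma card_exp2P {W : Type} {MW : Model W} (a e : W) : ⊨ card_exp2 a e <-> (⊨ cardinal e) /\ ceq (Fun a two) e.
Proof.
  change (⊨ card_exp2 a e) with (exists t, (⊨ is_two t) /\ exists s, (forall f, (f ∊ s -> ⊨ is_fun f a t) /\ ((⊨ is_fun f a t) -> f ∊ s)) /\
    (⊨ cardinal e) /\ (⊨ card_eq s e)).
  setoid_rewrite is_twoP. setoid_rewrite ceqP. setoid_rewrite IsFunP. split.
  - intros (t & -> & s & H & C1 & C2). split; [exact C1|]. replace (Fun a two) with s; [exact C2|].
    apply set_ext. intro f. rewrite FunE. exact (H f).
  - intros [C1 C2]. exists two. split; [reflexivity|]. exists (Fun a two). split; [|auto].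
    intro f. split; apply FunE.
Qed.
Lemma emb_exp2_l : ⊨ cardinal k -> ceq (Fun l two) k -> ⊨ card_exp2 (jj l) (jj k).
Proof.
  intros Ck E. apply card_exp2P. split; [now apply emb_cardinal|].
  replace (Fun (jj l) two) with (jj (Fun l two)); [now apply emb_ceq|].
  apply set_ext. intro f. rewrite FunE, embE', <- emb_two. split.
  - intros (h & Hh & ->). apply FunE in Hh. now apply (emb_fun h l two).
  - intro F. destruct (ground_fun f l two) as (h & -> & Fh); [apply so|exact F|]. exists h. split; [now apply FunE|reflexivity].
Qed.
End Preservation.
End Generics.

(** * The power of [k] in the Cohen extension *)

Section CohenExtension.
Context {V : Type} {M : Model V} {C : Choice V}.
Context (l k mu : V) (so : succ_of l k) (Omu : Ord mu) (kmu : k ∊ mu).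
Context (h2l : ceq (Fun l two) k) (hmu : cle (Fun k mu) mu).
Notation P := (Cohen_set l k mu).
Notation lo := (Cohen_order l k mu).
Notation fc := (fcs mem P lo).
Notation st q p := (pair q p ∊ lo).
Notation chk := (chk (one:=emp)).
Instance CFN : is_forcing_notion P lo emp := Cohen_forcing l k mu.
Implicit Types p q r x y z ξ : V.

Lemma compat_common p q : p ∊ P -> q ∊ P -> compat p q <-> exists r, st r p /\ st r q.
Proof.
  intros Hp Hq. split.
  - intro K. assert (Hc := compat_cup l k mu so p q Hp Hq K). exists (cup p q).
    split; apply Cohen_orderE; (split; [exact Hc|]); (split; [assumption|]); intros z Hz; apply cupE; auto.
  - intros (r & H & H') x y y' Hy Hy'. apply Cohen_orderE in H. apply Cohen_orderE in H'. destruct H as (Hr & _ & S). destruct H' as (_ & _ & S').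
    apply Cohen_setE in Hr. apply (proj1 (proj2 Hr) x); auto.
Qed.
Lemma Pcc A : Sub A P -> (forall a b, a ∊ A -> b ∊ A -> (exists r, st r a /\ st r b) -> a = b) -> cle A k.
Proof.
  intros S H. apply (Cohen_antichain l k mu so h2l A S). intros a b Ha Hb K. apply H; auto. apply compat_common; auto.
Qed.
Lemma Pcl i f : i ∊ k -> (forall j, j ∊ i -> app f j ∊ P /\ forall j', j' ∊ j -> st (app f j) (app f j')) ->
  exists q, q ∊ P /\ forall j, j ∊ i -> st q (app f j).
Proof. apply Cohen_closed, so. Qed.

(** The two rows together contain at most [l] indices decided by [p], and [k] does not embed into
    [l]. *)
Lemma fresh p ξ ξ' : p ∊ P -> exists i, i ∊ k /\ (forall y, ~ pair (pair ξ i) y ∊ p) /\ (forall y, ~ pair (pair ξ' i) y ∊ p).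
Proof.
  intro Hp. apply NNPP. intro N. apply (so_k l k so).
  pose (S := fun ξ => sep k (fun i => pair ξ i ∊ dom_part k mu p)).
  assert (LS : forall ξ, cle (S ξ) l).
  { intro η. apply cle_trans with (dom_part k mu p); [|now apply (dm_small l k mu)].
    apply cleI with (fun i => pair η i); [dfn| |].
    - intros i Hi. unfold S in Hi. sepin Hi. apply Hi.
    - intros i i' _ _ E. now apply pair_inj in E. }
  apply cle_trans with (cup (S ξ) (S ξ')).
  - apply cle_sub. intros i Hi. apply NNPP. intro C'. apply N. exists i. split; [exact Hi|].
    split; intros y Hy; apply C', cupE; [left|right]; unfold S; rewrite sepE by dfn; (split; [exact Hi|]);
    apply (dmE l); eauto.
  - apply cle_cup; auto; apply so.
Qed.
Lemma separate p ξ ξ' : p ∊ P -> ξ ∊ mu -> ξ' ∊ mu -> ξ <> ξ' -> exists q i, st q p /\ i ∊ k /\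
  pair (pair ξ i) (suc emp) ∊ q /\ pair (pair ξ' i) emp ∊ q.
Proof.
  intros Hp Hx Hx' Nx. destruct (fresh p ξ ξ' Hp) as (i & Hi & F1 & F2).
  set (a := pair (pair ξ i) (suc emp)). set (b := pair (pair ξ' i) emp).
  assert (Hr : upair a b ∊ P).
  { apply Cohen_setE. split; [|split].
    - intros z Hz. apply upairE in Hz. destruct Hz as [->| ->]; unfold a, b; apply prod_pair; (split; [apply prod_pair; auto|apply twoE; auto]).
    - intros x y y' Hy Hy'. apply upairE in Hy. apply upairE in Hy'. unfold a, b in *.
      destruct Hy as [Hy|Hy], Hy' as [Hy'|Hy']; apply pair_inj in Hy; apply pair_inj in Hy'; destruct Hy as [E1 ->], Hy' as [E2 ->]; auto;
      rewrite E1 in E2; apply pair_inj in E2; intuition congruence.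
    - apply cleI with (fun x => ite (x = a) emp (suc emp)); [dfn| |].
      + intros x Hx0. destruct (classic (x = a)); [rewrite ite_true|rewrite ite_false]; auto; apply so.
      + intros x y Hx0 Hy. apply upairE in Hx0. apply upairE in Hy. pose proof (@emp_neq_one V M) as E1.
        destruct (classic (x = a)) as [Ex|Ex]; [rewrite (ite_true (x = a))|rewrite (ite_false (x = a))]; auto;
        (destruct (classic (y = a)) as [Ey|Ey]; [rewrite (ite_true (y = a))|rewrite (ite_false (y = a))]; auto); try congruence;
        intuition congruence. }
  assert (Hc : cup p (upair a b) ∊ P).
  { apply (compat_cup l k mu so); auto. intros x y y' Hy Hy'. apply upairE in Hy'. unfold a, b in Hy'.
    destruct Hy' as [E|E]; apply pair_inj in E; destruct E as [-> _]; [destruct (F1 y Hy)|destruct (F2 y Hy)]. }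
  exists (cup p (upair a b)), i. split; [|split; [exact Hi|]].
  - apply Cohen_orderE. split; [exact Hc|]. split; [exact Hp|]. intros z Hz. apply cupE; auto.
  - split; apply cupE; right; apply upairE; auto.
Qed.

(** A maximal antichain inside [T]: run through a well-order of [T] and keep each element
    incompatible with all those kept before. Compatibility in the sense of [compat] is having a
    common extension. *)
Lemma antichain_ex T : Sub T P -> exists A, Sub A T /\ cle A k /\ forall q, q ∊ T -> exists a, a ∊ A /\ compat a q.
Proof.
  intro ST. pose proof (@dp2_compat V M) as Dc. destruct (wellorder T) as (θ & e & Oθ & I & S).
  pose (anti := fun A => forall a b, a ∊ A -> b ∊ A -> compat a b -> a = b).
  assert (Dn : dp1 anti) by (unfold anti; dfn).
  pose proof (@dp2_Sub V M) as DS.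
  assert (chain : forall i f, Ord i ->
    (forall j, j ∊ i -> app f j ∊ sep (Pow T) anti /\ forall j', j' ∊ j -> Sub (app f j') (app f j)) ->
    Sub (Union (rep i (app f))) T /\ anti (Union (rep i (app f)))).
  { intros i f Oi H. split.
    - intros z Hz. apply Union_appE in Hz. destruct Hz as (j & Hj & Hz). destruct (H j Hj) as [K _]. sepin K.
      destruct K as [K _]. rewrite PowE in K. auto.
    - intros a b Ha Hb K. apply Union_appE in Ha, Hb. destruct Ha as (i1 & H1 & Ha), Hb as (i2 & H2 & Hb).
      destruct (H i1 H1) as (A1 & L1). destruct (H i2 H2) as (A2 & L2). sepin A1. sepin A2.
      destruct (ord_tri i1 (ord_in _ _ Oi H1) i2 (ord_in _ _ Oi H2)) as [W|[->|W]].
      + apply (proj2 A2); auto. exact (L2 i1 W a Ha).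
      + apply (proj2 A2); auto.
      + apply (proj2 A1); auto. exact (L1 i2 W b Hb). }
  destruct (sequence (sep (Pow T) anti) Sub (fun i A => exists a, a ∊ A /\ compat a (app e i)) θ) as (f & Hf); [dfn|dfn|exact Oθ| |].
  - intros i f Hi H. assert (Oi : Ord i) by (eapply ord_in; eauto).
    destruct (chain i f Oi) as [UT AU]; [intros j Hj; split; now apply H|]. set (U := Union (rep i (app f))) in *.
    assert (SU : forall i', i' ∊ i -> Sub (app f i') U) by (intros i' Hi' z Hz; apply Union_appE; eauto).
    destruct (classic (exists a, a ∊ U /\ compat a (app e i))) as [K|N].
    + exists U. rewrite sepE by dfn. rewrite PowE. auto.
    + set (w := app e i). assert (Hw : w ∊ T) by now apply I. exists (cup U (sing w)). rewrite sepE by dfn. rewrite PowE.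
      split; [split|split].
      * intros z Hz. rewrite cupE, singE in Hz. destruct Hz as [Hz| ->]; auto.
      * intros a b Ha Hb K. rewrite cupE, singE in Ha, Hb. destruct Ha as [Ha| ->], Hb as [Hb| ->]; auto.
        -- destruct N. eauto.
        -- destruct N. exists b. split; [exact Hb|]. intros x y y' Hy Hy'. symmetry. eapply K; eauto.
      * exists w. split; [apply cupE; right; now apply singE|]. intros x y y' Hy Hy'. apply ST, Cohen_setE in Hw.
        apply (proj1 (proj2 Hw) x); auto.
      * intros i' Hi' z Hz. apply cupE. left. exact (SU i' Hi' z Hz).
  - destruct (chain θ f Oθ) as [AT AA]; [intros j Hj; split; now apply Hf|].
    exists (Union (rep θ (app f))). split; [exact AT|]. split.
    + apply (Cohen_antichain l k mu so h2l); [eapply Sub_trans; eauto|exact AA].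
    + intros q Hq. destruct (S q Hq) as (i & Hi & <-). destruct (Hf i Hi) as (_ & (a & Ha & K) & _).
      exists a. split; [apply Union_appE; eauto|exact K].
Qed.

Section Ext.
Context {G : V -> Prop} {gen : Generic P lo G}.
Notation N := (ext_of (P:=P) (lo:=lo) G).
Notation jj := (emb (fn:=CFN) (gen:=gen)).
Notation GG := (generic_set (one:=emp) (P:=P) (lo:=lo) (G:=G)).

(** An element of [mu] is sent to its row in the generic function, read off the filter. Genericity
    together with [separate] makes different rows different. *)
Lemma mu_le_power : cle (jj mu) (Fun (jj k) two).
Proof.
  apply cleI with (fun m => lam (jj k) (fun i => ite (exists w, w ∊ GG /\ pair (pair m i) (suc emp) ∊ w) (suc emp) emp)); [dfn| |].
  - intros m _. apply FunE, lam_fun; [dfn|]. intros i Hi. apply twoE.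
    match goal with |- ite ?Q _ _ = _ \/ _ => destruct (classic Q) end; [rewrite ite_true|rewrite ite_false]; auto.
  - intros m m' Hm Hm' E. apply embE' in Hm. apply embE' in Hm'. destruct Hm as (ξ & Hx & ->). destruct Hm' as (ξ' & Hx' & ->).
    apply NNPP. intro Ne. assert (Nx : ξ <> ξ') by congruence. destruct (gen_ex (P:=P) (lo:=lo) (G:=G)) as [p Gp].
    destruct (gen_dense (fun q => exists i, i ∊ k /\ pair (pair ξ i) (suc emp) ∊ q /\ pair (pair ξ' i) emp ∊ q) p) as (q & Gq & (i & Hi & Q1 & Q2) & _).
    { dfn. } { exact Gp. }
    { intros q Hq. destruct (separate q ξ ξ') as (r & i & Hr & K); [apply Cohen_orderE in Hq; tauto|auto|auto|auto|]. eauto. }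
    apply (f_equal (fun f => app f (jj i))) in E.
    rewrite !app_lam in E by first [dfn|now apply emb_mem'].
    rewrite ite_true, ite_false in E.
    + exact (emp_neq_one (eq_sym E)).
    + intros (u & Hu & K). apply generic_setE in Hu. destruct Hu as (r & Gr & ->).
      rewrite <- (emb_emp (gen:=gen)), <- emb_suc, <- !emb_pair, emb_mem' in K.
      destruct (gen_dir q r Gq Gr) as (w & _ & W1 & W2). apply Cohen_orderE in W1. apply Cohen_orderE in W2.
      destruct W1 as (Hw & _ & S1). destruct W2 as (_ & _ & S2). apply Cohen_setE in Hw.
      apply (@emp_neq_one V M). apply (proj1 (proj2 Hw) (pair ξ' i)); auto.
    + exists (jj q). split; [apply generic_setE; eauto|].
      rewrite <- (emb_emp (gen:=gen)), <- emb_suc, <- !emb_pair, emb_mem'. exact Q1.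
Qed.

(** For each [x], keep a maximal antichain among the conditions forcing the value 1 at [x]. If the
    value is 1, the filter meets this antichain by density; conversely, each of its members forces
    the value 1. *)
Lemma nice_name (F : N) : IsFun F (jj k) two -> exists n, n ∊ nice l k mu /\
  forall x, x ∊ k -> app F (jj x) = suc emp <-> exists p, G p /\ pair x p ∊ n.
Proof.
  intro HF. rewrite <- (emb_two (gen:=gen)), <- (cls_rep F) in HF. set (σ := proj1_sig F) in *.
  pose proof (dp3_relf (P:=P) (lo:=lo) (one:=emp) σ) as DR.
  pose (T := fun x => sep P (fun p => relf (P:=P) (lo:=lo) (one:=emp) σ p x (suc emp))).
  assert (DT : df1 T) by (unfold T; dfn).
  assert (TP : forall x, Sub (T x) P) by (intros x p Hp; unfold T in Hp; sepin Hp; apply Hp).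
  pose proof (@dp2_compat V M) as Dc. pose proof (@dp2_Sub V M) as DS.
  destruct (choice_rel k (Pow P) (fun x A => Sub A (T x) /\ cle A k /\ forall q, q ∊ T x -> exists a, a ∊ A /\ compat a q)) as (A & _ & HA); [dfn| |].
  { intros x Hx. destruct (antichain_ex (T x) (TP x)) as (A & A1 & A2 & A3). exists A. split; [|auto].
    apply PowE. eapply Sub_trans; eauto. }
  set (n := sep (prod k P) (fun c => exists x p, c = pair x p /\ p ∊ app A x)).
  assert (En : forall x p, x ∊ k -> pair x p ∊ n <-> p ∊ app A x).
  { intros x p Hx. unfold n. rewrite sepE by dfn. rewrite prod_pair. split.
    - intros [_ (x' & p' & E & K)]. apply pair_inj in E. destruct E; subst. exact K.
    - intro K. split; [|eauto]. split; [exact Hx|]. apply (TP x), (HA x Hx), K. }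
  exists n. split.
  - unfold nice. rewrite sepE by dfn. rewrite PowE. split; [intros c Hc; unfold n in Hc; sepin Hc; apply Hc|].
    pose proof (so_k0 so) as k0. pose proof (so_k1 so) as k1. pose proof (so_kk so) as kk.
    apply cle_trans with (Union (rep k (fun x => prod (sing x) (app A x)))).
    + apply cle_sub. intros c Hc. unfold n in Hc. sepin Hc. destruct Hc as [Hc (x & p & -> & Hp)]. apply prod_pair in Hc.
      apply UnionE. exists (prod (sing x) (app A x)). rewrite repE by dfn. split; [exists x; tauto|].
      apply prod_pair. rewrite singE. auto.
    + apply cle_Union; auto using cle_refl; [dfn|]. intros x Hx. eapply cle_trans; [|exact kk].
      apply cle_prod; [now apply cle_sing|now apply HA].
  - intros x Hx. assert (R : app F (jj x) = suc emp <-> exists p, G p /\ relf (P:=P) (lo:=lo) (one:=emp) σ p x (suc emp)).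
    { rewrite <- (relf_app σ k two G x (suc emp)) by assumption. unfold σ. rewrite cls_rep, emb_suc, emb_emp. reflexivity. }
    rewrite R. split.
    + intros (r & Gr & Hr).
      destruct (gen_dense (fun q => exists p, p ∊ app A x /\ st q p) r) as (q & Gq & (p & Hp & Hq) & _); [dfn|exact Gr| |].
      * intros q Hq. assert (Pq : q ∊ P) by (apply Cohen_orderE in Hq; tauto).
        assert (Tq : q ∊ T x) by (unfold T; rewrite sepE by dfn; split; [exact Pq|eapply relf_mono; eauto]).
        destruct (HA x Hx) as (A1 & _ & A3). destruct (A3 q Tq) as (a & Ha & K).
        apply compat_common in K; [|apply (TP x), A1, Ha|exact Pq]. destruct K as (w & W1 & W2). eauto.
      * exists p. split; [exact (gen_up p q Gq Hq)|now apply En].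
    + intros (p & Gp & Hp). exists p. split; [exact Gp|]. apply En in Hp; [|exact Hx].
      apply (HA x Hx) in Hp. unfold T in Hp. sepin Hp. apply Hp.
Qed.

(** Inside the extension, the function is recovered from its nice name and the filter, so the ground
    model bound on the number of nice names carries over. *)
Lemma power_le_mu : cle (Fun (jj k) two) (jj mu).
Proof.
  apply cle_trans with (jj (nice l k mu)); [|apply emb_cle; exact (nice_mu l k mu so Omu kmu hmu)].
  apply cle_surj with (fun u F => IsFun F (jj k) two /\ forall i, i ∊ jj k -> app F i = suc emp <-> exists w, w ∊ GG /\ pair i w ∊ u).
  - dfn.
  - intros F HF. apply FunE in HF. destruct (nice_name F HF) as (n & Hn & K). exists (jj n).
    rewrite emb_mem'. split; [exact Hn|]. split; [exact HF|]. intros i Hi. apply embE' in Hi. destruct Hi as (x & Hx & ->).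
    rewrite K by exact Hx. split.
    + intros (p & Gp & Hp). exists (jj p). rewrite <- emb_pair, emb_mem'. split; [apply generic_setE; eauto|exact Hp].
    + intros (u & Hu & Hp). apply generic_setE in Hu. destruct Hu as (p & Gp & ->). rewrite <- emb_pair, emb_mem' in Hp. eauto.
  - intros u F F' _ [HF K] [HF' K']. apply (fun_ext _ _ _ _ _ HF HF'). intros i Hi.
    assert (E : app F i = suc emp <-> app F' i = suc emp) by (rewrite K, K' by exact Hi; reflexivity).
    assert (H1 : app F i ∊ two) by now apply HF. assert (H2 : app F' i ∊ two) by now apply HF'.
    apply twoE in H1. apply twoE in H2. pose proof (@emp_neq_one N _).
    destruct H1 as [H1|H1], H2 as [H2|H2]; rewrite H1, H2 in *; intuition congruence.
Qed.
End Ext.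

Lemma check_nameP x : ⊨ is_check_name emp x (chk x).
Proof.
  pose proof (df1_chk (one:=emp)) as D.
  set (T := Vh (suc (rank x))). assert (OT : Ord (suc (rank x))) by apply ord_suc, rank_ord.
  assert (TT : Tr T) by now apply Vh_Tr.
  change (⊨ is_check_name emp x (chk x)) with
   (exists f T, Tr T /\ x ∊ T /\
    (forall z, z ∊ T -> exists d, (⊨ rel f z d) /\ forall d', (⊨ rel f z d') -> d' = d) /\
    (forall z, z ∊ T -> forall d, (⊨ rel f z d) ->
       forall e, (e ∊ d -> exists w, w ∊ z /\ exists b, (⊨ rel f w b) /\ ⊨ is_pair b emp e) /\
                 ((exists w, w ∊ z /\ exists b, (⊨ rel f w b) /\ ⊨ is_pair b emp e) -> e ∊ d)) /\
    ⊨ rel f x (chk x)).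
  setoid_rewrite relP. setoid_rewrite is_pairP.
  exists (lam T chk), T. assert (Ep : forall a b, pair a b ∊ lam T chk <-> a ∊ T /\ b = chk a) by (intros; now apply pair_lam).
  setoid_rewrite Ep.
  assert (Hx : x ∊ T) by apply in_Vh.
  split; [exact TT|]. split; [exact Hx|]. split; [|split].
  - intros z Hz. exists (chk z). split; [auto|]. tauto.
  - intros z Hz d [_ ->] e. rewrite chkE. split.
    + intros (y & Hy & ->). exists y. split; [exact Hy|]. exists (chk y). split; [|reflexivity].
      split; [exact (TT z Hz y Hy)|reflexivity].
    + intros (y & Hy & b & [_ ->] & ->). eauto.
  - auto.
Qed.
End CohenExtension.

(** * Reduction to countable models *)

Ltac unfold_defs := cbv beta delta [subset empty is_upair is_pair is_union is_inter is_power is_succ rel is_fun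
  injective surjective card_le card_lt card_eq transitive ordinal cardinal is_card_of is_omega infinite_cardinal
  succ_card card_exp card_exp_lt is_two card_exp2 cofinal_map is_cof topology hausdorff closed_in discrete_in
  closed_discrete ona in_nbhd covered finer D_space locally_lt sticky sticky_cond sticky_ext kappa_D
  is_subspace_topology is_trace_ona subspace_kappa_D is_forcing rel3 in_dom forces_mem_from is_forces_eq_on
  forces_mem forces_eq is_check_name].
Ltac uniform := unfold_defs; ufm.

(** The two statements about the extension get names so that their uniformity can be stated; they
    unfold to the corresponding parts of the theorem. *)
Definition power_values {A : Type} (l m : A) : fm A := ∃ l', succ_card l l' ∧ card_exp2 l l' ∧ card_exp2 l' m.
Definition small_spaces_D {A : Type} (k : A) : fm A := ∀ X t,
  topology X t ∧ hausdorff X t ∧ locally_lt k X t ∧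
  (∃ k', succ_card k k' ∧ card_le X k') ∧
  (∀ U0, ona X t U0 ⇒
     ∃ U, ona X t U ∧ finer X U U0 ∧
       ∀[Y ∈ t] card_le Y k ⇒ subspace_kappa_D k t U Y) ⇒
  D_space X t.

Lemma u_power_values i j : ufm (fun A e => power_values (e i) (e j)).
Proof. unfold power_values. uniform. Qed.
Lemma u_small_spaces_D i : ufm (fun A e => small_spaces_D (e i)).
Proof. unfold small_spaces_D. uniform. Qed.
Lemma u_is_cof i j : ufm (fun A e => is_cof (e i) (e j)).
Proof. uniform. Qed.
Lemma u_cardinal i : ufm (fun A e => cardinal (e i)).
Proof. uniform. Qed.

(** The conclusion of the theorem, for a structure that need not be a model of ZFC. *)
Definition conclusion (V : Type) (mem : V -> V -> Prop) (lam kap mu : V) : Prop :=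
  exists P lo one, holds mem (is_forcing P lo one) /\
    (forall a d, holds mem (is_cof a d) -> exists a' d',
       holds mem (is_check_name one a a') /\ holds mem (is_check_name one d d') /\ fcs mem P lo one (is_cof a' d')) /\
    (forall a, holds mem (cardinal a) -> exists a', holds mem (is_check_name one a a') /\ fcs mem P lo one (cardinal a')) /\
    (forall b, holds mem (b ∈ kap) -> exists b', holds mem (is_check_name one b b') /\
       forall p s, holds mem (rel lo p one) -> fcs mem P lo p (subset s b') ->
       forall q, holds mem (rel lo q p) -> exists r, holds mem (rel lo r q) /\
         exists x c, holds mem (is_check_name one x c) /\ fcs mem P lo r (s ≡ c)) /\
    exists l k m, holds mem (is_check_name one lam l) /\ holds mem (is_check_name one kap k) /\
      holds mem (is_check_name one mu m) /\ fcs mem P lo one (power_values l m) /\ fcs mem P lo one (small_spaces_D k).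

Section Countable.
Context {V : Type} {M : Model V} {C : Choice V}.
Context (en : nat -> V) (Hen : forall x, exists n, en n = x).

(** Squaring amounts to exponentiation by [two], which belongs to [lam]. The hypothesis on
    [lam^(<lam)] thus contains [lam × lam ≤ lam], from which [hessenberg] starts. *)
Lemma prod_of_exp_lt lam : ⊨ infinite_cardinal lam -> ⊨ card_exp_lt lam lam lam ->
  Ord lam /\ emp ∊ lam /\ suc emp ∊ lam /\ cle (prod lam lam) lam.
Proof.
  intros [Cl (w & (Ow & (e & He & Ee) & Sw & _) & Sub_w)] (s & Hs & _ & Es).
  apply cardinalP in Cl. apply ceqP in Es.
  apply emp_eq in Ee. subst e.
  assert (Sw' : forall x, x ∊ w -> suc x ∊ w).
  { intros x Hx. destruct (Sw x Hx) as (y & Hy & E). replace (suc x) with y; [exact Hy|].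
    apply set_ext. intro z. rewrite sucE. exact (conj (proj1 (E z)) (proj2 (E z))). }
  assert (W : forall x, x ∊ w -> x ∊ lam) by exact Sub_w.
  split; [apply Cl|]. split; [now apply W|]. split; [now apply W, Sw'|].
  apply cle_trans with (Fun two lam); [apply prod_Fun; apply twoE; auto|].
  apply cle_trans with s; [|exact (proj1 (ceq_cle _ _ Es))]. apply cle_sub. intros f Hf. apply FunE in Hf.
  apply (Hs f). exists two. split; [unfold two; auto|now apply IsFunP].
Qed.

Theorem countable_case (lam kap kap' mu : V)
  (hlam : ⊨ infinite_cardinal lam) (hlamlt : ⊨ card_exp_lt lam lam lam)
  (hkap : ⊨ succ_card lam kap) (hkap' : ⊨ succ_card kap kap')
  (hmu : ⊨ (cardinal mu ∧ kap' ∈ mu)) (hmuexp : ⊨ card_exp mu kap mu)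
  (h2lam : ⊨ card_exp2 lam kap) : conclusion V mem lam kap mu.
Proof.
  destruct (prod_of_exp_lt lam hlam hlamlt) as (Ol & l0 & l1 & ll).
  assert (so : succ_of lam kap) by now apply succ_ofI.
  assert (Ckap : ⊨ cardinal kap) by apply hkap.
  destruct hmu as [Cmu Hmu]. assert (Omu : Ord mu) by (apply cardinalP in Cmu; apply Cmu).
  assert (kmu : kap ∊ mu) by (eapply ord_trans; [exact Omu|exact Hmu|apply hkap']).
  assert (h2l : ceq (Fun lam two) kap) by (apply card_exp2P in h2lam; apply h2lam).
  assert (hm : cle (Fun kap mu) mu).
  { destruct hmuexp as (s & Hs & _ & Es). apply ceqP in Es. apply cle_trans with s; [|exact (proj1 (ceq_cle _ _ Es))].
    apply cle_sub. intros f Hf. apply FunE in Hf. apply (Hs f). now apply IsFunP. }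
  set (P := Cohen_set lam kap mu). set (lo := Cohen_order lam kap mu).
  pose (fn := Cohen_forcing lam kap mu : is_forcing_notion P lo emp).
  pose proof (Pcc lam kap mu so h2l) as Hcc. pose proof (Pcl lam kap mu so) as Hcl.
  change (Cohen_set lam kap mu) with P in Hcc, Hcl. change (Cohen_order lam kap mu) with lo in Hcc, Hcl.
  pose proof (check_nameP (V:=V)) as CN.
  assert (Po : emp ∊ P) by apply emp_Cohen.
  exists P, lo, emp. split; [|split; [|split; [|split]]].
  - apply is_forcingP. split; [exact fn|apply Cohen_order_sub].
  - intros a d H. exists (chk (one:=emp) a), (chk (one:=emp) d). split; [apply CN|]. split; [apply CN|].
    apply (forced en Hen (fun A e => is_cof (e 0) (e 1)) (fun n => match n with 0 => chk (one:=emp) a | _ => chk (one:=emp) d end) emp);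
      [apply (u_is_cof 0 1)|exact Po|].
    intros G gen _. exact (emb_cof en Hen so Hcl Hcc (gen:=gen) a d H).
  - intros a H. exists (chk (one:=emp) a). split; [apply CN|].
    apply (forced en Hen (fun A e => cardinal (e 0)) (fun n => chk (one:=emp) a) emp); [apply (u_cardinal 0)|exact Po|].
    intros G gen _. exact (emb_cardinal en Hen so Hcl Hcc (gen:=gen) a H).
  - intros b Hb. exists (chk (one:=emp) b). split; [apply CN|]. intros p s Hp Fs q Hq.
    (* In the extension by a generic filter through [q], the value of [s] is a ground model set.
       Some condition of the filter forces this, and a common extension with [q] is the one
       required. *)
    apply relP in Hq. destruct (generic_ex en Hen q) as (G & gen & Gq); [now apply (fn_dom P lo emp fn) in Hq|].
    assert (Gp : G p) by exact (gen_up p q Gq Hq).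
    assert (S : Sub (cls (G:=G) s) (emb (gen:=gen) b)).
    { exact (proj2 (truth (fun A e => subset (e 0) (e 1)) (u_subset 0 1) (fun n => match n with 0 => s | _ => chk (one:=emp) b end)) (ex_intro _ p (conj Gp Fs))). }
    destruct (ground_subset en Hen so Hcl (cls s) b Hb S) as [x Ex].
    destruct (proj1 (truth (gen:=gen) (fun A e => Eq (e 0) (e 1)) (u_eq 0 1) (fun n => match n with 0 => s | _ => chk (one:=emp) x end)) Ex) as (r & Gr & Fr).
    destruct (gen_dir q r Gq Gr) as (w & _ & W1 & W2). exists w. split; [now apply relP|].
    exists x, (chk (one:=emp) x). split; [apply CN|]. eapply fc_mono; eauto.
  - exists (chk (one:=emp) lam), (chk (one:=emp) kap), (chk (one:=emp) mu).
    split; [apply CN|]. split; [apply CN|]. split; [apply CN|]. split.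
    + apply (forced en Hen (fun A e => power_values (e 0) (e 1)) (fun n => match n with 0 => chk (one:=emp) lam | _ => chk (one:=emp) mu end) emp);
        [apply (u_power_values 0 1)|exact Po|].
      intros G gen _. exists (emb (gen:=gen) kap).
      split; [exact (emb_succ_card en Hen so Hcl Hcc (gen:=gen) Ckap)|].
      split; [exact (emb_exp2_l en Hen so Hcl Hcc (gen:=gen) Ckap h2l)|].
      refine (proj2 (card_exp2P (emb (gen:=gen) kap) (emb (gen:=gen) mu)) _). split; [exact (emb_cardinal en Hen so Hcl Hcc (gen:=gen) mu Cmu)|].
      apply cle_antisym.
      * exact (power_le_mu lam kap mu so Omu kmu h2l hm (gen:=gen)).
      * exact (mu_le_power lam kap mu so (gen:=gen)).
    + apply (forced en Hen (fun A e => small_spaces_D (e 0)) (fun n => chk (one:=emp) kap) emp);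
        [apply (u_small_spaces_D 0)|exact Po|].
      intros G gen _.
      (* The covering theorem is applied inside the extension, where the images of [lam] and [kap]
         are still consecutive cardinals. *)
      assert (so' : succ_of (emb (gen:=gen) lam) (emb (gen:=gen) kap)).
      { apply succ_ofI.
        - now apply emb_Ord.
        - rewrite <- (emb_emp (gen:=gen)). now apply emb_mem'.
        - rewrite <- (emb_emp (gen:=gen)), <- emb_suc. now apply emb_mem'.
        - rewrite emb_prod_eq. now apply emb_cle.
        - exact (emb_succ_card en Hen so Hcl Hcc (gen:=gen) Ckap). }
      exact (locally_small_D _ _ so' (fun X t => ∃ k', succ_card (emb (gen:=gen) kap) k' ∧ card_le X k')).
Qed.
End Countable.

(** Properties of structures that are first-order, uniformly in the structure. *)
Definition FO (R : forall V : Type, (V -> V -> Prop) -> (nat -> V) -> Prop) : Prop :=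
  exists p : formula, forall V mem e, R V mem e <-> holds mem (inst p e).

Lemma fo_iff (R S : forall V : Type, (V -> V -> Prop) -> (nat -> V) -> Prop) :
  (forall V mem e, S V mem e <-> R V mem e) -> FO R -> FO S.
Proof. intros H [p K]. exists p. intros. now rewrite H. Qed.
Lemma fo_not R : FO R -> FO (fun V mem e => ~ R V mem e).
Proof. intros [p H]. exists (fNot p). intros. cbn. now rewrite H. Qed.
Lemma fo_and R S : FO R -> FO S -> FO (fun V mem e => R V mem e /\ S V mem e).
Proof. intros [p H] [q K]. exists (fAnd p q). intros. cbn. now rewrite H, K. Qed.
Lemma fo_or R S : FO R -> FO S -> FO (fun V mem e => R V mem e \/ S V mem e).
Proof.
  intros H K. apply fo_iff with (fun V mem e => ~ (~ R V mem e /\ ~ S V mem e)).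
  - intros. tauto.
  - auto using fo_not, fo_and.
Qed.
Lemma fo_imp (R S : forall V : Type, (V -> V -> Prop) -> (nat -> V) -> Prop) :
  FO R -> FO S -> FO (fun V mem e => R V mem e -> S V mem e).
Proof.
  intros H K. apply fo_iff with (fun V mem e => ~ (R V mem e /\ ~ S V mem e)).
  - intros. tauto.
  - auto using fo_not, fo_and.
Qed.
Lemma fo_all (R : forall V : Type, (V -> V -> Prop) -> V -> (nat -> V) -> Prop) :
  FO (fun V mem e => R V mem (e 0) (fun n => e (S n))) -> FO (fun V mem e => forall x, R V mem x e).
Proof.
  intros [p H]. exists (fAll p). intros V mem e. cbn. split; intros K x; specialize (K x); apply (H V mem (scons x e)); exact K.
Qed.
Lemma fo_ex (R : forall V : Type, (V -> V -> Prop) -> V -> (nat -> V) -> Prop) :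
  FO (fun V mem e => R V mem (e 0) (fun n => e (S n))) -> FO (fun V mem e => exists x, R V mem x e).
Proof.
  intro H. apply fo_iff with (fun V mem e => ~ forall x, ~ R V mem x e).
  - intros. split; [intros [x Hx] K; exact (K x Hx)|intro K; apply NNPP; intro N; apply K; eauto].
  - apply fo_not. apply (fo_all (fun V mem x e => ~ R V mem x e)). now apply fo_not.
Qed.
Lemma fo_ren R (r : nat -> nat) : FO R -> FO (fun V mem e => R V mem (fun n => e (r n))).
Proof. intros [p H]. exists (ren r p). intros. now rewrite H, inst_ren. Qed.

Lemma fo_holds f : ufm f -> FO (fun V mem e => holds mem (f V e)).
Proof.
  induction 1; cbn [holds].
  - exists (fMem i j). reflexivity.
  - exists (fEq i j). reflexivity.
  - now apply fo_not.
  - now apply fo_and.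
  - now apply fo_or.
  - now apply fo_imp.
  - now apply (fo_all (fun V mem x e => holds mem (f V x e))).
  - now apply (fo_ex (fun V mem x e => holds mem (f V x e))).
Qed.
(** Unlike [dfn_fc], this concerns structures that satisfy no axioms: the atomic cases are
    first-order as they stand, and the clauses of forcing are unfolded along the formula. *)
Lemma fo_fcs f i j k : ufm f -> FO (fun V mem e => fcs mem (e i) (e j) (e k) (f V e)).
Proof.
  (* For the induction, the set of conditions, its order and the current condition sit at indices 0,
     1 and 2, in front of the parameters of [f]. *)
  intro U. enough (H : FO (fun V mem e => fcs mem (e 0) (e 1) (e 2) (f V (fun n => e (3 + n))))).
  { exact (fo_ren _ (fun n => match n with 0 => i | 1 => j | 2 => k | S (S (S n)) => n end) H). }
  clear i j k. induction U; cbn [fcs].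
  - apply (fo_holds (fun A e => forces_mem (e 0) (e 1) (e 2) (e (3 + i)) (e (3 + j)))). uniform.
  - apply (fo_holds (fun A e => forces_eq (e 0) (e 1) (e 2) (e (3 + i)) (e (3 + j)))). uniform.
  - apply fo_all, fo_imp; [apply (fo_holds (fun A e => rel (e 2) (e 0) (e 3))); ufm|]. apply fo_not.
    exact (fo_ren _ (fun n => match n with 0 => 1 | 1 => 2 | 2 => 0 | S (S (S n)) => 4 + n end) IHU).
  - now apply fo_and.
  - apply fo_all, fo_imp; [apply (fo_holds (fun A e => rel (e 2) (e 0) (e 3))); ufm|].
    apply fo_ex, fo_and; [apply (fo_holds (fun A e => rel (e 3) (e 0) (e 1))); ufm|]. apply fo_or.
    + exact (fo_ren _ (fun n => match n with 0 => 2 | 1 => 3 | 2 => 0 | S (S (S n)) => 5 + n end) IHU1).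
    + exact (fo_ren _ (fun n => match n with 0 => 2 | 1 => 3 | 2 => 0 | S (S (S n)) => 5 + n end) IHU2).
  - apply fo_all, fo_imp; [apply (fo_holds (fun A e => rel (e 2) (e 0) (e 3))); ufm|]. apply fo_imp.
    + exact (fo_ren _ (fun n => match n with 0 => 1 | 1 => 2 | 2 => 0 | S (S (S n)) => 4 + n end) IHU1).
    + exact (fo_ren _ (fun n => match n with 0 => 1 | 1 => 2 | 2 => 0 | S (S (S n)) => 4 + n end) IHU2).
  - apply (fo_all (fun V mem x e => fcs mem (e 0) (e 1) (e 2) (f V x (fun n => e (3 + n))))).
    exact (fo_ren _ (fun n => match n with 0 => 1 | 1 => 2 | 2 => 3 | 3 => 0 | S (S (S (S n))) => 4 + n end) IHU).
  - apply fo_all, fo_imp; [apply (fo_holds (fun A e => rel (e 2) (e 0) (e 3))); ufm|].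
    apply fo_ex, fo_and; [apply (fo_holds (fun A e => rel (e 3) (e 0) (e 1))); ufm|].
    apply (fo_ex (fun V mem x e => fcs mem (e 2) (e 3) (e 0) (f V x (fun n => e (5 + n))))).
    exact (fo_ren _ (fun n => match n with 0 => 3 | 1 => 4 | 2 => 1 | 3 => 0 | S (S (S (S n))) => 6 + n end) IHU).
Qed.

Lemma fo_conclusion : FO (fun V mem e => conclusion V mem (e 0) (e 1) (e 2)).
Proof.
  unfold conclusion.
  repeat match goal with
  | |- FO (fun V mem e => holds mem _) => apply fo_holds; uniform
  | |- FO (fun V mem e => fcs mem _ _ _ (power_values _ _)) => apply fo_fcs, u_power_values
  | |- FO (fun V mem e => fcs mem _ _ _ (small_spaces_D _)) => apply fo_fcs, u_small_spaces_D
  | |- FO (fun V mem e => fcs mem _ _ _ _) => apply fo_fcs; uniform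
  | |- FO (fun V mem e => _ /\ _) => apply fo_and
  | |- FO (fun V mem e => exists _, _) => apply fo_ex
  | |- FO (fun V mem e => forall _ : V, _) => apply fo_all
  | |- FO (fun V mem e => _ -> _) => apply fo_imp
  end.
Qed.

(** Only finitely many parameters matter for one formula. This is why countably many Skolem values,
    indexed by coded tuples, are enough. *)
Lemma inst_bound (p : formula) : exists n, forall (A : Type) (e e' : nat -> A),
  (forall i, i < n -> e i = e' i) -> inst p e = inst p e'.
Proof.
  induction p as [i j|i j|p [n Hn]|p [n Hn] q [m Hm]|p [n Hn]].
  - exists (S (i + j)). intros A e e' H. cbn. now rewrite !H by lia.
  - exists (S (i + j)). intros A e e' H. cbn. now rewrite !H by lia.
  - exists n. intros A e e' H. cbn. now rewrite (Hn A e e').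
  - exists (n + m). intros A e e' H. cbn. rewrite (Hn A e e') by (intros i Hi; apply H; lia).
    now rewrite (Hm A e e') by (intros i Hi; apply H; lia).
  - exists n. intros A e e' H. cbn. f_equal. apply functional_extensionality; intro x. apply Hn.
    intros [|i] Hi; [reflexivity|]. cbn. apply H. lia.
Qed.

(** Iterated pairing: a number codes an infinite sequence, and any finite initial segment can be
    prescribed. *)
Fixpoint list_code (c i : nat) : nat :=
  match i with
  | 0 => fst (Cantor.of_nat c)
  | S i => list_code (snd (Cantor.of_nat c)) i
  end.
Lemma list_code_surj n : forall g, exists c, forall i, i < n -> list_code c i = g i.
Proof.
  induction n as [|n IH]; intro g; [exists 0; lia|].
  destruct (IH (fun i => g (S i))) as [c Hc]. exists (Cantor.to_nat (g 0, c)).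
  intros [|i] Hi; cbn [list_code]; rewrite Cantor.cancel_of_to; [reflexivity|]. apply Hc. lia.
Qed.
(** [n] bounds the depth of decoding, since the recursion is not structural in the code [c]; it is
    stored together with the code in [stage]. *)
Fixpoint formula_code (n c : nat) : formula :=
  match n with
  | 0 => fMem 0 0
  | S n =>
      let (t, c) := Cantor.of_nat c in
      let (a, b) := Cantor.of_nat c in
      match t with
      | 0 => fMem a b
      | 1 => fEq a b
      | 2 => fNot (formula_code n a)
      | 3 => fAnd (formula_code n a) (formula_code n b)
      | _ => fAll (formula_code n a)
      end
  end.
Lemma formula_code_surj p : exists n c, forall m, n <= m -> formula_code m c = p.
Proof.
  assert (K : forall n t a b, formula_code (S n) (Cantor.to_nat (t, Cantor.to_nat (a, b))) =
    match t with 0 => fMem a b | 1 => fEq a b | 2 => fNot (formula_code n a)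
    | 3 => fAnd (formula_code n a) (formula_code n b) | _ => fAll (formula_code n a) end).
  { intros. cbn [formula_code]. now rewrite !Cantor.cancel_of_to. }
  induction p as [i j|i j|p (n & c & H)|p (n & c & H) q (n' & c' & H')|p (n & c & H)].
  - exists 1, (Cantor.to_nat (0, Cantor.to_nat (i, j))). intros [|m] Hm; [lia|]. apply K.
  - exists 1, (Cantor.to_nat (1, Cantor.to_nat (i, j))). intros [|m] Hm; [lia|]. apply K.
  - exists (S n), (Cantor.to_nat (2, Cantor.to_nat (c, 0))). intros [|m] Hm; [lia|]. rewrite K, H by lia. reflexivity.
  - exists (S (n + n')), (Cantor.to_nat (3, Cantor.to_nat (c, c'))). intros [|m] Hm; [lia|].
    rewrite K, H, H' by lia. reflexivity.
  - exists (S n), (Cantor.to_nat (4, Cantor.to_nat (c, 0))). intros [|m] Hm; [lia|]. rewrite K, H by lia. reflexivity.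
Qed.

(** The Skolem hull of the [b n], enumerated in stages. *)
Section LowenheimSkolem.
Context {V : Type} (mem : V -> V -> Prop) (b : nat -> V).
(** Counterexamples are chosen instead of witnesses, because [fAll] is the only quantifier of
    [formula]. *)
Definition skolem (p : formula) (e : nat -> V) : V :=
  epsilon (inhabits (b 0)) (fun x => ~ holds mem (inst p (scons x e))).
(** Tag 0 repeats an element of the previous stage, so the stages increase; every other tag
    evaluates a coded Skolem function at a coded tuple of earlier elements. *)
Fixpoint stage (n : nat) : nat -> V :=
  match n with
  | 0 => b
  | S n => fun c =>
      let (t, c) := Cantor.of_nat c in
      match t with
      | 0 => stage n c
      | _ =>
        let (f, d) := Cantor.of_nat c in
        let (n', c') := Cantor.of_nat f in
        skolem (formula_code n' c') (fun i => stage n (list_code d i))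
      end
  end.
Definition hull (x : V) : Prop := exists n c, stage n c = x.
Lemma stage_mono n m c : n <= m -> exists c', stage m c' = stage n c.
Proof.
  intro H. induction H as [|m H [c' IH]]; [eauto|]. exists (Cantor.to_nat (0, c')).
  cbn [stage]. now rewrite Cantor.cancel_of_to.
Qed.
Lemma hull_common (e : nat -> V) n : (forall i, hull (e i)) -> exists m, forall i, i < n -> exists c, stage m c = e i.
Proof.
  intro H. induction n as [|n [m IH]]; [exists 0; lia|].
  destruct (H n) as (m' & c & Hc). exists (m + m'). intros i Hi.
  destruct (Nat.eq_dec i n) as [->|Ne].
  - destruct (stage_mono m' (m + m') c) as [c' E]; [lia|]. exists c'. congruence.
  - destruct (IH i) as [c0 E0]; [lia|]. destruct (stage_mono m (m + m') c0) as [c' E]; [lia|]. exists c'. congruence.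
Qed.
(** The finitely many relevant parameters occur in a common stage, so the Skolem value for them
    appears in the next one. *)
Lemma hull_skolem p (e : nat -> V) : (forall i, hull (e i)) -> (exists x, ~ holds mem (inst p (scons x e))) ->
  exists x, hull x /\ ~ holds mem (inst p (scons x e)).
Proof.
  intros H [x Hx]. destruct (inst_bound p) as [n Hn].
  destruct (hull_common e n H) as [m Hm].
  assert (G : exists g, forall i, i < n -> stage m (g i) = e i).
  { exists (fun i => epsilon (inhabits 0) (fun c => stage m c = e i)). intros i Hi. apply epsilon_spec. auto. }
  destruct G as [g Hg]. destruct (list_code_surj n g) as [d Hd].
  destruct (formula_code_surj p) as (n' & c' & Hp).
  set (e' := fun i => stage m (list_code d i)).
  assert (E : forall y, inst p (scons y e) = inst p (scons y e')).
  { intro y. apply Hn. intros [|i] Hi; [reflexivity|]. cbn. unfold e'. rewrite Hd, Hg by lia. reflexivity. }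
  exists (skolem p e'). split.
  - exists (S m), (Cantor.to_nat (1, Cantor.to_nat (Cantor.to_nat (n', c'), d))).
    cbn [stage]. rewrite !Cantor.cancel_of_to, Hp by lia. reflexivity.
  - rewrite E. unfold skolem. apply (epsilon_spec (inhabits (b 0)) (fun x => ~ holds mem (inst p (scons x e')))).
    exists x. now rewrite <- E.
Qed.

Definition hull_type : Type := { x : V | hull x }.
Definition hmem (x y : hull_type) : Prop := mem (proj1_sig x) (proj1_sig y).
(** The Tarski-Vaught criterion: a counterexample in [V] to a universal formula over the hull can be
    replaced by one in the hull. *)
Lemma elementary p : forall e : nat -> hull_type,
  holds hmem (inst p e) <-> holds mem (inst p (fun n => proj1_sig (e n))).
Proof.
  induction p; intro e; cbn [inst holds].
  - reflexivity.
  - split; [now intros ->|]. intro E. apply eq_sig_hprop; [intros; apply proof_irrelevance|exact E].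
  - now rewrite IHp.
  - now rewrite IHp1, IHp2.
  - assert (E : forall x : hull_type, inst p (fun n => proj1_sig (scons x e n)) = inst p (scons (proj1_sig x) (fun n => proj1_sig (e n)))).
    { intro x. f_equal. apply functional_extensionality; intros [|n]; reflexivity. }
    split; intros H x.
    + apply NNPP. intro N. destruct (hull_skolem p (fun n => proj1_sig (e n))) as (y & Hy & K); [intro i; apply (proj2_sig (e i))|eauto|].
      apply K. specialize (H (exist _ y Hy)). rewrite IHp, E in H. exact H.
    + rewrite IHp, E. apply H.
Qed.
Lemma elementary_fo R : FO R -> forall e : nat -> hull_type, R _ hmem e <-> R V mem (fun n => proj1_sig (e n)).
Proof. intros [p H] e. rewrite !H. apply elementary. Qed.
Lemma transfer f : ufm f -> forall e : nat -> hull_type,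
  holds hmem (f _ e) <-> holds mem (f V (fun n => proj1_sig (e n))).
Proof. intros U e. exact (elementary_fo _ (fo_holds f U) e). Qed.

Lemma hull_countable : exists en : nat -> hull_type, forall x, exists n, en n = x.
Proof.
  exists (fun n => exist hull (stage (fst (Cantor.of_nat n)) (snd (Cantor.of_nat n))) (ex_intro _ _ (ex_intro _ _ eq_refl))).
  intros [x (n & c & H)]. exists (Cantor.to_nat (n, c)). apply eq_sig_hprop; [intros; apply proof_irrelevance|].
  cbn -[Cantor.of_nat Cantor.to_nat]. now rewrite Cantor.cancel_of_to.
Qed.
Lemma hull_base n : hull (b n).
Proof. exists 0, n. reflexivity. Qed.
Definition base (n : nat) : hull_type := exist _ (b n) (hull_base n).
End LowenheimSkolem.

Lemma ufm_inst1 p i r : ufm (fun A e => inst p (scons (e i) (fun n => e (r n)))).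
Proof.
  replace (fun (A : Type) (e : nat -> A) => inst p (scons (e i) (fun n => e (r n))))
    with (fun (A : Type) (e : nat -> A) => inst p (fun n => e (match n with 0 => i | S n => r n end))); [apply ufm_inst|].
  apply functional_extensionality_dep; intro A. apply functional_extensionality; intro e.
  f_equal. apply functional_extensionality; intros [|n]; reflexivity.
Qed.
Lemma ufm_inst2 p i j r : ufm (fun A e => inst p (scons (e i) (scons (e j) (fun n => e (r n))))).
Proof.
  replace (fun (A : Type) (e : nat -> A) => inst p (scons (e i) (scons (e j) (fun n => e (r n)))))
    with (fun (A : Type) (e : nat -> A) => inst p (fun n => e (match n with 0 => i | 1 => j | S (S n) => r n end))); [apply ufm_inst|].
  apply functional_extensionality_dep; intro A. apply functional_extensionality; intro e.
  f_equal. apply functional_extensionality; intros [|[|n]]; reflexivity.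
Qed.
#[export] Hint Resolve ufm_inst1 ufm_inst2 : ufm.

(** * The countable hull as a model, and the final transfer *)

Section HullModel.
Context {V : Type} {E : V -> V -> Prop} (Z : ZFC E) (b : nat -> V).
Notation W := (hull_type E b).
Let e0 := base E b.

Definition hull_model : Model W.
Proof.
  refine {| mem := hmem E b |}.
  - refine (proj2 (transfer E b (fun A e => ∀ x y, (∀ z, z ∈ x ⇔ z ∈ y) ⇒ x ≡ y) _ e0) (zfc_extensionality E Z)). uniform.
  - refine (proj2 (transfer E b (fun A e => ∀ x, (∃ y, y ∈ x) ⇒ ∃[y ∈ x] ¬ ∃ z, z ∈ x ∧ z ∈ y) _ e0) (zfc_foundation E Z)). uniform.
  - refine (proj2 (transfer E b (fun A e => ∀ a b, ∃ c, is_upair a b c) _ e0) (zfc_pairing E Z)). uniform.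
  - refine (proj2 (transfer E b (fun A e => ∀ s, ∃ u, is_union s u) _ e0) (zfc_union E Z)). uniform.
  - refine (proj2 (transfer E b (fun A e => ∀ x, ∃ s, is_power x s) _ e0) (zfc_power E Z)). uniform.
  - refine (proj2 (transfer E b (fun A e => ∃ w, (∃[x ∈ w] empty x) ∧ ∀[x ∈ w] ∃[y ∈ w] is_succ x y) _ e0) (zfc_infinity E Z)). uniform.
  - intros p v.
    refine (proj2 (transfer E b (fun A e => ∀ a, ∃ b, ∀ x, x ∈ b ⇔ (x ∈ a ∧ inst p (scons x e))) _ v)
      (zfc_separation E Z p (fun n => proj1_sig (v n)))). uniform.
  - intros p v.
    refine (proj2 (transfer E b (fun A e => ∀ a, (∀[x ∈ a] ∃ y, inst p (scons x (scons y e)) ∧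
             ∀ y', inst p (scons x (scons y' e)) ⇒ y' ≡ y) ⇒
      ∃ b, ∀[x ∈ a] ∃[y ∈ b] inst p (scons x (scons y e))) _ v)
      (zfc_replacement E Z p (fun n => proj1_sig (v n)))). uniform.
Defined.
Lemma hull_choice : @Choice W hull_model.
Proof.
  refine (proj2 (transfer E b (fun A e => ∀ s, (∀[x ∈ s] ∃ z, z ∈ x) ⇒
      ∃ f u, is_union s u ∧ is_fun f s u ∧ ∀[x ∈ s] ∀ z, rel f x z ⇒ z ∈ x) _ e0) (zfc_choice E Z)). uniform.
Qed.
End HullModel.

Theorem theorem2p1 (V : Type) (mem : V -> V -> Prop) (hZFC : ZFC mem)
  (lam kap kap' mu : V)
  (hlam : holds mem (infinite_cardinal lam))
  (hlamlt : holds mem (card_exp_lt lam lam lam))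
  (hkap : holds mem (succ_card lam kap))
  (hkap' : holds mem (succ_card kap kap'))
  (hmu : holds mem (cardinal mu ∧ kap' ∈ mu))
  (hmuexp : holds mem (card_exp mu kap mu))
  (h2lam : holds mem (card_exp2 lam kap))
  (h2kap : holds mem (card_exp2 kap kap')) :
  exists Q : forcing mem,
    preserves_cofinalities Q /\
    preserves_cardinals Q /\
    adds_no_bounded_subsets Q kap /\
    exists l k m : V,
      check_name Q lam l /\ check_name Q kap k /\ check_name Q mu m /\
      holds_in_extension Q
        (∃ l', succ_card l l' ∧ card_exp2 l l' ∧ card_exp2 l' m) /\
      holds_in_extension Q
        (∀ X t,
           topology X t ∧ hausdorff X t ∧ locally_lt k X t ∧
           (∃ k', succ_card k k' ∧ card_le X k') ∧
           (∀ U0, ona X t U0 ⇒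
              ∃ U, ona X t U ∧ finer X U U0 ∧
                ∀[Y ∈ t] card_le Y k ⇒ subspace_kappa_D k t U Y) ⇒
           D_space X t).
Proof.
  (* The hull is generated by the four cardinals, which makes them the elements of index 0 to 3 of
     [base]; the value at larger indices only repeats [kap']. *)
  set (b := fun n => match n with 0 => lam | 1 => kap | 2 => mu | _ => kap' end).
  assert (H : conclusion V mem lam kap mu).
  (* The conclusion is first-order in the three cardinals, so it can be pulled back from the
     countable hull, where generic filters exist; the hypotheses travel in the other direction. *)
  { apply (elementary_fo mem b _ fo_conclusion (base mem b)).
    destruct (hull_countable mem b) as [en Hen].
    pose (M := hull_model hZFC b). pose (C := hull_choice hZFC b).
    apply (@countable_case _ M C en Hen _ _ (base mem b 3)).
    - refine (proj2 (transfer mem b (fun A e => infinite_cardinal (e 0)) _ (base mem b)) hlam). uniform.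
    - refine (proj2 (transfer mem b (fun A e => card_exp_lt (e 0) (e 0) (e 0)) _ (base mem b)) hlamlt). uniform.
    - refine (proj2 (transfer mem b (fun A e => succ_card (e 0) (e 1)) _ (base mem b)) hkap). uniform.
    - refine (proj2 (transfer mem b (fun A e => succ_card (e 1) (e 3)) _ (base mem b)) hkap'). uniform.
    - refine (proj2 (transfer mem b (fun A e => cardinal (e 2) ∧ e 3 ∈ e 2) _ (base mem b)) hmu). uniform.
    - refine (proj2 (transfer mem b (fun A e => card_exp (e 2) (e 1) (e 2)) _ (base mem b)) hmuexp). uniform.
    - refine (proj2 (transfer mem b (fun A e => card_exp2 (e 0) (e 1)) _ (base mem b)) h2lam). uniform. }
  destruct H as (P & lo & one & H0 & H1 & H2 & H3 & H4).
  exists {| conditions := P; order := lo; weakest := one; forcing_ok := H0 |}.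
  split; [exact H1|]. split; [exact H2|]. split; [exact H3|exact H4].
Qed.
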